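(* Let $n\ge3$ and let $(X_1,\ldots,X_n)$ be an $n$-tuple of (possibly unbounded) commuting self-adjoint operators acting on a complex separable infinite-dimensional Hilbert space $\mathcal{H}$. Suppose $T\in B(\mathcal{H})$ is such that $[T,X_j]\in\mathcal{C}_n^-$ for all $1\le j\le n$. Then, for any sequence $(\xi^{(k)})_{k\in\mathbb{N}}$ in $\mathbb{R}^n$ such that $|\xi^{(k)}|\to\infty$, the following strong limit exists: $$\operatorname*{s-lim}_{k\to\infty}\exp\Big(-i\sum_{j=1}^n\xi_j^{(k)}X_j\Big)\,T\,\exp\Big(i\sum_{j=1}^n\xi_j^{(k)}X_j\Big)E_{ac}(X_1,\ldots,X_n).$$
   Context: $\mathcal{C}_n^-$ is the Lorentz $(n,1)$ ideal: the compact operators $K$ on $\mathcal{H}$ with $|K|_n^-=\sum_{j\ge1}s_j(K)\,j^{-1+1/n}<\infty$, where $s_1(K)\ge s_2(K)\ge\cdots$ are the singular values of $K$ in decreasing order. ''Commuting'' for (possibly unbounded) self-adjoint operators means strongly commuting, i.e. their spectral measures commute. For $T$ bounded and $X_j$ possibly unbounded self-adjoint, $[T,X_j]\in\mathcal{C}_n^-$ means that $T$ maps the domain $D(X_j)$ into itself and that $TX_j-X_jT$, defined on $D(X_j)$, extends to an operator in $\mathcal{C}_n^-$. Exponentials of real linear combinations $\sum_j\xi_jX_j$ are the unitary operators given by the joint functional calculus. $E_{ac}(X_1,\ldots,X_n)$ is the orthogonal projection onto the Lebesgue absolutely continuous subspace: the closed subspace of vectors $h\in\mathcal{H}$ such that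 $\langle E(\cdot)h,h\rangle$ is absolutely continuous with respect to Lebesgue measure on $\mathbb{R}^n$, where $E$ is the joint spectral measure of $(X_1,\ldots,X_n)$ on $\mathbb{R}^n$. *)

(* Defs.v *)
From HB Require Import structures.
From mathcomp Require Import all_boot all_order all_algebra.
From mathcomp Require Import sesquilinear complex.
From mathcomp Require Import all_classical all_reals all_analysis.

Set Implicit Arguments.
Unset Strict Implicit.
Unset Printing Implicit Defensive.
Import Order.TTheory GRing.Theory Num.Theory.
Import numFieldNormedType.Exports.

Local Open Scope classical_set_scope.
Local Open Scope ring_scope.
Local Open Scope complex_scope.

(* The complex Hilbert spaces considered are complete normed modules [H] over
   [R[i]] with a positive definite hermitian form [dot], linear in its first
   argument, that induces the norm of [H].  Note that norms take values
   in [R[i]]. *)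

Section hilbert_space.
Context {R : realType} {H : completeNormedModType R[i]}.
Variable dot : {dot H for Num.conj}.

Definition dot_induces_norm := forall x : H, `|x| ^+ 2 = dot x x.

Definition separable_space := exists2 D : set H, countable D & dense D.

Definition has_dim (M : set H) (m : nat) := exists b : 'I_m -> H,
  (forall i, M (b i)) /\
  (forall h, M h -> exists! c : 'rV[R[i]]_m, h = \sum_i c 0 i *: b i).

Definition infinite_dimensional := forall m (b : 'I_m -> H),
  exists h, forall c : 'rV[R[i]]_m, h <> \sum_i c 0 i *: b i.

Definition bounded_operator (T : H -> H) := linear T /\ continuous T.

Definition compact_operator (K : H -> H) :=
  bounded_operator K /\ precompact (K @` [set h | `|h| <= 1]).

Definition adjoint (T : H -> H) : H -> H :=
  get [set S : H -> H | forall h k, dot (T h) k = dot h (S k)].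

Definition orthogonal_projection (M : set H) (h : H) : H :=
  get [set p | M p /\ forall m, M m -> dot (h - p) m = 0].

(* [s j] is the (j+1)-st singular value of the compact operator [K]: each
   [l > 0] occurs in [s] as often as the multiplicity of [l ^+ 2] as an
   eigenvalue of [K^* K], and [s] vanishes after the finitely many positive
   terms when [K] has finite rank. *)
Definition singular_values (K : H -> H) (s : nat -> R) :=
  [/\ forall j, 0 <= s j,
      nonincreasing_seq s &
      forall l : R, 0 < l -> exists2 m : nat,
        ([set j | s j = l] #= `I_m)%card &
        has_dim [set h | adjoint K (K h) = (l ^+ 2)%:C *: h] m].

Definition lorentz_ideal (n : nat) (K : H -> H) :=
  compact_operator K /\
  exists2 s : nat -> R, singular_values K s &
    (\sum_(0 <= j <oo) (s j * j.+1%:R `^ (-1 + n%:R^-1))%:E < +oo)%E.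

(* Values of [op_fun X] outside [op_dom X] are irrelevant. *)
Record operator := Operator { op_dom : set H ; op_fun :> H -> H }.

(* The last clause says that the adjoint of [X] is [X], domains included. *)
Definition self_adjoint (X : operator) :=
  [/\ op_dom X 0,
      (forall (a : R[i]) h k, op_dom X h -> op_dom X k ->
         op_dom X (a *: h + k) /\ X (a *: h + k) = a *: X h + X k),
      dense (op_dom X) &
      forall k y, (forall h, op_dom X h -> dot (X h) k = dot h y) <->
                  (op_dom X k /\ y = X k)].

Definition commutator_in (I : set (H -> H)) (T : H -> H) (X : operator) :=
  (forall h, op_dom X h -> op_dom X (T h)) /\
  exists2 K : H -> H, I K &
    forall h, op_dom X h -> T (X h) - X (T h) = K h.

Section projection_valued_measure.
Context {d : measure_display} {T : measurableType d}.
Implicit Type E : set T -> H -> H.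

Definition projection_valued_measure E :=
  [/\ (forall A, measurable A ->
         [/\ bounded_operator (E A),
             forall h, E A (E A h) = E A h &
             forall h k, dot (E A h) k = dot h (E A k)]),
      (forall h, E setT h = h),
      (forall A B, measurable A -> measurable B ->
         forall h, E (A `&` B) h = E A (E B h)) &
      (forall F : nat -> set T, (forall k, measurable (F k)) ->
         trivIset setT F -> forall h,
         series (fun k => E (F k) h) @ \oo --> E (\bigcup_k F k) h)].

(* the measure <E(.)h, h> *)
Definition diag_measure E (h : H) (A : set T) : \bar R :=
  (complex.Re (dot (E A h) h))%:E.

(* The bounded operator \int f dE for a bounded measurable [f]; it is
   determined by its quadratic form. *)
Definition spectral_integral E (f : T -> R[i]) : H -> H :=
  get [set U : H -> H | bounded_operator U /\ forall h,
    dot (U h) h =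
      fine (\int[diag_measure E h]_x (complex.Re (f x))%:E)%E +i*
      fine (\int[diag_measure E h]_x (complex.Im (f x))%:E)%E].

End projection_valued_measure.

(* [F] is the projection-valued measure with X = \int t dF(t). *)
Definition spectral_measure (X : operator)
    (F : set (measurableTypeR R) -> H -> H) :=
  [/\ projection_valued_measure F,
      (forall h, op_dom X h <->
         (\int[diag_measure F h]_t (t ^+ 2)%:E < +oo)%E) &
      (forall h, op_dom X h ->
         dot (X h) h = (fine (\int[diag_measure F h]_t t%:E)%E)%:C)].

Definition strongly_commute (X Y : operator) := forall F G,
  spectral_measure X F -> spectral_measure Y G ->
  forall A B, measurable A -> measurable B ->
  forall h, F A (G B h) = G B (F A h).

Section joint_spectral_measure.
Context {n : nat}.
Implicit Type E : set (n.-tuple (measurableTypeR R)) -> H -> H.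

Definition joint_spectral_measure (X : 'I_n -> operator) E :=
  projection_valued_measure E /\
  forall j, spectral_measure (X j) (fun B => E [set x | B (tnth x j)]).

(* exp (i \sum_j a_j X_j), where [E] is the joint spectral measure of [X] *)
Definition joint_expi E (a : 'rV[R]_n) : H -> H :=
  spectral_integral E (fun x =>
    let t : R := \sum_j a 0 j * tnth x j in cos t +i* sin t).

End joint_spectral_measure.
End hilbert_space.

Arguments operator {R} H.
Arguments separable_space {R} H.
Arguments infinite_dimensional {R} H.

(* n-dimensional Lebesgue measure, as an iterated product measure *)
Fixpoint lebesgue_tuple {R : realType} (n : nat) :
    set (n.-tuple (measurableTypeR R)) -> \bar R :=
  match n with
  | 0 => fun A => \d_ [tuple] A
  | m.+1 => fun A =>
      (\int[lebesgue_measure]_(x in [set: measurableTypeR R])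
         lebesgue_tuple [set t : m.-tuple (measurableTypeR R) |
                          A [tuple of x :: t]])%E
  end.

Definition ac_subspace {R : realType} {H : completeNormedModType R[i]}
    (dot : {dot H for Num.conj}) (n : nat)
    (E : set (n.-tuple (measurableTypeR R)) -> H -> H) : set H :=
  [set h | diag_measure dot E h `<< @lebesgue_tuple R n].

Definition E_ac {R : realType} {H : completeNormedModType R[i]}
    (dot : {dot H for Num.conj}) (n : nat)
    (E : set (n.-tuple (measurableTypeR R)) -> H -> H) : H -> H :=
  orthogonal_projection dot (ac_subspace dot E).

Definition euclidean_norm {R : realType} {n : nat} (a : 'rV[R]_n) : R :=
  Num.sqrt (\sum_j a 0 j ^+ 2).

(* Main.v *)
(* Let U_a = exp(i sum_j a_j X_j) and F(a) h = U_{-a} T U_a h.  By Duhamel's formula,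
   |F(a + t e_j) h - F(a) h| is at most t times the supremum of |K_j U_b h| over the segment
   from a to a + t e_j, where K_j = [T, X_j].

   Suppose that the joint spectral measure of h has compact support and a bounded density.
   On any lattice, the Fourier series on a large box and duality give the Bessel inequality
   sum_m |<U_m h, e>|^2 <= C |e|^2.  Cutting K_j at its N-th singular value s_N, the mean of
   |K_j U_{a+m} h| over a box of L^n lattice points is thus at most
   C (L^-n sum_{i<N} s_i^2)^(1/2) + s_N |h|, uniformly in a.  For N = L^n and L = 2^i, the
   products of these bounds with L are summable in i, since K_j is in the Lorentz ideal and
   n >= 3.  Hence the averages A_L F(a) h over boxes of side L = 2^i converge as i grows,
   uniformly in a.  As A_L F(a) h - A_L F(b) h tends to 0 for fixed a and b, while
   A_L F(a_k) h - F(a_k) h tends to 0 for fixed L when a_k goes to infinity (K_j is compact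
   and U_{a_k} h tends weakly to 0), the sequence F(a_k) h is Cauchy.

   By the Radon-Nikodym theorem such vectors h are dense in the absolutely continuous
   subspace, and the operators F(a) are uniformly bounded. *)

Require Import Defs.
From HB Require Import structures.
From mathcomp Require Import all_boot all_order all_algebra.
From mathcomp Require Import sesquilinear complex.
From mathcomp Require Import all_classical all_reals all_analysis.
From mathcomp Require Import measurable_realfun.
From mathcomp Require Import ring lra.
Import Order.TTheory GRing.Theory Num.Theory.
Import numFieldNormedType.Exports.
Set Implicit Arguments.
Unset Strict Implicit.
Unset Printing Implicit Defensive.
Local Open Scope classical_set_scope.
Local Open Scope ring_scope.
Local Open Scope complex_scope.

(** Two scales shape the argument. On the dyadic blocks up to [2^(in)] the Lorentz weights
    [j^(-1+1/n)] add up to about [2^i], so [2^i] times the singular value at [2^(in)] is summable.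
    The quadratic mean of the first [2^(in)] singular values, times [2^i], obeys a recursion with
    ratio [2 / 2^(n/2)] up to such summable terms, and this ratio is below 1 from [n = 3] on. An
    arbitrary sequence lies on no lattice. As [F(a) h] is Lipschitz in [a], the sequence is rounded
    to the lattice of mesh [1/(p+1)], with [p] dictated by the precision; the Fourier box is
    enlarged until its half-side times the mesh is a multiple of [pi]. The [X_j] are unbounded, and
    the exponentials are specified by quadratic forms only. The functional calculus is therefore
    described locally in norm ([calculus]), which makes products and uniqueness accessible.
    Duhamel's formula is proved as an inequality, without vector-valued integrals: on the range of a
    spectral slab [|x_j| <= r] everything is bounded, small Taylor steps are added up, and the slab
    is removed by density. *)

Lemma harmonic_lt {R : realType} (e : R) : 0 < e ->
  exists N, forall k, (N <= k)%N -> k.+1%:R^-1 < e.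
Proof.
move=> e0; have /cvgrPdist_lt/(_ e e0)[N _ hN] := @cvg_harmonic R.
exists N => k /hN /=.
by rewrite /harmonic sub0r normrN ger0_norm// invr_ge0.
Qed.

(** * Complex modulus, linear maps and the norm *)

Section complex_modulus.
Context {R : realType}.
Implicit Types z w : R[i].

Definition cmod z : R := complex.Re `|z|.

Lemma cmodE z : `|z| = (cmod z)%:C.
Proof. by rewrite /cmod normc_def. Qed.

Lemma cmod_ge0 z : 0 <= cmod z.
Proof. by rewrite -ler0c -cmodE. Qed.

Lemma cmodM z w : cmod (z * w) = cmod z * cmod w.
Proof. by apply: complexI; rewrite rmorphM /= -!cmodE normrM. Qed.

Lemma cmodD z w : cmod (z + w) <= cmod z + cmod w.
Proof. by rewrite -lecR rmorphD /= -!cmodE ler_normD. Qed.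

Lemma cmodN z : cmod (- z) = cmod z.
Proof. by rewrite /cmod normrN. Qed.

Lemma cmod0 : cmod 0 = 0.
Proof. by rewrite /cmod normr0. Qed.

Lemma cmod1 : cmod 1 = 1.
Proof. by rewrite /cmod normr1. Qed.

Lemma cmod_real (a : R) : cmod a%:C = `|a|.
Proof. by apply: complexI; rewrite -cmodE normc_def /= expr0n addr0 sqrtr_sqr. Qed.

Lemma cmod_nat n : cmod n%:R = n%:R.
Proof.
have -> : n%:R = (n%:R : R)%:C :> R[i] by rewrite rmorph_nat.
by rewrite cmod_real ger0_norm.
Qed.

Lemma cmod_sqr z : cmod z ^+ 2 = complex.Re z ^+ 2 + complex.Im z ^+ 2.
Proof. by apply: complexI; rewrite add_Re2_Im2 cmodE rmorphXn. Qed.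

Lemma cmod_conj z : cmod (conjc z) = cmod z.
Proof. by rewrite /cmod normcJ. Qed.

Lemma Re_le_cmod z : `|complex.Re z| <= cmod z.
Proof. by rewrite -lecR -cmodE normc_ge_Re. Qed.

Lemma cmod_eq0 z : cmod z = 0 -> z = 0.
Proof. by move=> z0; apply/normr0_eq0; rewrite cmodE z0. Qed.

Lemma mulc_conj z : z * conjc z = (cmod z ^+ 2)%:C.
Proof. by rewrite -sqr_normc cmodE rmorphXn. Qed.

Lemma conjM z w : conjc (z * w) = conjc z * conjc w.
Proof. exact: rmorphM. Qed.

Lemma conj_scale (t : R) z : conjc (t%:C * z) = t%:C * conjc z.
Proof. by rewrite conjM; congr (_ * _); rewrite /= oppr0. Qed.

Lemma conj_scale1 (t : R) z : conjc t%:C * z = t%:C * z.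
Proof. by congr (_ * _); rewrite /= oppr0. Qed.

Lemma cmodi : cmod 'i = 1.
Proof. by apply/eqP; rewrite -sqrp_eq1 ?cmod_ge0// cmod_sqr /= expr0n expr1n add0r. Qed.

Lemma ReD z w : complex.Re (z + w) = complex.Re z + complex.Re w.
Proof. by case: z; case: w. Qed.

Lemma ReN z : complex.Re (- z) = - complex.Re z.
Proof. by case: z. Qed.

Lemma Re_sum (I : Type) (r : seq I) (P : pred I) (F : I -> R[i]) :
  complex.Re (\sum_(i <- r | P i) F i) = \sum_(i <- r | P i) complex.Re (F i).
Proof. by elim/big_ind2 : _ => // x1 x2 y1 y2 <- <-; rewrite ReD. Qed.

End complex_modulus.

Section linear_map.
Context {K : nzRingType} {U V : lmodType K} (T : U -> V).
Hypothesis lT : linear T.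

Lemma lin0 : T 0 = 0.
Proof. by apply: (addrI (T 0)); have := lT 1 0 0; rewrite !scale1r !addr0. Qed.

Lemma linD x y : T (x + y) = T x + T y.
Proof. by have := lT 1 x y; rewrite !scale1r. Qed.

Lemma linZ a x : T (a *: x) = a *: T x.
Proof. by have := lT a x 0; rewrite lin0 !addr0. Qed.

Lemma linN x : T (- x) = - T x.
Proof. by rewrite -scaleN1r linZ scaleN1r. Qed.

Lemma linB x y : T (x - y) = T x - T y.
Proof. by rewrite linD linN. Qed.

Lemma lin_sum (I : Type) (r : seq I) (P : pred I) (F : I -> U) :
  T (\sum_(i <- r | P i) F i) = \sum_(i <- r | P i) T (F i).
Proof. by elim/big_rec2 : _ => [|i x y _ <-]; rewrite ?lin0// linD. Qed.

End linear_map.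

Section hilbert_norm.
Context {R : realType} {H : completeNormedModType R[i]}.
Implicit Types x y : H.

(** The norm of [H] takes values in [R[i]], whose order is partial; all estimates go through this
    real copy of it, and [cmod] plays the same role for scalars. *)
Definition nr x : R := complex.Re `|x|.

Lemma nrE x : `|x| = (nr x)%:C.
Proof.
have : 0 <= `|x| by [].
by rewrite /nr lecE /= => /andP[/eqP]; case: `|x| => a b /= -> _.
Qed.

Lemma nr_ge0 x : 0 <= nr x.
Proof. by rewrite -ler0c -nrE. Qed.

Lemma nr0 : nr (0 : H) = 0.
Proof. by rewrite /nr normr0. Qed.

Lemma nr_eq0 x : nr x = 0 -> x = 0.
Proof. by move=> h; apply/normr0_eq0; rewrite nrE h. Qed.

Lemma nrN x : nr (- x) = nr x.
Proof. by rewrite /nr normrN. Qed.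

Lemma nrBC x y : nr (x - y) = nr (y - x).
Proof. by rewrite -nrN opprB. Qed.

Lemma nrD x y : nr (x + y) <= nr x + nr y.
Proof. by rewrite -lecR rmorphD /= -!nrE ler_normD. Qed.

Lemma nrB x y : nr (x - y) <= nr x + nr y.
Proof. by rewrite -[nr y]nrN nrD. Qed.

Lemma nr_tri z x y : nr (x - y) <= nr (x - z) + nr (z - y).
Proof. by rewrite -[x - y](subrKA z) nrD. Qed.

Lemma nrZ (a : R[i]) x : nr (a *: x) = cmod a * nr x.
Proof. by apply: complexI; rewrite rmorphM /= -nrE -cmodE -nrE normrZ. Qed.

Lemma nrZR (a : R) x : nr (a%:C *: x) = `|a| * nr x.
Proof. by rewrite nrZ cmod_real. Qed.

Lemma nr_sum (I : Type) (r : seq I) (P : pred I) (F : I -> H) :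
  nr (\sum_(i <- r | P i) F i) <= \sum_(i <- r | P i) nr (F i).
Proof.
elim/big_ind2 : _ => [||//]; first by rewrite nr0.
by move=> x1 x2 y1 y2 h1 h2; apply: (le_trans (nrD _ _)); rewrite lerD.
Qed.

Lemma nr_dist x y : `|nr x - nr y| <= nr (x - y).
Proof.
have h a b : nr a - nr b <= nr (a - b).
  by rewrite lerBlDr -{1}[a](subrK b) nrD.
by rewrite ler_norml h andbT lerNl opprB nrBC h.
Qed.

Lemma gt0_complex (e : R[i]) : 0 < e -> exists2 r : R, 0 < r & e = r%:C.
Proof.
case: e => a b; rewrite ltcE /= => /andP[/eqP -> a0].
by exists a.
Qed.

Lemma cvgnrP (f : nat -> H) (l : H) :
  (f @ \oo --> l) <->
  (forall e : R, 0 < e -> exists N, forall k, (N <= k)%N -> nr (f k - l) < e).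
Proof.
split=> [/cvgrPdist_lt h e e0|h].
  have e0' : 0 < e%:C by rewrite ltcR.
  case: (h _ e0') => N _ hN; exists N => k Nk.
  by have := hN k Nk; rewrite /= nrE ltcR nrBC.
apply/cvgrPdist_lt => _ /gt0_complex[e e0 ->].
have [N hN] := h e e0.
by exists N => // k /= Nk; rewrite nrE ltcR nrBC hN.
Qed.

Lemma nr_complete (f : nat -> H) :
  (forall e : R, 0 < e -> exists N, forall k l, (N <= k)%N -> (N <= l)%N ->
     nr (f k - f l) < e) ->
  exists l : H, f @ \oo --> l.
Proof.
move=> h; suff : cvg (f @ \oo) by move=> fc; exists (lim (f @ \oo)).
apply/cauchy_cvgP/cauchy_ballP => _ /gt0_complex[e e0 ->].
have [N hN] := h e e0.
exists (f @` [set k | (N <= k)%N], f @` [set k | (N <= k)%N]) => /=.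
  by split; exists N => // k Nk; exists k.
move=> [_ _] /= [[k Nk <-] [l Nl <-]].
by rewrite -ball_normE /= nrE ltcR hN.
Qed.

Lemma cvg_nr_unique (f : nat -> H) (l l' : H) :
  f @ \oo --> l -> f @ \oo --> l' -> l = l'.
Proof. by move=> /(cvg_lim (@norm_hausdorff _ _)) <- /(cvg_lim (@norm_hausdorff _ _)) <-. Qed.

Lemma bounded_operatorP (T : H -> H) :
  bounded_operator T <->
  linear T /\ exists2 M : R, 0 <= M & forall x, nr (T x) <= M * nr x.
Proof.
split=> -[lT].
  move=> cT; split=> //.
  pose L := GRing.isLinear.Build _ _ _ _ T lT.
  pose f : {linear H -> H} := HB.pack T L.
  have /linear_bounded_continuous/linear_boundedP : continuous f by [].
  case=> M [Mr hM].
  have : M < `|M| + 1 by rewrite (le_lt_trans (real_ler_norm Mr))// ltrDl.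
  move=> /hM; rewrite cmodE => {}hM; exists (cmod M + 1); first by rewrite addr_ge0 ?cmod_ge0.
  by move=> x; have := hM x; rewrite !nrE -lecR !rmorphM rmorphD.
case=> M M0 hM; split=> // x.
apply/(@cvgrPdist_lt _ _ _ (nbhs x)) => _ /gt0_complex[e e0 ->].
apply/nbhs_normP; exists (e / (M + 1))%:C.
  by rewrite /= ltcR divr_gt0// ltr_wpDl.
move=> y /=; rewrite nrE ltcR => xy.
have -> : T x - T y = T (x - y).
  exact/esym/(linB lT).
rewrite nrE ltcR (le_lt_trans (hM _))//.
rewrite ltr_pdivlMr ?ltr_wpDl// in xy.
apply: le_lt_trans xy; rewrite mulrC ler_wpM2l ?nr_ge0//.
by rewrite lerDl.
Qed.

End hilbert_norm.

(** * Inner product, projections and adjoints *)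

Section inner_product.
Context {R : realType} {H : completeNormedModType R[i]}.
Variable dot : {dot H for Num.conj}.
Hypothesis hdot : dot_induces_norm dot.
Implicit Types x y z : H.

Lemma dotC x y : dot x y = conjc (dot y x).
Proof. by rewrite hermC expr0 mul1r. Qed.

Lemma dotDl x y z : dot (x + y) z = dot x z + dot y z.
Proof. exact: linearDl. Qed.

Lemma dotDr x y z : dot x (y + z) = dot x y + dot x z.
Proof. exact: linearDr. Qed.

Lemma dotNr x z : dot x (- z) = - dot x z.
Proof. exact: linearNr. Qed.

Lemma dotBl x y z : dot (x - y) z = dot x z - dot y z.
Proof. exact: linearBl. Qed.

Lemma dotBr x y z : dot x (y - z) = dot x y - dot x z.
Proof. exact: linearBr. Qed.

Lemma dotZl a x y : dot (a *: x) y = a * dot x y.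
Proof. exact: linearZl_LR. Qed.

Lemma dotZr a x y : dot x (a *: y) = conjc a * dot x y.
Proof. exact: linearZr_LR. Qed.

Lemma dot0l z : dot 0 z = 0.
Proof. exact: linear0l. Qed.

Lemma dot0r z : dot z 0 = 0.
Proof. exact: linear0r. Qed.

Lemma dot_suml (I : Type) (r : seq I) (P : pred I) (F : I -> H) z :
  dot (\sum_(i <- r | P i) F i) z = \sum_(i <- r | P i) dot (F i) z.
Proof. by elim/big_rec2 : _ => [|i x y _ <-]; rewrite ?dot0l// dotDl. Qed.

Lemma dot_sumr (I : Type) (r : seq I) (P : pred I) (F : I -> H) z :
  dot z (\sum_(i <- r | P i) F i) = \sum_(i <- r | P i) dot z (F i).
Proof. by elim/big_rec2 : _ => [|i x y _ <-]; rewrite ?dot0r// dotDr. Qed.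

Lemma dotxx x : dot x x = (nr x ^+ 2)%:C.
Proof. by rewrite -hdot nrE rmorphXn. Qed.

Lemma nrD_sqr x y : nr (x + y) ^+ 2 = nr x ^+ 2 + nr y ^+ 2 + 2 * complex.Re (dot x y).
Proof.
have e z : nr z ^+ 2 = complex.Re (dot z z) by rewrite dotxx.
rewrite !e dotDl !dotDr !ReD (dotC y x).
by case: (dot x y) => a b /=; ring.
Qed.

Lemma nrB_sqr x y : nr (x - y) ^+ 2 = nr x ^+ 2 + nr y ^+ 2 - 2 * complex.Re (dot x y).
Proof. by rewrite nrD_sqr nrN dotNr ReN mulrN. Qed.

Lemma parallelogram x y :
  nr (x + y) ^+ 2 + nr (x - y) ^+ 2 = 2 * nr x ^+ 2 + 2 * nr y ^+ 2.
Proof. by rewrite nrD_sqr nrB_sqr; ring. Qed.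

Lemma nr_sub_proj x y (t : R) :
  nr (x - (t%:C * dot x y) *: y) ^+ 2 =
  nr x ^+ 2 - (2 * t - t ^+ 2 * nr y ^+ 2) * cmod (dot x y) ^+ 2.
Proof.
rewrite nrB_sqr nrZ dotZr conj_scale -mulrA [conjc _ * _]mulrC mulc_conj.
rewrite -rmorphM /= cmodM cmod_real !exprMn real_normK ?num_real//.
by ring.
Qed.

(** The inequality behind both Cauchy-Schwarz (with [D = 0]) and the orthogonality of a nearest
    point: when [D] is at least the squared norm of [x], it forces [dot x y = 0]. *)
Lemma cmod_dot_sqr_le x y (D : R) : y != 0 ->
  (forall a, D <= nr (x - a *: y) ^+ 2) ->
  cmod (dot x y) ^+ 2 <= (nr x ^+ 2 - D) * nr y ^+ 2.
Proof.
move=> y0 hD.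
have ny : 0 < nr y.
  by rewrite lt0r nr_ge0 andbT; apply: contra_neq y0; exact: nr_eq0.
(* This is the multiple of [y] nearest to [x]: the quadratic in [t] of [nr_sub_proj] is optimal at
   [t = nr y ^- 2]. *)
have := hD ((nr y ^- 2)%:C * dot x y).
rewrite nr_sub_proj.
rewrite (_ : 2 * nr y ^- 2 - _ = nr y ^- 2); last by field; rewrite gt_eqF.
by rewrite lerBrDr addrC -lerBrDr mulrC ler_pdivrMr ?exprn_gt0.
Qed.

Lemma cauchy_schwarz x y : cmod (dot x y) <= nr x * nr y.
Proof.
have [->|y0] := eqVneq y 0; first by rewrite dot0r cmod0 nr0 mulr0.
rewrite -(@ler_pXn2r _ 2)// ?nnegrE ?cmod_ge0 ?mulr_ge0 ?nr_ge0// exprMn.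
rewrite -[X in _ <= X * _]subr0; apply: cmod_dot_sqr_le => // a.
by rewrite exprn_ge0// nr_ge0.
Qed.

Lemma Re_dot_le x y : `|complex.Re (dot x y)| <= nr x * nr y.
Proof. exact: le_trans (Re_le_cmod _) (cauchy_schwarz _ _). Qed.

Lemma dot_eq0C x y : dot x y = 0 -> dot y x = 0.
Proof. by move=> h; rewrite dotC h conjc0. Qed.

Lemma pythagoras x y : dot x y = 0 -> nr (x + y) ^+ 2 = nr x ^+ 2 + nr y ^+ 2.
Proof. by move=> h; rewrite nrD_sqr h /= mulr0 addr0. Qed.

Lemma pythagoras_sum (I : eqType) (r : seq I) (F : I -> H) : uniq r ->
  (forall i j, i != j -> dot (F i) (F j) = 0) ->
  nr (\sum_(i <- r) F i) ^+ 2 = \sum_(i <- r) nr (F i) ^+ 2.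
Proof.
move=> + h; elim: r => [|i r ih] /=; first by rewrite !big_nil nr0 expr0n.
case/andP => ir ur; rewrite !big_cons pythagoras ?ih//.
rewrite dot_sumr big_seq big1// => j jr; apply: h.
by apply: contraNneq ir => ->.
Qed.

Lemma dot_ext x y : (forall z, dot x z = dot y z) -> x = y.
Proof.
move=> h; apply/eqP; rewrite -subr_eq0; apply/eqP/nr_eq0/eqP.
by rewrite -sqrf_eq0 -(inj_eq (@complexI R)) -dotxx dotBl h subrr.
Qed.

Lemma dot_extr x y : (forall z, dot z x = dot z y) -> x = y.
Proof. by move=> h; apply: dot_ext => z; rewrite dotC h -dotC. Qed.

Lemma cvg_dotl (f : nat -> H) (l z : H) : f @ \oo --> l ->
  forall e : R, 0 < e -> exists N, forall k, (N <= k)%N -> cmod (dot (f k) z - dot l z) < e.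
Proof.
move=> /cvgnrP h e e0.
have [|N hN] := h (e / (nr z + 1)); first by rewrite divr_gt0// ltr_wpDl// nr_ge0.
exists N => k Nk; rewrite -dotBl (le_lt_trans (cauchy_schwarz _ _))//.
have := hN k Nk; rewrite ltr_pdivlMr ?ltr_wpDl ?nr_ge0//; apply: le_lt_trans.
by rewrite ler_wpM2l ?nr_ge0// lerDl.
Qed.

Definition closed_subspace (M : set H) := [/\ M 0,
  (forall a x y, M x -> M y -> M (a *: x + y)) &
  (forall (f : nat -> H) (l : H), (forall k, M (f k)) -> f @ \oo --> l -> M l)].

(** A minimizing sequence for the distance from [h] to [M] is Cauchy by the parallelogram law, since
    midpoints stay in [M]. Its limit [p] attains the distance, and minimality along the lines
    through [p] gives orthogonality. *)
Lemma projection_exists (M : set H) h : closed_subspace M ->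
  exists p, M p /\ forall m, M m -> dot (h - p) m = 0.
Proof.
case=> M0 Ml Mc.
pose S := [set nr (h - m) ^+ 2 | m in M].
have S0 : S !=set0 by exists (nr (h - 0) ^+ 2); exists 0.
have Slb : has_lbound S by exists 0 => _ [m _ <-]; rewrite exprn_ge0// nr_ge0.
pose D := inf S.
have Dle m : M m -> D <= nr (h - m) ^+ 2 by move=> Mm; apply: ge_inf => //; exists m.
have /choice[f hf] k : exists m, M m /\ nr (h - m) ^+ 2 < D + k.+1%:R^-1.
  have [|_ [m Mm <-] hm] := @inf_adherent _ S k.+1%:R^-1 _ (conj S0 Slb).
    by rewrite invr_gt0.
  by exists m.
have fd k l : nr (f k - f l) ^+ 2 <= 2 * k.+1%:R^-1 + 2 * l.+1%:R^-1.
  have := parallelogram (h - f k) (h - f l).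
  have -> : h - f k - (h - f l) = - (f k - f l) by rewrite opprB addrC subrKA opprB.
  rewrite nrN.
  have -> : h - f k + (h - f l) = 2%:R *: (h - 2^-1 *: (f k + f l)).
    rewrite scalerBr scalerA divff// scale1r scaler_nat mulr2n.
    by rewrite addrACA opprD.
  have := Dle (2^-1 *: (f k + f l)) _.
  rewrite nrZ exprMn.
  rewrite cmod_nat.
  move=> /(_ _)/[dup] hD; have [Mk hk] := hf k; have [Ml' hl] := hf l.
  have Mm : M (2^-1 *: (f k + f l)).
    rewrite -[_ *: _]addr0; apply: (Ml) => //.
    by rewrite -[f k]scale1r; apply: Ml.
  move=> /(_ Mm); move: hk hl.
  set u := nr (h - f k) ^+ 2; set v := nr (h - f l) ^+ 2.
  set A := nr (h - _) ^+ 2; set B := nr (f k - f l) ^+ 2.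
  move: (k.+1%:R^-1) (l.+1%:R^-1) => a b.
  by move=> ? ? ? ?; lra.
have [p fp] : exists p : H, f @ \oo --> p.
  apply: nr_complete => e e0.
  have [|N hN] := @harmonic_lt R (e ^+ 2 / 4); first by rewrite divr_gt0// exprn_gt0.
  exists N => k l /hN hk /hN hl.
  rewrite -(@ltr_pXn2r _ 2) ?nnegrE ?nr_ge0 ?ltW//.
  apply: le_lt_trans (fd k l) _.
  by move: (k.+1%:R^-1) (l.+1%:R^-1) hk hl => a b ? ?; lra.
have Mp : M p by apply: Mc fp => k; have [] := hf k.
(* The squared norm of [h - f k] is expanded around [p]; the constant [4 * (nr (h - p) + 1)] keeps
   the cross term below [e / 2]. *)
have pD : nr (h - p) ^+ 2 <= D.
  suff key (e : R) : 0 < e -> nr (h - p) ^+ 2 <= D + e by apply/ler_addgt0Pr.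
  move=> e0.
  have nrp := nr_ge0 (h - p).
  have [|N1 hN1] := @harmonic_lt R (e / 2); first by rewrite divr_gt0.
  have e'0 : 0 < e / (4 * (nr (h - p) + 1)) by rewrite divr_gt0// mulr_gt0// ltr_wpDl.
  have /cvgnrP /(_ _ e'0) [N2 hN2] := fp.
  pose k := maxn N1 N2.
  have h1 := hN1 k (leq_maxl _ _); have h2 := hN2 k (leq_maxr _ _).
  have [_ h3] := hf k.
  have h4 := nrD_sqr (h - p) (p - f k).
  rewrite subrKA in h4.
  have h5 := Re_dot_le (h - p) (p - f k).
  rewrite ler_norml nrBC in h5; case/andP : h5 => h5 _.
  have h6 : nr (h - p) * nr (f k - p) <= e / 4.
    rewrite ltr_pdivlMr ?mulr_gt0// ?ltr_wpDl// in h2.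
    have := nr_ge0 (f k - p).
    by move: h2; set a := nr (f k - p); set b := nr (h - p) => ? ?; lra.
  have h7 : 0 <= nr (p - f k) ^+ 2 by rewrite exprn_ge0// nr_ge0.
  rewrite h4 in h3; move: h1 h3 h5 h6 h7.
  move: (complex.Re _) (k.+1%:R^-1) (nr (h - p) * _) (nr (h - p) ^+ 2) (_ ^+ 2).
  by move=> ? ? ? ? ? ? ? ? ? ?; lra.
exists p; split=> // m Mm.
have [->|m0] := eqVneq m 0; first by rewrite dot0r.
have h8 : cmod (dot (h - p) m) ^+ 2 <= (nr (h - p) ^+ 2 - D) * nr m ^+ 2.
  apply: cmod_dot_sqr_le => // a; rewrite -addrA -opprD addrC [p + _]addrC.
  by rewrite addrC; apply: Dle; exact: Ml.
apply: cmod_eq0; apply/eqP; rewrite -sqrf_eq0 eq_le exprn_ge0 ?cmod_ge0// andbT.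
by rewrite (le_trans h8)// mulr_le0_ge0 ?exprn_ge0 ?nr_ge0// subr_le0.
Qed.

Lemma projection_unique (M : set H) h p q : closed_subspace M ->
  M p -> (forall m, M m -> dot (h - p) m = 0) ->
  M q -> (forall m, M m -> dot (h - q) m = 0) -> p = q.
Proof.
case=> M0 Ml _ Mp hp Mq hq; apply/eqP; rewrite -subr_eq0; apply/eqP/nr_eq0/eqP.
rewrite -sqrf_eq0 -(inj_eq (@complexI R)) -dotxx.
have Mpq : M (p - q) by rewrite addrC -scaleN1r; exact: Ml.
have -> : dot (p - q) (p - q) = dot (h - q) (p - q) - dot (h - p) (p - q).
  by rewrite -[RHS]dotBl opprB [h - q + _]addrC subrKA.
by rewrite hq// hp// subrr.
Qed.

(** The kernel of a nonzero [f] has codimension one: for [u] orthogonal to it with [f u] nonzero,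
    [x - (f x / f u) *: u] lies in the kernel, so that [f x] can be read off from [dot x u]. *)
Lemma riesz (f : H -> R[i]) (C : R) : linear (f : H -> R[i]^o) ->
  (forall x, cmod (f x) <= C * nr x) -> exists y, forall x, f x = dot x y.
Proof.
move=> lf bf.
have [[x0 fx0]|f0] := pselect (exists x, f x != 0); last first.
  exists 0 => x; rewrite dot0r; apply/eqP; apply: contrapT => /negP fx.
  by apply: f0; exists x.
pose M := [set x | f x = 0].
have Mc : closed_subspace M; first split.
- exact: (lin0 lf).
- by move=> a x y; rewrite /M /= => fx fy; rewrite lf fx fy scaler0 addr0.
- move=> u l uM /cvgnrP ul; rewrite /M /=.
  apply: cmod_eq0; apply/eqP; rewrite eq_le cmod_ge0 andbT.
  apply/ler_addgt0Pr => e e0; rewrite add0r.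
  have C1 : 0 < `|C| + 1 by rewrite ltr_wpDl.
  have [|N hN] := ul (e / (`|C| + 1)); first by rewrite divr_gt0.
  have := hN N (leqnn _); rewrite ltr_pdivlMr// => h.
  have -> : f l = - f (u N - l) by rewrite (linB lf) uM sub0r opprK.
  rewrite cmodN (le_trans (bf _))// ltW// (le_lt_trans _ h)// mulrC ler_wpM2l ?nr_ge0//.
  by rewrite (le_trans (ler_norm _))// lerDl.
have [p [Mp hp]] := projection_exists x0 Mc.
pose u := x0 - p.
have fu : f u = f x0 by rewrite (linB lf) Mp subr0.
have u0 : nr u != 0.
  apply: contra_neq fx0 => /nr_eq0 u0.
  by rewrite -fu u0 (lin0 lf).
exists (((nr u ^- 2)%:C * conjc (f u)) *: u) => x.
have h1 : dot (x - (f x / f u) *: u) u = 0.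
  apply: dot_eq0C; apply: hp => /=.
  by rewrite /M /= (linB lf) (linZ lf) /GRing.scale /= divfK ?subrr// fu.
rewrite dotBl dotZl dotxx in h1; move/eqP: h1; rewrite subr_eq0 => /eqP h1.
have e : (nr u ^- 2)%:C * (nr u ^+ 2)%:C = 1 by rewrite -rmorphM /= mulVf// sqrf_eq0.
rewrite dotZr h1 conj_scale conjcK.
transitivity (f x * (f u / f u) * ((nr u ^- 2)%:C * (nr u ^+ 2)%:C)); last by ring.
by rewrite e divff ?mulr1// fu.
Qed.

(** [adjoint] is chosen by [get], so its defining property holds once some adjoint exists; Riesz's
    theorem provides one because [T] is bounded. *)
Lemma adjointP (T : H -> H) : bounded_operator T ->
  forall h k, dot (T h) k = dot h (adjoint dot T k).
Proof.
move=> /bounded_operatorP[lT [C C0 bT]].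
suff : [set S : H -> H | forall h k, dot (T h) k = dot h (S k)] (adjoint dot T) by [].
apply: getPex.
have h k : exists y, forall x, dot (T x) k = dot x y.
  apply: (@riesz _ (C * nr k)).
    by move=> a x y; rewrite lT dotDl dotZl.
  move=> x; apply: (le_trans (cauchy_schwarz _ _)).
  by rewrite mulrAC ler_wpM2r ?nr_ge0// bT.
have [S hS] := choice h.
by exists S => x k; rewrite hS.
Qed.

End inner_product.

(** * Singular vectors of a compact operator *)

Section singular_value_decomposition.
Context {R : realType} {H : completeNormedModType R[i]}.
Variable dot : {dot H for Num.conj}.
Hypothesis hdot : dot_induces_norm dot.
Implicit Types g h : H.

Lemma adjoint_le (T : H -> H) (M : R) : bounded_operator T -> 0 <= M ->
  (forall x, nr (T x) <= M * nr x) -> forall y, nr (adjoint dot T y) <= M * nr y.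
Proof.
move=> bT M0 hM y; set z := adjoint dot T y.
have [z0|z0] := eqVneq (nr z) 0; first by rewrite z0 mulr_ge0// nr_ge0.
have nz : 0 < nr z by rewrite lt0r z0 nr_ge0.
rewrite -(ler_pM2l nz) mulrA [nr z * M]mulrC.
apply: le_trans (_ : nr (T z) * nr y <= _); last by rewrite ler_wpM2r ?nr_ge0.
apply: le_trans (cauchy_schwarz hdot _ _).
by rewrite (adjointP hdot bT) -/z dotxx// cmod_real normrX ger0_norm ?nr_ge0 ?expr2.
Qed.

(** A cluster point of the images replaces the choice of a convergent subsequence. *)
Lemma compact_cluster (K : H -> H) (g : nat -> H) : compact_operator K ->
  (forall k, nr (g k) <= 1) ->
  exists l : H, forall e : R, 0 < e -> forall N, exists2 k, (N <= k)%N & nr (K (g k) - l) < e.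
Proof.
move=> [_]; rewrite precompactE => cK g1.
have [] := cK ((K \o g) @ \oo).
  exists 0 => // k _ /=; apply: subset_closure; exists (g k) => //=.
  by rewrite nrE lecE /= eqxx /=.
move=> l [_ hl]; exists l => e e0 N.
have [] := hl ((K \o g) @` [set k | (N <= k)%N]) [set y | nr (y - l) < e].
- by exists N => // k Nk; exists k.
- apply/nbhs_normP; exists e%:C; first by rewrite /= ltcR.
  by move=> y /=; rewrite nrE ltcR nrBC.
- by move=> y [[k Nk <-]] /= h; exists k.
Qed.

Lemma le_small (x : R) : (forall e : R, 0 < e -> x < e) -> x <= 0.
Proof.
by move=> h; rewrite leNgt; apply/negP => x0; have := h x x0; rewrite ltxx.
Qed.

Section one_operator.
Variable K : H -> H.
Hypothesis cK : compact_operator K.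
Let A h := adjoint dot K (K h).

Lemma dot_gram g h : dot (A g) h = dot (K g) (K h).
Proof. by rewrite dotC -(adjointP hdot cK.1) -dotC. Qed.

Lemma dot_gramr g h : dot g (A h) = dot (K g) (K h).
Proof. by rewrite -(adjointP hdot cK.1). Qed.

(** Let [s] be the norm of [K] on [W]; the last hypothesis gives [l < s], in particular [0 < s].
    Near-maximizers [g k] are near-eigenvectors of [A] for [s ^+ 2], hence close to [s ^- 2] times
    [A (g k)]. When [K (g k)] is close to a cluster point [L], they are close to [s ^- 2] times the
    adjoint of [K] at [L], which is therefore an exact eigenvector. *)
Lemma gram_eigenvector (W : set H) (l : R) : closed_subspace W ->
  (forall g, W g -> W (A g)) -> 0 <= l ->
  ~ (forall g, W g -> nr (K g) <= l * nr g) ->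
  exists s e, [/\ l < s, W e, nr e = 1 & A e = (s ^+ 2)%:C *: e].
Proof.
move=> Wc WA l0 hl.
have [lK [M M0 hM]] := (@bounded_operatorP _ _ _).1 cK.1.
have W0 : W 0 by case: Wc.
have WZ a g : W g -> W (a *: g).
  by case: Wc => _ Wl _ Wg; rewrite -[_ *: _]addr0; exact: Wl.
pose S := [set nr (K g) | g in [set g | W g /\ nr g <= 1]].
have S0 : S !=set0 by exists (nr (K 0)); exists 0 => //; split; rewrite ?nr0.
have Sub : has_ubound S.
  exists M => _ [g [_ g1] <-]; apply: (le_trans (hM g)).
  by rewrite -[leRHS]mulr1 ler_wpM2l.
pose s := sup S.
have Ks g : W g -> nr (K g) <= s * nr g.
  move=> Wg; have [/nr_eq0 ->|g0] := eqVneq (nr g) 0.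
    by rewrite (lin0 lK) !nr0 mulr0.
  have ng : 0 < nr g by rewrite lt0r g0 nr_ge0.
  have : S (nr (K ((nr g)^-1%:C *: g))).
    exists ((nr g)^-1%:C *: g) => //; split; first exact: WZ.
    by rewrite nrZR ger0_norm ?invr_ge0 ?nr_ge0// mulVf.
  move=> /(ub_le_sup Sub); rewrite (linZ lK) nrZR ger0_norm ?invr_ge0 ?nr_ge0//.
  by rewrite mulrC ler_pdivrMr.
have ls : l < s.
  rewrite ltNge; apply/negP => sl; apply: hl => g Wg.
  by apply: (le_trans (Ks g Wg)); rewrite ler_wpM2r ?nr_ge0.
have s0 : 0 < s by exact: le_lt_trans ls.
have /choice[g hg] k : exists g, [/\ W g, nr g <= 1 & s - k.+1%:R^-1 < nr (K g)].
  have [|_ [g [Wg g1] <-] h] := @sup_adherent _ S k.+1%:R^-1 _ (conj S0 Sub).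
    by rewrite invr_gt0.
  by exists g.
have Ale h : W h -> nr (A h) <= s * nr (K h).
  move=> Wh; have [->|n0] := eqVneq (nr (A h)) 0; first by rewrite mulr_ge0 ?nr_ge0// ltW.
  have np : 0 < nr (A h) by rewrite lt0r n0 nr_ge0.
  rewrite -(ler_pM2l np) -expr2.
  have -> : nr (A h) ^+ 2 = complex.Re (dot (A h) (A h)) by rewrite dotxx.
  rewrite dot_gram mulrCA mulrA mulrC.
  apply: (le_trans (ler_norm _)); apply: (le_trans (Re_dot_le hdot _ _)).
  rewrite ler_wpM2l ?nr_ge0//; exact/Ks/WA.
(* The square expands to [|A g|^2 + s^4 |g|^2 - 2 s^2 |K g|^2]; with [|A g| <= s |K g|] and
   [|g| <= 1] it is at most [s^2 (s^2 - |K g|^2)]. *)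
have gap k : nr (A (g k) - (s ^+ 2)%:C *: g k) ^+ 2 <= 2 * s ^+ 3 * k.+1%:R^-1.
  have [Wg g1 gk] := hg k.
  rewrite (nrB_sqr hdot) nrZR dotZr conj_scale1 dot_gram dotxx//.
  rewrite -rmorphM /= exprMn real_normK ?num_real//.
  have h1 : nr (A (g k)) ^+ 2 <= (s * nr (K (g k))) ^+ 2.
    by rewrite ler_pXn2r ?nnegrE ?mulr_ge0 ?nr_ge0 ?Ale// ltW.
  have h2 : (s ^+ 2) ^+ 2 * nr (g k) ^+ 2 <= (s ^+ 2) ^+ 2.
    by rewrite -[leRHS]mulr1 ler_wpM2l ?exprn_ge0 ?exprn_ile1 ?nr_ge0// ltW.
  have h3 : s ^+ 2 - nr (K (g k)) ^+ 2 <= 2 * s * k.+1%:R^-1.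
    rewrite subr_sqr mulrC.
    have h4 : nr (K (g k)) <= s.
      by apply: (le_trans (Ks _ Wg)); rewrite -[leRHS]mulr1 ler_wpM2l// ltW.
    apply: ler_pM => //; [by rewrite addr_ge0 ?nr_ge0// ltW|by rewrite subr_ge0| |].
      by rewrite mulr_natl mulr2n lerD2l.
    by rewrite lerBlDl -lerBlDr ltW.
  have : s ^+ 2 * (s ^+ 2 - nr (K (g k)) ^+ 2) <= s ^+ 2 * (2 * s * k.+1%:R^-1).
    by rewrite ler_wpM2l// exprn_ge0// ltW.
  have -> : 2 * s ^+ 3 * k.+1%:R^-1 = s ^+ 2 * (2 * s * k.+1%:R^-1) by ring.
  move: h1 h2; rewrite exprMn.
  move: (nr (A _) ^+ 2) (nr (K _) ^+ 2) (nr (g k) ^+ 2) (s ^+ 2) (2 * s * _).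
  by move=> a b c d f ? ? ?; lra.
have [L hL] := compact_cluster cK (fun k => let: And3 _ h _ := hg k in h).
pose e := (s ^- 2)%:C *: adjoint dot K L.
have s20 : 0 < s ^+ 2 by rewrite exprn_gt0.
have near_e (d : R) N : 0 < d -> exists2 k, (N <= k)%N &
    nr (g k - e) < d /\ nr (A (g k) - (s ^+ 2)%:C *: g k) < d.
  move=> d0.
  pose d1 := Num.min d (s ^+ 2 * d / 2).
  have d10 : 0 < d1 by rewrite lt_min d0 divr_gt0// mulr_gt0.
  have [|N1 hN1] := @harmonic_lt R (d1 ^+ 2 / (2 * s ^+ 3)).
    by rewrite divr_gt0 ?exprn_gt0// mulr_gt0// exprn_gt0.
  have [|k Nk hk] := hL (s ^+ 2 * d / (2 * (M + 1))) _ (maxn N N1).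
    by rewrite divr_gt0 ?mulr_gt0// ltr_wpDl.
  exists k; first by rewrite (leq_trans _ Nk)// leq_maxl.
  have gk1 : nr (A (g k) - (s ^+ 2)%:C *: g k) < d1.
    rewrite -(@ltr_pXn2r _ 2) ?nnegrE ?nr_ge0 ?ltW//.
    apply: (le_lt_trans (gap k)); rewrite mulrC -ltr_pdivlMr ?mulr_gt0 ?exprn_gt0//.
    by apply: hN1; rewrite (leq_trans _ Nk)// leq_maxr.
  split; last by rewrite (lt_le_trans gk1)// ge_min lexx.
  have -> : g k - e = (s ^- 2)%:C *: ((s ^+ 2)%:C *: g k - A (g k) + (A (g k) - adjoint dot K L)).
    rewrite subrKA scalerBr scalerA -rmorphM /= mulVf ?gt_eqF//.
    by rewrite rmorph1 scale1r.
  rewrite nrZR ger0_norm ?invr_ge0 ?ltW// mulrC ltr_pdivrMr//.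
  apply: (le_lt_trans (nrD _ _)); rewrite [X in X + _]nrBC.
  have h5 : nr (A (g k) - adjoint dot K L) <= M * nr (K (g k) - L).
    have -> : A (g k) - adjoint dot K L = adjoint dot K (K (g k) - L).
      apply: (dot_extr hdot) => z; rewrite dotBr -!(adjointP hdot cK.1).
      by rewrite dotBr.
    exact: adjoint_le cK.1 M0 hM _.
  have h6 : M * nr (K (g k) - L) <= s ^+ 2 * d / 2.
    rewrite ltr_pdivlMr ?mulr_gt0 ?ltr_wpDl// in hk.
    have := nr_ge0 (K (g k) - L); move: hk; move: (nr _) (s ^+ 2 * d) => a b ? ?.
    by nra.
  have h7 : d1 <= s ^+ 2 * d / 2 by rewrite /d1 ge_min lexx orbT.
  by move: gk1 h5 h6 h7; move: (s ^+ 2) (nr _) (nr _) (M * _) => f a b c ? ? ? ?; lra.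
have We : W e.
  have /choice[f hf] j : exists k, nr (g k - e) < j.+1%:R^-1.
    have [|k _ [h _]] := near_e j.+1%:R^-1 0%N; first by rewrite invr_gt0.
    by exists k.
  case: Wc => _ _ Wc; apply: (Wc (fun j => g (f j))) => [j|]; first by case: (hg (f j)).
  apply/cvgnrP => d d0; have [N hN] := harmonic_lt d0.
  by exists N => k Nk; apply: lt_trans (hN k Nk).
have e1 : nr e <= 1.
  rewrite -subr_le0; apply: le_small => d d0.
  have [k _ [h _]] := near_e d 0%N d0; have [_ g1 _] := hg k.
  have := nr_dist (g k) e; rewrite ler_norml => /andP[h2 _].
  by move: h h2 g1; move: (nr _) (nr _) (nr _) => a b c ? ? ?; lra.
have Kes : s <= nr (K e).
  rewrite -subr_le0; apply: le_small => d d0.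
  have [|N1 hN1] := @harmonic_lt R (d / 2); first by rewrite divr_gt0.
  have [|k Nk [h _]] := near_e (d / (2 * (M + 1))) N1.
    by rewrite divr_gt0// mulr_gt0// ltr_wpDl.
  have [_ _ gk] := hg k; have {hN1}hk := hN1 k Nk.
  have h1 := nr_dist (K (g k)) (K e).
  have h2 : nr (K (g k) - K e) <= M * nr (g k - e) by rewrite -(linB lK) hM.
  have h3 : M * nr (g k - e) <= d / 2.
    rewrite ltr_pdivlMr ?mulr_gt0 ?ltr_wpDl// in h.
    by have := nr_ge0 (g k - e); move: h; move: (nr _) => a ? ?; nra.
  rewrite ler_norml in h1; case/andP : h1 => _ h1.
  move: gk hk h1 h2 h3; move: (nr _) (nr _) (nr _) (M * _) (_^-1) => a b c f x *.
  by lra.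
have ne : nr e = 1.
  apply/eqP; rewrite eq_le e1 /= -(ler_pM2l s0) mulr1.
  exact: le_trans Kes (Ks e We).
exists s, e; split => //.
apply/eqP; rewrite -subr_eq0; apply/eqP/nr_eq0/eqP; rewrite eq_le nr_ge0 andbT.
apply: le_small => d d0.
pose B := M * M + s ^+ 2 + 1.
have B0 : 0 < B by rewrite ltr_wpDl// addr_ge0 ?mulr_ge0// ltW.
have [|k _ [h1 h2]] := near_e (d / (2 * B)) 0%N; first by rewrite divr_gt0// mulr_gt0.
have -> : A e - (s ^+ 2)%:C *: e =
    (A (g k) - (s ^+ 2)%:C *: g k) - (A (g k - e) - (s ^+ 2)%:C *: (g k - e)).
  have -> : A (g k - e) = A (g k) - A e.
    apply: (dot_extr hdot) => z; rewrite dotBr !dot_gramr.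
    by rewrite (linB lK) dotBr.
  rewrite scalerBr; set a := A (g k); set b := A e; set c := _ *: g k; set f := _ *: e.
  have -> : a - b - (c - f) = (a - c) - (b - f).
    by rewrite !opprB addrACA [RHS]addrACA [- b - c]addrC.
  by rewrite subKr.
apply: (le_lt_trans (nrB _ _)).
have h3 : nr (A (g k - e) - (s ^+ 2)%:C *: (g k - e)) <= (M * M + s ^+ 2) * nr (g k - e).
  apply: (le_trans (nrB _ _)); rewrite nrZR (ger0_norm (ltW s20)) mulrDl.
  apply: lerD => //.
  apply: (le_trans (adjoint_le cK.1 M0 hM _)); rewrite -mulrA ler_wpM2l// hM.
rewrite ltr_pdivlMr ?mulr_gt0// in h1; rewrite ltr_pdivlMr ?mulr_gt0// in h2.
have B1 : 1 <= B by rewrite /B lerDr addr_ge0 ?mulr_ge0// ltW.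
have h4 : (M * M + s ^+ 2) * nr (g k - e) <= B * nr (g k - e).
  by rewrite ler_wpM2r ?nr_ge0// lerDl.
have h5 : nr (A (g k) - (s ^+ 2)%:C *: g k) <= nr (A (g k) - (s ^+ 2)%:C *: g k) * B.
  by rewrite ler_peMr// nr_ge0.
have {h3 h4}h3 := le_trans h3 h4.
move: h1 h2 h3 h5; clearbody B; move: (nr _) (nr _) (nr _) => a b c.
by move=> ? ? ? ?; lra.
Qed.

End one_operator.

End singular_value_decomposition.
Section singular_vectors.
Context {R : realType} {H : completeNormedModType R[i]}.
Variable dot : {dot H for Num.conj}.
Hypothesis hdot : dot_induces_norm dot.
Variable K : H -> H.
Hypothesis cK : compact_operator K.
Let A h := adjoint dot K (K h).

Definition orthonormal_family p (e : 'I_p -> H) :=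
  forall i j, dot (e i) (e j) = (i == j)%:R.

Lemma orthonormal_coef p (e : 'I_p -> H) (c : 'I_p -> R[i]) k : orthonormal_family e ->
  dot (\sum_i c i *: e i) (e k) = c k.
Proof.
move=> oe; rewrite dot_suml (bigD1 k)//= dotZl oe eqxx mulr1 big1 ?addr0// => i ik.
by rewrite dotZl oe (negPf ik) mulr0.
Qed.

(** A longer family would have linearly dependent coordinate vectors in the basis [b], but
    orthonormality makes every coefficient of a linear relation vanish. *)
Lemma orthonormal_dim (M : set H) m q (e : 'I_q -> H) :
  has_dim M m -> orthonormal_family e -> (forall i, M (e i)) -> (q <= m)%N.
Proof.
move=> [b [_ hb]] oe Me.
have /choice[c hc] i : exists c : 'rV[R[i]]_m, e i = \sum_k c 0 k *: b k.
  by have [c [-> _]] := hb _ (Me i); exists c.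
pose C : 'M[R[i]]_(q, m) := \matrix_i c i.
have [rC|] := boolP (row_free C).
  by move: rC; rewrite /row_free => /eqP <-; exact: rank_leq_col.
rewrite -kermx_eq0 => /rowV0Pn[v /sub_kermxP vC v0].
exfalso; move/negP : v0; apply; apply/eqP/rowP => k; rewrite [RHS]mxE.
rewrite -(orthonormal_coef (fun i => v 0 i) k oe).
suff -> : \sum_i v 0 i *: e i = 0 by rewrite dot0l.
transitivity (\sum_j (v *m C) 0 j *: b j); last first.
  by rewrite vC big1// => j _; rewrite mxE scale0r.
transitivity (\sum_i \sum_j (v 0 i * C i j) *: b j).
  apply: eq_bigr => i _; rewrite {1}hc scaler_sumr; apply: eq_bigr => j _.
  by rewrite scalerA mxE.
by rewrite exchange_big; apply: eq_bigr => j _; rewrite mxE scaler_suml.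
Qed.

Definition eigen_family p (e : 'I_p -> H) (sg : 'I_p -> R) :=
  orthonormal_family e /\ forall i, A (e i) = (sg i ^+ 2)%:C *: e i.

(** Each value [l > s N] occurs among the [sg i] at most as often as the dimension of its
    eigenspace, which is the number of [j] with [s j = l]. All these [j] are below [N] because [s]
    is nonincreasing. Thus the [sg i] are, with multiplicities, a part of the first [N] terms of
    [s]. *)
Lemma singular_values_count s N p (e : 'I_p -> H) sg : singular_values dot K s ->
  eigen_family e sg -> (forall i, s N < sg i) ->
  exists2 t, subseq t [seq s j | j <- iota 0 N] & perm_eq [seq sg i | i <- enum 'I_p] t.
Proof.
move=> [s0 sni hs] [oe Ae] sgN.
apply/count_subseqP => l.
have [ln|ln] := leP l (s N).
  rewrite count_map (eq_count (a2 := pred0)) ?count_pred0// => i /=.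
  by apply/negP => /eqP il; have := sgN i; rewrite il ltNge ln.
have l0 : 0 < l := le_lt_trans (s0 N) ln.
have [m /card_esym/card_set_bijP[f0 [fS fI _]] hm] := hs l l0.
pose f : nat -> nat := f0.
pose is_ := [seq i <- enum 'I_p | sg i == l].
have uis : uniq is_ by rewrite filter_uniq// enum_uniq.
have h1 : (size is_ <= m)%N.
  pose t := in_tuple is_.
  apply: (orthonormal_dim (e := fun k : 'I_(size is_) => e (tnth t k)) hm).
    move=> i j; rewrite oe; congr (_%:R); congr nat_of_bool.
    by apply/eqP/eqP => [/(tuple_uniqP t uis)|->].
  move=> i /=; rewrite -/(A _) Ae.
  have := mem_tnth i t; rewrite mem_filter => /andP[/eqP -> _].
  by [].
rewrite count_map -size_filter; apply: (leq_trans h1).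
rewrite count_map -size_filter.
rewrite -(size_iota 0 m) -(size_map f); apply: uniq_leq_size.
  rewrite map_inj_in_uniq ?iota_uniq// => i j; rewrite !mem_iota /= !add0n => im jm.
  by apply: fI; rewrite inE.
apply/allP; rewrite all_map; apply/allP => i; rewrite mem_iota /= add0n => im.
have := fS i; rewrite /= => /(_ im) fil.
rewrite mem_filter /= fil eqxx mem_iota /= add0n ltnNge.
by apply/negP => /sni; rewrite fil leNgt ln.
Qed.

(** The spectral theorem is bypassed: a family of eigenvectors with values above [s N] has at most
    [N] members, so there is one of maximal size. If [K] exceeded the bound [s N] on its orthogonal
    complement, [gram_eigenvector] would enlarge it. *)
Lemma singular_vectors s N : singular_values dot K s ->
  exists p (e : 'I_p -> H) (sg : 'I_p -> R),
    [/\ eigen_family e sg, \sum_i sg i ^+ 2 <= \sum_(j < N) s j ^+ 2 &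
        forall g, (forall i, dot g (e i) = 0) -> nr (K g) <= s N * nr g].
Proof.
move=> hs; have s0 : 0 <= s N by case: hs.
pose P p := `[< exists (e : 'I_p -> H) sg, eigen_family e sg /\ (forall i, s N < sg i) >].
have exP : exists p, P p.
  exists 0%N; apply/asboolP; exists (fun=> 0), (fun=> 0); split; last by case.
  by split=> -[].
have ubP p : P p -> (p <= N)%N.
  move=> /asboolP[e [sg [he hN]]].
  have [t st pt] := singular_values_count hs he hN.
  rewrite -(card_ord p) cardE -(size_map sg) (perm_size pt).
  by rewrite (leq_trans (size_subseq st))// size_map size_iota.
case: (ex_maxnP exP ubP) => p /asboolP[e [sg [he hN]]] pmax.
exists p, e, sg; split => //.
  have [t st pt] := singular_values_count hs he hN.
  have -> : \sum_i sg i ^+ 2 = \sum_(x <- [seq sg i | i <- enum 'I_p]) x ^+ 2.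
    by rewrite big_map big_enum.
  rewrite (perm_big _ pt) /=.
  have [u pu] := perm_to_subseq st.
  rewrite -(big_mkord xpredT (fun j => s j ^+ 2)) /index_iota subn0.
  rewrite -[leRHS](big_map s xpredT (fun x => x ^+ 2)) (perm_big _ pu) big_cat /=.
  by rewrite lerDl sumr_ge0// => x _; rewrite sqr_ge0.
apply: contrapT => hW.
pose W := [set g : H | forall i, dot g (e i) = 0].
have [oe Ae] := he.
have Wc : closed_subspace W.
  split=> [i|a x y Wx Wy i|f l Wf fl i]; first exact: dot0l.
    by rewrite dotDl dotZl Wx Wy mulr0 addr0.
  apply: cmod_eq0; apply/eqP; rewrite eq_le cmod_ge0 andbT.
  apply: le_small => d d0; have [M hM] := cvg_dotl hdot (e i) fl d0.
  by have := hM M (leqnn _); rewrite Wf sub0r cmodN.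
have [||x [e' [ls We' ne' Ae']]] := gram_eigenvector hdot cK Wc _ s0.
- move=> g Wg i; rewrite (dot_gram hdot cK) -(dot_gramr hdot cK) -/(A _) Ae dotZr Wg mulr0.
  by [].
- by move=> h; apply: hW => g Wg; exact: h.
have : P p.+1.
  apply/asboolP.
  exists (fun i => if unlift ord_max i is Some j then e j else e').
  exists (fun i => if unlift ord_max i is Some j then sg j else x).
  split; last by move=> i; case: unliftP.
  split=> [i j|i]; last by case: unliftP.
  case: unliftP => [i'|] ->; case: unliftP => [j'|] ->.
  - by rewrite oe (inj_eq lift_inj).
  - by rewrite dotC We' conjc0 eq_sym (negPf (neq_lift _ _)).
  - by rewrite We' (negPf (neq_lift _ _)).
  - by rewrite eqxx dotxx// ne' expr1n.
by move=> /pmax; rewrite ltnn.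
Qed.

(** The components of [g] in and off the span of the [e i] are treated apart: the images under [K]
    of the [e i] are orthogonal with norms [|sg i|], and off the span [K] is bounded by [l]. *)
Lemma nr_compact_le p (e : 'I_p -> H) sg (l : R) g : eigen_family e sg -> 0 <= l ->
  (forall g, (forall i, dot g (e i) = 0) -> nr (K g) <= l * nr g) ->
  nr (K g) <= Num.sqrt (\sum_i sg i ^+ 2 * cmod (dot g (e i)) ^+ 2) + l * nr g.
Proof.
move=> [oe Ae] l0 hl.
have lK : linear K := cK.1.1.
pose g1 := \sum_i dot g (e i) *: e i.
have og : forall i, dot (g - g1) (e i) = 0.
  by move=> i; rewrite dotBl orthonormal_coef// subrr.
have ng : nr (g - g1) <= nr g.
  rewrite -(@ler_pXn2r _ 2) ?nnegrE ?nr_ge0// -[g in leRHS](subrK g1).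
  rewrite [leRHS](pythagoras hdot) ?lerDl ?sqr_ge0//.
  by rewrite dot_sumr big1// => i _; rewrite dotZr og mulr0.
rewrite -[g in leLHS](subrK g1) (linD lK) addrC (le_trans (nrD _ _))// lerD//; last first.
  by rewrite (le_trans (hl _ og))// ler_wpM2l.
rewrite -[leLHS]ger0_norm ?nr_ge0// -sqrtr_sqr ler_sqrt; last first.
  by apply: sumr_ge0 => i _; rewrite mulr_ge0 ?sqr_ge0.
rewrite le_eqVlt; apply/orP; left; apply/eqP/complexI; rewrite -(dotxx hdot) -(dot_gramr hdot cK).
have -> : adjoint dot K (K g1) = \sum_i (dot g (e i) * (sg i ^+ 2)%:C) *: e i.
  apply: (dot_extr hdot) => z; rewrite (dot_gramr hdot cK) (lin_sum lK) !dot_sumr.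
  apply: eq_bigr => i _; rewrite (linZ lK) -scalerA -Ae !dotZr.
  by rewrite (dot_gramr hdot cK).
rewrite dot_sumr rmorph_sum /=; apply: eq_bigr => i _.
rewrite dotZr orthonormal_coef// [X in conjc X]mulrC conj_scale -mulrA.
by rewrite [conjc _ * _]mulrC mulc_conj -rmorphM.
Qed.

End singular_vectors.

(** * Sums of singular values in the Lorentz ideal *)

Section lorentz_sums.
Context {R : realType}.
Variables (n : nat) (s : nat -> R).
Hypothesis n3 : (3 <= n)%N.
Hypothesis s_ge0 : forall j, 0 <= s j.
Hypothesis s_noninc : nonincreasing_seq s.
Hypothesis s_lorentz : (\sum_(0 <= j <oo) (s j * j.+1%:R `^ (-1 + n%:R^-1))%:E < +oo)%E.

Let w j : R := j.+1%:R `^ (-1 + n%:R^-1).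
Let c i := 2 ^+ i * s (2 ^ (i * n)).

Let n0 : (0 < n)%N. Proof. exact: leq_trans n3. Qed.

Lemma lorentz_partial_bounded : exists B : R, forall N, \sum_(0 <= j < N) s j * w j <= B.
Proof.
have sw0 j : (0 <= (s j * w j)%:E)%E by rewrite lee_fin mulr_ge0// powR_ge0.
have h N : (\sum_(0 <= j < N) (s j * w j)%:E <= \sum_(0 <= j <oo) (s j * w j)%:E)%E.
  by apply: nneseries_lim_ge => *; exact: sw0.
have : ((\sum_(0 <= j <oo) (s j * w j)%:E)%E \is a fin_num).
  rewrite ge0_fin_numE//; exact: nneseries_ge0.
move=> /fineK e; exists (fine (\sum_(0 <= j <oo) (s j * w j)%:E)%E) => N.
by rewrite -lee_fin e -sumEFin.
Qed.

(** Equality holds at [j.+1 = 2 ^ (i * n)], and the weight decreases with [j]. *)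
Lemma lorentz_weight_ge i j : (j < 2 ^ (i * n))%N ->
  2 ^+ i / (2 ^ (i * n))%:R <= w j.
Proof.
move=> ji; have nz : n%:R != 0 :> R by rewrite pnatr_eq0 -lt0n.
have Q0 : 0 < (2 ^ (i * n))%:R :> R by rewrite ltr0n expn_gt0.
have r0 : 0 <= 1 - n%:R^-1 :> R.
  by rewrite subr_ge0 invf_le1 ?ltr0n// ler1n.
rewrite /w (_ : -1 + _ = - (1 - n%:R^-1)); last by rewrite opprB addrC.
rewrite powRN -[leLHS]invrK invf_div lef_pV2 ?posrE ?divr_gt0 ?exprn_gt0 ?powR_gt0 ?ltr0n//.
apply: (@le_trans _ _ ((2 ^ (i * n))%:R `^ (1 - n%:R^-1))).
  by rewrite ge0_ler_powR// ?nnegrE// ?ler_nat.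
rewrite (@powRD _ _ 1 (- n%:R^-1)) ?(gt_eqF Q0) ?implybT// powRr1 ?(ltW Q0)// powRN.
rewrite expnM natrX -powR_mulrn// -powRrM divff// powRr1// natrX.
  by rewrite powR_mulrn.
by rewrite expn_gt0.
Qed.

(** Cauchy condensation on the blocks from [2 ^ (J * n)] to [2 ^ (J.+1 * n)]. Such a block contains
    at least half of the indices below its right end, and on each of them [s] and the weight are
    bounded below by the right end; this gives [c J.+1] up to the factor 2. *)
Lemma lorentz_dyadic_bounded : exists B : R, forall I, \sum_(0 <= i < I) c i <= B.
Proof.
have [B hB] := lorentz_partial_bounded.
exists (c 0 + 2 * B) => I.
have B0 : 0 <= B by have := hB 0%N; rewrite big_geq.
have c0 i : 0 <= c i by rewrite mulr_ge0// exprn_ge0.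
have h : forall I, \sum_(0 <= i < I) c i.+1 <= 2 * \sum_(0 <= j < 2 ^ (I * n)) s j * w j.
  elim=> [|J ih].
    by rewrite big_geq// mulr_ge0// sumr_ge0// => j _; rewrite mulr_ge0// powR_ge0.
  have le1 : (2 ^ (J * n) <= 2 ^ (J.+1 * n))%N by rewrite leq_exp2l// leq_mul2r leqnSn orbT.
  rewrite big_nat_recr//= [X in _ <= 2 * X](@big_cat_nat _ _ _ (2 ^ (J * n)))//= mulrDr lerD//.
  apply: (@le_trans _ _ (2 * \sum_(2 ^ (J * n) <= j < 2 ^ (J.+1 * n))
      s (2 ^ (J.+1 * n)) * (2 ^+ J.+1 / (2 ^ (J.+1 * n))%:R))); last first.
    rewrite ler_wpM2l//; apply: ler_sum_nat => j /andP[_ jJ].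
    by apply: ler_pM => //; [apply/s_noninc/ltnW|exact: lorentz_weight_ge].
  rewrite sumr_const_nat -[X in 2 * X]mulr_natr natrB//.
  have e : (2 ^ (J * n))%:R <= (2 ^ (J.+1 * n))%:R / 2 :> R.
    rewrite ler_pdivlMr// -natrM ler_nat -[X in (_ * X)%N]/(2 ^ 1)%N -expnD leq_exp2l//.
    by rewrite mulSn addnC leq_add2r.
  have Q0 : 0 < (2 ^ (J.+1 * n))%:R :> R by rewrite ltr0n expn_gt0.
  rewrite /c.
  set Q := (2 ^ (J.+1 * n))%:R in e Q0 *; set P := (2 ^ (J * n))%:R in e *.
  set u := s _; set v := 2 ^+ J.+1.
  rewrite (_ : 2 * (u * (v / Q) * (Q - P)) = (v * u) * ((Q - P) * 2 / Q)); last by ring.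
  rewrite -[leLHS]mulr1 ler_wpM2l ?mulr_ge0 ?s_ge0 ?exprn_ge0// ler_pdivlMr// mul1r.
  by move: e; rewrite ler_pdivlMr// mulrBl; lra.
case: I => [|I]; first by rewrite big_geq// addr_ge0// mulr_ge0.
rewrite big_nat_recl//= lerD2l (le_trans (h I))// ler_wpM2l//.
Qed.

Let x i : R := 2 ^+ i * Num.sqrt (\sum_(0 <= j < 2 ^ (i * n)) s j ^+ 2 / (2 ^ (i * n))%:R).

Lemma sqrtr_subadd (a b : R) : 0 <= a -> 0 <= b ->
  Num.sqrt (a + b) <= Num.sqrt a + Num.sqrt b.
Proof.
move=> a0 b0; rewrite -(@ler_pXn2r _ 2) ?nnegrE ?addr_ge0 ?sqrtr_ge0//.
rewrite sqr_sqrtr ?addr_ge0// sqrrD !sqr_sqrtr// -addrA lerD2l lerDr.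
by rewrite mulrn_wge0// mulr_ge0 ?sqrtr_ge0.
Qed.

(* Splitting the sum at [2 ^ (i * n)] yields [x i.+1 <= q * x i + 2 * c i] with
   [q = 2 / Num.sqrt (2 ^+ n)], and [q < 1] because [3 <= n]. *)
Lemma lorentz_mean_bounded : exists B : R, forall I, \sum_(0 <= i < I) x i <= B.
Proof.
have [B hB] := lorentz_dyadic_bounded.
pose rho : R := Num.sqrt (2 ^+ n).
have rho2 : 2 < rho.
  rewrite -(@ltr_pXn2r _ 2) ?nnegrE ?sqrtr_ge0// sqr_sqrtr ?exprn_ge0//.
  by rewrite ltr_eXn2l ?ltr1n// (leq_trans _ n3).
have rho0 : 0 < rho by exact: lt_trans rho2.
have q1 : 2 / rho < 1 by rewrite ltr_pdivrMr// mul1r.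
have q0 : 0 <= 2 / rho by rewrite divr_ge0// ltW.
have rhoE i : Num.sqrt (2 ^ (i * n))%:R = rho ^+ i.
  rewrite natrX mulnC exprM -[rho ^+ i]ger0_norm ?exprn_ge0 ?ltW// -sqrtr_sqr.
  by congr Num.sqrt; rewrite -[rho ^+ i ^+ 2]exprM [(i * 2)%N]mulnC exprM sqr_sqrtr// exprn_ge0.
have x0 i : 0 <= x i by rewrite mulr_ge0 ?exprn_ge0 ?sqrtr_ge0.
have step i : x i.+1 <= 2 / rho * x i + 2 * c i.
  have le1 : (2 ^ (i * n) <= 2 ^ (i.+1 * n))%N by rewrite leq_exp2l// leq_mul2r leqnSn orbT.
  have xE k : x k = 2 ^+ k * (Num.sqrt (\sum_(0 <= j < 2 ^ (k * n)) s j ^+ 2) / rho ^+ k).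
    by rewrite /x -mulr_suml sqrtrM ?sumr_ge0 ?sqrtrV -?rhoE// => j _; rewrite sqr_ge0.
  rewrite !xE (@big_cat_nat _ _ _ (2 ^ (i * n)))//=.
  set a := \sum_(0 <= j < _) _; set b := \sum_(_ <= j < _) _.
  have b1 : Num.sqrt b <= rho ^+ i.+1 * s (2 ^ (i * n)).
    rewrite -rhoE -[s _]ger0_norm// -sqrtr_sqr -sqrtrM ?ler0n//.
    rewrite ler_sqrt ?mulr_ge0 ?ler0n ?sqr_ge0//.
    apply: (@le_trans _ _ (\sum_(2 ^ (i * n) <= j < 2 ^ (i.+1 * n)) s (2 ^ (i * n)) ^+ 2)).
      apply: ler_sum_nat => j /andP[ij _].
      by rewrite ler_pXn2r ?nnegrE//; exact: s_noninc.
    rewrite sumr_const_nat -[leLHS]mulr_natl ler_wpM2r ?sqr_ge0// ler_nat leq_subr//.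
  have a0 : 0 <= a by apply: sumr_ge0 => j _; rewrite sqr_ge0.
  have b0 : 0 <= b by apply: sumr_ge0 => j _; rewrite sqr_ge0.
  apply: (@le_trans _ _ (2 ^+ i.+1 * ((Num.sqrt a + rho ^+ i.+1 * s (2 ^ (i * n))) / rho ^+ i.+1))).
    rewrite ler_wpM2l ?exprn_ge0// ler_wpM2r ?invr_ge0 ?exprn_ge0 ?(ltW rho0)//.
    by rewrite (le_trans (sqrtr_subadd a0 b0))// lerD2l.
  rewrite le_eqVlt; apply/orP; left; apply/eqP; rewrite /c !exprS.
  by field; rewrite expf_neq0 gt_eqF.
(* Summing the recursion, with [q = 2 / rho], bounds a partial sum [S] by [x 0 + q * S + 2 * B]. *)
exists ((x 0 + 2 * B) / (1 - 2 / rho)) => I.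
rewrite ler_pdivlMr ?subr_gt0//.
have h : \sum_(0 <= i < I) x i.+1 <= 2 / rho * \sum_(0 <= i < I) x i + 2 * B.
  apply: (@le_trans _ _ (\sum_(0 <= i < I) (2 / rho * x i + 2 * c i))).
    by apply: ler_sum => i _; exact: step.
  by rewrite big_split/= -!mulr_sumr lerD2l ler_wpM2l.
have h2 : \sum_(0 <= i < I) x i <= x 0 + \sum_(0 <= i < I) x i.+1.
  by rewrite -big_nat_recl// big_nat_recr//= lerDl.
by move: h h2; move: (2 / rho) => q *; lra.
Qed.

Lemma lorentz_vanish (e : R) : 0 < e -> exists N, s N < e.
Proof.
move=> e0; have [B hB] := lorentz_dyadic_bounded.
apply: contrapT => h.
have sge N : e <= s N by rewrite leNgt; apply/negP => ?; apply: h; exists N.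
have hI I : I%:R * e <= B.
  apply: le_trans (hB I); rewrite mulr_natl -[X in e *+ X]subn0 -sumr_const_nat.
  apply: ler_sum => i _; rewrite -[leLHS]mul1r ler_pM// ?(ltW e0)//.
  by rewrite exprn_ege1// ler1n.
have B0 : 0 <= B / e by rewrite divr_ge0 ?(ltW e0)//; have := hI 0%N; rewrite mul0r.
have := hI (Num.bound (B / e)); rewrite -ler_pdivlMr// leNgt.
by rewrite (le_lt_trans (ler_norm _))// ger0_norm// archi_boundP.
Qed.

End lorentz_sums.

(** * Averages over boxes *)

Section box_points.
Context {V : zmodType}.
Implicit Types (vs : seq V) (v : V).

(** A list rather than a set: coinciding points are counted with multiplicity, so the number of
    points is the same for all [vs] of a given length. *)
Fixpoint box_points vs (L : nat) : seq V :=
  if vs is v :: vs' then [seq v *+ t + m | t <- iota 0 L, m <- box_points vs' L]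
  else [:: 0].

Lemma size_box_points vs L : size (box_points vs L) = (L ^ size vs)%N.
Proof. by elim: vs => //= v vs ih; rewrite size_allpairs ih size_iota expnS. Qed.

Lemma box_points_sum (W : nmodType) (F : V -> W) v vs L :
  \sum_(m <- box_points (v :: vs) L) F m =
  \sum_(0 <= t < L) \sum_(m <- box_points vs L) F (v *+ t + m).
Proof. by rewrite /= big_allpairs_dep /index_iota subn0. Qed.

End box_points.

Lemma map_box_points (V W : zmodType) (f : V -> W) vs L :
  f 0 = 0 -> {morph f : x y / x + y} ->
  map f (box_points vs L) = box_points (map f vs) L.
Proof.
move=> f0 fD; have fM v t : f (v *+ t) = f v *+ t.
  by elim: t => [|t ih]; rewrite ?mulr0n// !mulrS fD ih.
elim: vs => [|v vs ih] /=; first by rewrite f0.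
rewrite -ih map_allpairs allpairs_mapr; apply: eq_allpairs => t m.
by rewrite fD fM.
Qed.

Lemma sumr_const_size (W : nmodType) (I : Type) (r : seq I) (x : W) :
  \sum_(i <- r) x = x *+ size r.
Proof. by rewrite big_const_seq count_predT iter_addr_0. Qed.

Lemma scale_invn_mulrn {R : realType} (W : lmodType R[i]) (x : W) k : (0 < k)%N ->
  (k%:R^-1 : R)%:C *: (x *+ k) = x.
Proof.
move=> k0; rewrite -[x *+ k]scaler_nat scalerA -[X in _ * X](rmorph_nat (real_complex R)).
by rewrite -rmorphM /= mulVf ?scale1r// pnatr_eq0 -lt0n.
Qed.

Section real_averages.
Context {R : realType}.

Lemma mean_sqr_le (I : Type) (r : seq I) (x : I -> R) :
  ((size r)%:R^-1 * \sum_(i <- r) x i) ^+ 2 <= (size r)%:R^-1 * \sum_(i <- r) x i ^+ 2.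
Proof.
have [->|r0] := eqVneq (size r) 0%N; first by rewrite invr0 !mul0r expr0n.
have k0 : 0 < (size r)%:R :> R by rewrite ltr0n lt0n.
set k := (size r)%:R in k0 *; set S := \sum_(i <- r) x i; set Q := \sum_(i <- r) _.
pose m := k^-1 * S.
have : 0 <= \sum_(i <- r) (x i - m) ^+ 2 by apply: sumr_ge0 => i _; rewrite sqr_ge0.
have -> : \sum_(i <- r) (x i - m) ^+ 2 = Q - k * m ^+ 2.
  transitivity (\sum_(i <- r) (x i ^+ 2 - 2 * m * x i + m ^+ 2)).
    by apply: eq_bigr => i _; ring.
  rewrite big_split sumrB /= -mulr_sumr sumr_const_size -[X in _ + X = _]mulr_natl -/Q -/S -/k.
  have -> : S = k * m by rewrite /m mulrA divff ?mul1r// gt_eqF.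
  by ring.
rewrite subr_ge0 => h; rewrite -/m -(ler_pM2l k0) (le_trans h)// mulrA divff ?mul1r//.
by rewrite gt_eqF.
Qed.

Lemma mean_sqrt_le (I : Type) (r : seq I) (x : I -> R) : (forall i, 0 <= x i) ->
  (size r)%:R^-1 * \sum_(i <- r) Num.sqrt (x i) <= Num.sqrt ((size r)%:R^-1 * \sum_(i <- r) x i).
Proof.
move=> x0; rewrite -[leLHS]ger0_norm; last first.
  by rewrite mulr_ge0 ?invr_ge0// sumr_ge0// => i _; rewrite sqrtr_ge0.
rewrite -sqrtr_sqr ler_sqrt; last by rewrite mulr_ge0 ?invr_ge0// sumr_ge0.
rewrite (le_trans (mean_sqr_le _ _))// ler_wpM2l ?invr_ge0//.
by apply: ler_sum => i _; rewrite sqr_sqrtr.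
Qed.

End real_averages.

Section box_average.
Context {R : realType} {H : completeNormedModType R[i]} {V : zmodType}.
Implicit Types (F G : V -> H) (vs : seq V) (v a b : V).

Definition box_average vs L F a : H :=
  ((L ^ size vs)%:R^-1 : R)%:C *: \sum_(m <- box_points vs L) F (a + m).

Lemma box_average_cons v vs L F a : box_average (v :: vs) L F a =
  (L%:R^-1 : R)%:C *: \sum_(0 <= t < L) box_average vs L F (a + v *+ t).
Proof.
rewrite /box_average box_points_sum -scaler_sumr scalerA -rmorphM /=.
rewrite -invfM -natrM -expnS; congr (_ *: _).
by apply: eq_bigr => t _; apply: eq_bigr => m _; rewrite addrA.
Qed.

(** Here the direction [v] is averaged inside, at the level of the function, so that an induction on
    [vs] can be applied to the averaged function. *)
Lemma box_average_consr v vs L F a : box_average (v :: vs) L F a =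
  box_average vs L (fun b => (L%:R^-1 : R)%:C *: \sum_(0 <= t < L) F (b + v *+ t)) a.
Proof.
rewrite /box_average box_points_sum -scaler_sumr scalerA -rmorphM /=.
rewrite -invfM -natrM -expnSr exchange_big; congr (_ *: _).
by apply: eq_bigr => m _; apply: eq_bigr => t _; rewrite addrCA addrC.
Qed.

Lemma nr_average_le (I : Type) (r : seq I) (x : I -> H) (C : R) : (0 < size r)%N ->
  (forall i, nr (x i) <= C) -> nr (((size r)%:R^-1 : R)%:C *: \sum_(i <- r) x i) <= C.
Proof.
move=> r0 h; rewrite nrZR ger0_norm ?invr_ge0// ler_pdivrMl ?ltr0n//.
apply: (le_trans (nr_sum _ _ _)); apply: (@le_trans _ _ (\sum_(i <- r) C)).
  exact: ler_sum.
by rewrite sumr_const_size mulr_natl.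
Qed.

Lemma nr_average_nat_le L (x : nat -> H) (C : R) : (0 < L)%N ->
  (forall i, nr (x i) <= C) -> nr ((L%:R^-1 : R)%:C *: \sum_(0 <= t < L) x t) <= C.
Proof.
move=> L0 h; have := @nr_average_le _ (iota 0 L) x C.
by rewrite size_iota /index_iota subn0; apply.
Qed.

Lemma box_averageB vs L F G a :
  box_average vs L F a - box_average vs L G a = box_average vs L (fun b => F b - G b) a.
Proof. by rewrite /box_average -scalerBr sumrB. Qed.

Lemma box_average_shift vs L F u a :
  box_average vs L F (a + u) = box_average vs L (fun b => F (b + u)) a.
Proof. by congr (_ *: _); apply: eq_bigr => m _; rewrite addrAC. Qed.

Lemma box_average_scale_sum vs L L' v (c : R[i]) F a :
  box_average vs L (fun b => c *: \sum_(0 <= t < L') F (b + v *+ t)) a =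
  c *: \sum_(0 <= t < L') box_average vs L F (a + v *+ t).
Proof.
rewrite /box_average -scaler_sumr -scaler_sumr !scalerA mulrC exchange_big.
congr (_ *: _); apply: eq_bigr => m _; apply: eq_bigr => t _; congr F.
by rewrite addrAC.
Qed.

Lemma nr_box_average_le vs L F a (C : R) : (0 < L)%N ->
  (L ^ size vs)%:R^-1 * \sum_(m <- box_points vs L) nr (F (a + m)) <= C ->
  nr (box_average vs L F a) <= C.
Proof.
move=> L0; apply: le_trans; rewrite nrZR ger0_norm ?invr_ge0// ler_wpM2l ?invr_ge0//.
exact: nr_sum.
Qed.

Lemma nr_box_average_cst vs L F a (C : R) : (0 < L)%N ->
  (forall b, nr (F b) <= C) -> nr (box_average vs L F a) <= C.
Proof.
move=> L0 h; rewrite /box_average -size_box_points.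
by apply: nr_average_le => //; rewrite size_box_points expn_gt0 L0.
Qed.

(** The box of side [2 * L] splits into translates of the box of side [L], half of which are
    displaced by [L] along a given [v]; hence the factor [2^-1]. The induction peels off [v] and
    replaces [F] by its average [G] along [v]. *)
Lemma box_average_double vs L F (D : V -> R) a : (0 < L)%N ->
  (forall v b, v \in vs ->
     nr (box_average vs L F (b + v *+ L) - box_average vs L F b) <= D v) ->
  nr (box_average vs (2 * L) F a - box_average vs L F a) <= 2^-1 * \sum_(v <- vs) D v.
Proof.
move=> L0; elim: vs F a => [|v vs ih] F a hD.
  by rewrite /box_average /= !big_seq1 !expn0 subrr nr0 big_nil mulr0.
pose G b := (L%:R^-1 : R)%:C *: \sum_(0 <= t < L) F (b + v *+ t).
have EG b : box_average (v :: vs) L F b = box_average vs L G b.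
  by rewrite box_average_consr.
have E2 : box_average (v :: vs) (2 * L) F a =
    (2^-1 : R)%:C *: (box_average vs (2 * L) G a + box_average vs (2 * L) G (a + v *+ L)).
  rewrite !box_average_scale_sum box_average_cons -scalerDr scalerA -rmorphM /=.
  rewrite -invfM -natrM; congr (_ *: _).
  rewrite (@big_cat_nat _ _ _ L) ?leq_pmull//=; congr (_ + _).
  have h (f : nat -> H) : \sum_(L <= i < 2 * L) f i = \sum_(0 <= i < L) f (i + L)%N.
    by rewrite -{1}[L]add0n big_addn mul2n -addnn addnK.
  by rewrite h; apply: eq_bigr => t _; rewrite -addrA -mulrnDr addnC.
have hDs w b : w \in vs -> nr (box_average vs L G (b + w *+ L) - box_average vs L G b) <= D w.
  by move=> wvs; rewrite -!EG; apply: hD; rewrite inE wvs orbT.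
have e : box_average (v :: vs) (2 * L) F a - box_average (v :: vs) L F a =
   (2^-1 : R)%:C *: ((box_average vs (2 * L) G a - box_average vs L G a) +
     (box_average vs (2 * L) G (a + v *+ L) - box_average vs L G (a + v *+ L)) +
     (box_average vs L G (a + v *+ L) - box_average vs L G a)).
  rewrite E2 EG; set A := box_average _ _ _ a; set B := box_average _ _ _ (a + _).
  set C := box_average _ _ _ a; set C' := box_average _ _ _ (a + _).
  rewrite -addrA subrKA addrACA -[in RHS]opprD scalerBr; congr (_ - _).
  rewrite scalerDr -scalerDl -rmorphD /= (_ : 2^-1 + 2^-1 = 1 :> R) ?scale1r//.
  by lra.
rewrite e nrZR ger0_norm ?invr_ge0// ler_wpM2l ?invr_ge0// big_cons addrC.
apply: (le_trans (nrD _ _)); apply: lerD.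
  by rewrite -!EG; apply: hD; rewrite inE eqxx.
apply: (le_trans (nrD _ _)); have := lerD (ih G a hDs) (ih G (a + v *+ L) hDs).
by move=> h; apply: (le_trans h); rewrite -mulrDl [2^-1 + _]addrC; lra.
Qed.

(** The averages over a box and over its translate by [v] differ only in two opposite faces, each
    carrying the proportion [1 / L] of the points. *)
Lemma box_average_step v vs L F a (C : R) : (0 < L)%N -> v \in vs ->
  (forall b, nr (F b) <= C) ->
  nr (box_average vs L F (a + v) - box_average vs L F a) <= 2 * C / L%:R.
Proof.
move=> L0 + hC; elim: vs a => [//|w vs ih] a; rewrite inE.
have [<- _|_ /= vvs] := eqVneq v w.
  rewrite !box_average_cons -scalerBr -sumrB.
  rewrite (eq_big_nat _ _ (F2 := fun t => box_average vs L F (a + v *+ t.+1) - box_average vs L F (a + v *+ t))); last first.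
    by move=> t _; rewrite mulrS addrA.
  rewrite telescope_sumr// nrZR ger0_norm ?invr_ge0// mulrC ler_wpM2r ?invr_ge0//.
  apply: (le_trans (nrB _ _)); rewrite mulr_natl mulr2n lerD//; exact: nr_box_average_cst.
rewrite !box_average_cons -scalerBr -sumrB.
apply: nr_average_nat_le => // t; rewrite addrAC; exact: ih.
Qed.

(** The displacement by [L] steps telescopes into single steps, each controlled by the mean of the
    increments of [F] over a box. This is the origin of the factor [L] in front of the means of the
    commutators. *)
Lemma box_average_gradient v vs L F b (C : R) : (0 < L)%N ->
  (forall a, (L ^ size vs)%:R^-1 * \sum_(m <- box_points vs L) nr (F (a + m + v) - F (a + m)) <= C) ->
  nr (box_average vs L F (b + v *+ L) - box_average vs L F b) <= L%:R * C.
Proof.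
move=> L0 hC.
have -> : box_average vs L F (b + v *+ L) - box_average vs L F b =
    \sum_(0 <= t < L) (box_average vs L F (b + v *+ t.+1) - box_average vs L F (b + v *+ t)).
  by rewrite telescope_sumr// mulr0n addr0.
apply: (le_trans (nr_sum _ _ _)).
rewrite mulr_natl -[X in C *+ X]subn0 -sumr_const_nat; apply: ler_sum => t _.
rewrite (mulrSr v) (addrA b) (box_average_shift _ _ _ v) box_averageB.
by apply: nr_box_average_le.
Qed.

End box_average.

(** * Convergence along unbounded sequences *)

(** The Bessel inequality concerns lists without repetition. The vanishing of the coordinates
    outside [js] is what the induction carries along. *)
Lemma uniq_box_points_delta n (js : seq 'I_n) L : uniq js ->
  uniq (box_points [seq (delta_mx 0 j : 'rV[int]_n) | j <- js] L) /\
  forall m j, m \in box_points [seq (delta_mx 0 j : 'rV[int]_n) | j <- js] L ->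
    j \notin js -> m 0 j = 0.
Proof.
elim: js => [|k js ih] /=.
  by split=> // m j; rewrite inE => /eqP -> _; rewrite mxE.
case/andP => kjs /ih[ujs hjs]; split.
  apply: allpairs_uniq => //; first exact: iota_uniq.
  move=> _ _ /allpairsP[[t m] [/= _ mjs ->]] /allpairsP[[u p] [/= _ pjs ->]] /=.
  move=> e; have /rowP/(_ k) := e; rewrite !mxE !mulmxnE !mxE !eqxx /= (hjs _ _ mjs kjs) (hjs _ _ pjs kjs).
  rewrite !addr0 => /eqP; rewrite eqr_nat => /eqP tu.
  by move: e; rewrite tu => /addrI ->.
move=> m j /allpairsP[[t p] [/= _ pjs ->]]; rewrite inE negb_or => /andP[jk jjs].
by rewrite !mxE mulmxnE mxE eqxx (negPf jk) /= mul0rn add0r (hjs _ _ pjs jjs).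
Qed.

Section lattice_point.
Context {R : realType} {n : nat}.
Variable d : R.
Implicit Types m : 'rV[int]_n.

Definition lattice_point m : 'rV[R]_n := d *: map_mx intr m.

Lemma lattice_pointD m m' : lattice_point (m + m') = lattice_point m + lattice_point m'.
Proof. by rewrite /lattice_point map_mxD scalerDr. Qed.

Lemma lattice_pointN m : lattice_point (- m) = - lattice_point m.
Proof. by rewrite /lattice_point map_mxN scalerN. Qed.

Lemma lattice_pointB m m' : lattice_point (m - m') = lattice_point m - lattice_point m'.
Proof. by rewrite lattice_pointD lattice_pointN. Qed.

Lemma lattice_point0 : lattice_point 0 = 0.
Proof. by rewrite /lattice_point map_mx0 scaler0. Qed.

Lemma lattice_point_delta j : lattice_point (delta_mx 0 j) = d *: delta_mx 0 j.
Proof. by rewrite /lattice_point map_delta_mx. Qed.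

End lattice_point.

(** * The orbit of one vector satisfying Bessel inequalities on all lattices *)

Section commutator_limit.
Context {R : realType} {H : completeNormedModType R[i]}.
Variable dot : {dot H for Num.conj}.
Hypothesis hdot : dot_induces_norm dot.
Variable n : nat.
Hypothesis n3 : (3 <= n)%N.

Local Notation E j := (delta_mx 0 j : 'rV[R]_n).

Variable U : 'rV[R]_n -> H -> H.
Hypothesis Ulin : forall a, linear (U a).
Hypothesis Uiso : forall a x, nr (U a x) = nr x.
Hypothesis UD : forall a b x, U (a + b) x = U a (U b x).
Hypothesis Uadj : forall a x y, dot (U a x) y = dot x (U (- a) y).
Hypothesis Ucont : forall x j (e : R), 0 < e -> exists2 d : R, 0 < d &
  forall t : R, 0 <= t <= d -> nr (U (t *: E j) x - x) < e.

Variable T : H -> H.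
Variable M : R.
Hypothesis M0 : 0 <= M.
Hypothesis TM : forall x, nr (T x) <= M * nr x.

Variable K : 'I_n -> H -> H.
Hypothesis cK : forall j, lorentz_ideal dot n (K j).
Hypothesis duhamel : forall j (t0 : R) g (C : R), 0 <= t0 ->
  (forall t : R, 0 <= t <= t0 -> nr (K j (U (t *: E j) g)) <= C) ->
  nr (U (- (t0 *: E j)) (T (U (t0 *: E j) g)) - T g) <= t0 * C.

Variable h : H.
(** The constant may depend on the mesh [p.+1%:R^-1], which is fixed before the limit along the
    sequence is taken. *)
Hypothesis bessel : forall p : nat, exists C : R, 0 <= C /\
  forall L : seq 'rV[int]_n, uniq L -> forall e,
    \sum_(m <- L) cmod (dot (U (lattice_point p.+1%:R^-1 m) h) e) ^+ 2 <= C * nr e ^+ 2.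

Let F a := U (- a) (T (U a h)).

Lemma nr_orbit a : nr (F a) <= M * nr h.
Proof. by rewrite Uiso (le_trans (TM _))// Uiso. Qed.

Lemma orbit_diff a v :
  nr (F (a + v) - F a) = nr (U (- v) (T (U v (U a h))) - T (U a h)).
Proof.
by rewrite /F opprD UD -(linB (Ulin _)) Uiso [a + v]addrC UD.
Qed.

Lemma commutator_op_bound j : exists2 B : R, 0 <= B & forall x, nr (K j x) <= B * nr x.
Proof. by have [[/bounded_operatorP[_ //] _] _] := cK j. Qed.

Lemma K_lin j : linear (K j).
Proof. by have [[[//]]] := cK j. Qed.

Lemma orbit_lipschitz j : exists2 B : R, 0 <= B &
  forall a (t : R), 0 <= t -> nr (F (a + t *: E j) - F a) <= t * B.
Proof.
have [B B0 hB] := commutator_op_bound j.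
exists (B * nr h); first by rewrite mulr_ge0 ?nr_ge0.
move=> a t t0; rewrite orbit_diff; apply: duhamel => // u _.
by rewrite (le_trans (hB _))// !Uiso.
Qed.

(** The integral in Duhamel's formula becomes a sum over [p] nodes. The error [e] is uniform in [a]
    because [U (t *: E j)] commutes with the isometry [U a], so that only the continuity of
    [U (t *: E j) h] at [t = 0] matters. *)
Lemma orbit_gradient j (d e : R) : 0 < d -> 0 < e -> exists2 p, (0 < p)%N & forall a,
  nr (F (a + d *: E j) - F a) <=
  d * (p%:R^-1 * \sum_(0 <= i < p) nr (K j (U (a + (i%:R * (d / p%:R)) *: E j) h)) + e).
Proof.
move=> d0 e0; have [B B0 hB] := commutator_op_bound j.
have [|r r0 hr] := @Ucont h j (e / (B + 1)); first by rewrite divr_gt0// ltr_wpDl.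
pose p := (Num.bound (d / r)).+1; exists p => // a.
have p0 : 0 < p%:R :> R by rewrite ltr0n.
have dpr : d / p%:R <= r.
  rewrite ler_pdivrMr// mulrC -ler_pdivrMr//.
  have dr0 : 0 <= d / r by rewrite divr_ge0 ?ltW.
  by rewrite (le_trans (ltW (archi_boundP dr0)))// ler_nat leqnSn.
pose q := d / p%:R; have q0 : 0 <= q by rewrite divr_ge0 ?ltW.
have -> : F (a + d *: E j) - F a =
    \sum_(0 <= i < p) (F (a + (i.+1%:R * q) *: E j) - F (a + (i%:R * q) *: E j)).
  rewrite (telescope_sumr (fun i => F (a + (i%:R * q) *: E j)))// mul0r scale0r addr0.
  by rewrite /q mulrCA divff ?mulr1// gt_eqF.
apply: (le_trans (nr_sum _ _ _)).
apply: (@le_trans _ _ (\sum_(0 <= i < p) q * (nr (K j (U (a + (i%:R * q) *: E j) h)) + e))).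
  apply: ler_sum => i _.
  have -> : a + (i.+1%:R * q) *: E j = a + (i%:R * q) *: E j + q *: E j.
    by rewrite -natr1 mulrDl mul1r scalerDl addrA.
  set b := a + _; rewrite orbit_diff; apply: duhamel => // t /andP[t0 tq].
  have -> : U (t *: E j) (U b h) = U b h + U b (U (t *: E j) h - h).
    by rewrite -UD addrC UD (linB (Ulin _)) addrC subrK.
  rewrite (linD (K_lin j)) (le_trans (nrD _ _))// lerD2l.
  rewrite (le_trans (hB _))// Uiso.
  have := hr t; rewrite t0 (le_trans tq dpr) => /(_ isT).
  rewrite ltr_pdivlMr ?ltr_wpDl// => /ltW; apply: le_trans.
  by rewrite mulrC ler_wpM2l ?nr_ge0// lerDl.
rewrite -mulr_sumr big_split/= sumr_const_nat subn0 -[e *+ p]mulr_natl.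
by rewrite le_eqVlt; apply/orP; left; apply/eqP; rewrite /q; field; rewrite gt_eqF.
Qed.

Section lattice.
Variable p : nat.
Let d : R := p.+1%:R^-1.

Let d0 : 0 < d. Proof. by rewrite invr_gt0. Qed.

Let vs : seq 'rV[R]_n := [seq d *: E j | j <- enum 'I_n].
Let us : seq 'rV[int]_n := [seq delta_mx 0 j | j <- enum 'I_n].

Lemma size_vs : size vs = n.
Proof. by rewrite size_map -cardE card_ord. Qed.

Lemma box_lattice L : box_points vs L = map (lattice_point d) (box_points us L).
Proof.
rewrite map_box_points; first congr box_points.
- by rewrite /us -map_comp; apply: eq_map => j /=; rewrite lattice_point_delta.
- exact: lattice_point0.
- exact: lattice_pointD.
Qed.

Lemma commutator_decomp j : exists s : nat -> R, [/\ singular_values dot (K j) s,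
  (\sum_(0 <= i <oo) (s i * i.+1%:R `^ (-1 + n%:R^-1))%:E < +oo)%E &
  forall N, exists k (e : 'I_k -> H) (sg : 'I_k -> R),
    \sum_i sg i ^+ 2 <= \sum_(0 <= i < N) s i ^+ 2 /\
    forall g, nr (K j g) <= Num.sqrt (\sum_i sg i ^+ 2 * cmod (dot g (e i)) ^+ 2) + s N * nr g /\
      forall i, nr (e i) = 1].
Proof.
have [cKj [s hs ss]] := cK j; exists s; split=> // N.
have [k [e [sg [he hsg hK]]]] := singular_vectors hdot cKj N hs.
exists k, e, sg; split; first by rewrite big_mkord.
move=> g; split; first by apply: nr_compact_le => //; case: hs.
move=> i; have := he.1 i i; rewrite eqxx dotxx// => /complexI/eqP.
by rewrite sqrp_eq1 ?nr_ge0// => /eqP.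
Qed.

(** By concavity of the square root the mean passes under it, where the Bessel inequality applies to
    each singular vector separately. The cut [N] and the side [L] are still independent here. *)
Lemma commutator_mean (j : 'I_n) : exists C : R, exists s : nat -> R, [/\ singular_values dot (K j) s,
  (\sum_(0 <= i <oo) (s i * i.+1%:R `^ (-1 + n%:R^-1))%:E < +oo)%E &
  forall L N a, (0 < L)%N ->
   (L ^ n)%:R^-1 * \sum_(m <- box_points vs L) nr (K j (U (a + m) h)) <=
   C * Num.sqrt ((\sum_(0 <= i < N) s i ^+ 2) / (L ^ n)%:R) + s N * nr h].
Proof.
have [C [C0 hC]] := bessel p; have [s [hs ss hN]] := commutator_decomp j.
exists (Num.sqrt C), s; split => // L N a L0.
have [k [e [sg [hsg hK]]]] := hN N.
have Ln0 : 0 < (L ^ n)%:R :> R by rewrite ltr0n expn_gt0 L0.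
pose q m := \sum_i sg i ^+ 2 * cmod (dot (U (a + m) h) (e i)) ^+ 2.
have q0 m : 0 <= q m by apply: sumr_ge0 => i _; rewrite mulr_ge0 ?sqr_ge0.
apply: (@le_trans _ _ ((L ^ n)%:R^-1 * \sum_(m <- box_points vs L) (Num.sqrt (q m) + s N * nr h))).
  rewrite ler_wpM2l ?invr_ge0//; apply: ler_sum => m _.
  by have [+ _] := hK (U (a + m) h); rewrite Uiso.
rewrite big_split/= mulrDr sumr_const_size size_box_points size_vs.
rewrite -[s N * nr h *+ _]mulr_natl (mulKf (lt0r_neq0 Ln0)) lerD2r.
have := @mean_sqrt_le _ _ (box_points vs L) _ q0.
rewrite size_box_points size_vs => /le_trans; apply.
rewrite -sqrtrM// ler_sqrt; last first.
  by rewrite mulr_ge0// divr_ge0 ?(ltW Ln0)// sumr_ge0// => i _; rewrite sqr_ge0.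
rewrite [leRHS]mulrA mulrC ler_wpM2r ?invr_ge0 ?(ltW Ln0)//.
rewrite /q exchange_big/=; apply: (@le_trans _ _ (\sum_i sg i ^+ 2 * C)); last first.
  by rewrite -mulr_suml mulrC ler_wpM2l.
apply: ler_sum => i _; rewrite -mulr_sumr ler_wpM2l ?sqr_ge0// box_lattice big_map.
have [_ /(_ i) ei] := hK 0.
have [uu _] := uniq_box_points_delta L (enum_uniq 'I_n).
(* The base point [a] is moved onto the singular vector, whose norm does not change: hence a bound
   uniform in [a]. *)
have := hC _ uu (U (- a) (e i)); rewrite Uiso ei expr1n mulr1; apply: le_trans.
by apply: ler_sum => m _; rewrite UD Uadj.
Qed.

(** For [L = 2 ^ i] and [N = L ^ n], the two parts of [commutator_mean] times [L] are summable by
    [lorentz_mean_bounded] and [lorentz_dyadic_bounded]. The nodes of [orbit_gradient] merely shift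
    the base point of the box, on which the bound does not depend. *)
Lemma orbit_mean_gradient (j : 'I_n) : exists g : nat -> R,
  (exists B : R, forall I, \sum_(0 <= i < I) 2 ^+ i * g i <= B) /\
  forall i, 0 <= g i /\
    forall a, ((2 ^ i) ^ size vs)%:R^-1 * \sum_(m <- box_points vs (2 ^ i)) nr (F (a + m + d *: E j) - F (a + m)) <= g i.
Proof.
have [C [s [hs ss hC]]] := commutator_mean j.
have [s0 sni _] := hs.
have [B1 hB1] := lorentz_dyadic_bounded n3 s0 sni ss.
have [B2 hB2] := lorentz_mean_bounded n3 s0 sni ss.
pose b i := C * Num.sqrt ((\sum_(0 <= j < 2 ^ (i * n)) s j ^+ 2) / (2 ^ (i * n))%:R) + s (2 ^ (i * n))%N * nr h.
have hb i a : ((2 ^ i) ^ n)%:R^-1 * \sum_(m <- box_points vs (2 ^ i)) nr (K j (U (a + m) h)) <= b i.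
  have := hC (2 ^ i)%N (2 ^ (i * n))%N a; rewrite -expnM; apply.
  by rewrite expn_gt0.
have b0 i : 0 <= b i.
  apply: le_trans (hb i 0); rewrite mulr_ge0 ?invr_ge0// sumr_ge0// => m _; exact: nr_ge0.
exists (fun i => d * b i); split.
  exists (d * (`|C| * B2 + B1 * nr h)) => I.
  under eq_bigr do rewrite mulrCA.
  rewrite -mulr_sumr ler_wpM2l ?(ltW d0)//.
  apply: (@le_trans _ _ (\sum_(0 <= i < I) (`|C| * (2 ^+ i *
     Num.sqrt (\sum_(0 <= j < 2 ^ (i * n)) s j ^+ 2 / (2 ^ (i * n))%:R)) + 2 ^+ i * s (2 ^ (i * n))%N * nr h))).
    apply: ler_sum => i _; rewrite /b mulrDr [X in _ <= _ + X]mulrAC -mulrA [nr h * _]mulrC lerD2r.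
    rewrite mulrCA -mulr_suml ler_wpM2r ?ler_norm// mulr_ge0 ?sqrtr_ge0 ?exprn_ge0//.
  rewrite big_split/= -mulr_sumr -mulr_suml lerD// ?ler_wpM2l ?ler_wpM2r ?nr_ge0//.
move=> i; split; first by rewrite mulr_ge0 ?(ltW d0).
move=> a; rewrite size_vs; set Q := ((2 ^ i) ^ n)%:R^-1.
have Q0 : 0 < ((2 ^ i) ^ n)%:R :> R by rewrite ltr0n !expn_gt0.
suff key (e : R) : 0 < e -> Q * \sum_(m <- box_points vs (2 ^ i))
    nr (F (a + m + d *: E j) - F (a + m)) <= d * (b i + e).
  rewrite -ler_pdivrMl//; apply/ler_addgt0Pr => e e0.
  by rewrite ler_pdivrMl//; exact: key.
move=> e0; have [q q0 hq] := orbit_gradient j d0 e0.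
apply: (@le_trans _ _ (Q * \sum_(m <- box_points vs (2 ^ i)) (d * (q%:R^-1 *
   \sum_(0 <= l < q) nr (K j (U (a + m + (l%:R * (d / q%:R)) *: E j) h)) + e)))).
  by rewrite ler_wpM2l ?invr_ge0 ?(ltW Q0)//; apply: ler_sum => m _; exact: hq.
rewrite -mulr_sumr mulrCA ler_wpM2l ?(ltW d0)// big_split/= mulrDr.
rewrite sumr_const_size size_box_points size_vs -[e *+ _]mulr_natl (mulKf (lt0r_neq0 Q0)) lerD2r.
rewrite -mulr_sumr mulrCA exchange_big/= ler_pdivrMl ?ltr0n// mulr_sumr.
rewrite mulr_natl -[X in b i *+ X]subn0 -sumr_const_nat; apply: ler_sum => l _.
apply: le_trans (hb i (a + (l%:R * (d / q%:R)) *: E j)); rewrite ler_wpM2l ?invr_ge0 ?(ltW Q0)//.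
by apply: ler_sum => m _; rewrite addrAC.
Qed.

Lemma box_average_dyadic : exists G : nat -> R,
  [/\ (exists B : R, forall I, \sum_(0 <= i < I) G i <= B), (forall i, 0 <= G i) &
  forall i a, nr (box_average vs (2 ^ i.+1) F a - box_average vs (2 ^ i) F a) <= G i].
Proof.
have /choice[g hg] := orbit_mean_gradient.
pose S i : R := \sum_j 2 ^+ i * g j i.
have g0 j i : 0 <= g j i by have [_ /(_ i)[]] := hg j.
have S0 i : 0 <= S i by apply: sumr_ge0 => j _; rewrite mulr_ge0 ?exprn_ge0.
(* The bound fed to [box_average_double] does not distinguish the directions: each gets the whole
   sum [S i], whence the factor [n]. *)
exists (fun i => 2^-1 * (n%:R * S i)); split; last 1 first.
- move=> i a; have -> : n%:R * S i = \sum_(v <- vs) S i.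
    by rewrite sumr_const_size size_vs mulr_natl.
  rewrite expnS.
  apply: (@box_average_double _ _ _ vs _ _ (fun=> S i)) => [|v b]; first by rewrite expn_gt0.
  case/mapP => j _ ->; rewrite /S (bigD1 j)//= -[leLHS]addr0 lerD//; last first.
    by apply: sumr_ge0 => k _; rewrite mulr_ge0 ?exprn_ge0.
  have [_ /(_ i)[_ h1]] := hg j.
  rewrite -natrX; apply: box_average_gradient => //; by rewrite expn_gt0.
- have /choice[B hB] : forall j, exists B : R, forall I, \sum_(0 <= i < I) 2 ^+ i * g j i <= B.
    by move=> j; have [] := hg j.
  exists (2^-1 * (n%:R * \sum_j B j)) => I.
  rewrite -!mulr_sumr ler_wpM2l ?invr_ge0// ler_wpM2l// /S exchange_big/=.
  by apply: ler_sum.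
- by move=> i; rewrite !mulr_ge0 ?invr_ge0.
Qed.

Lemma box_average_tail (e : R) : 0 < e -> exists I, forall J a, (I <= J)%N ->
  nr (box_average vs (2 ^ J) F a - box_average vs (2 ^ I) F a) <= e.
Proof.
move=> e0; have [G [[B hB] G0 hG]] := box_average_dyadic.
pose S := [set \sum_(0 <= i < I) G i | I in [set: nat]].
have supS : has_sup S.
  split; first by exists (\sum_(0 <= i < 0) G i); exists 0%N.
  by exists B => _ [I _ <-].
have [_ [I _ <-] hI] := sup_adherent e0 supS.
exists I => J a IJ.
apply: (@le_trans _ _ (\sum_(I <= i < J) G i)).
  rewrite -(telescope_sumr (fun i => box_average vs (2 ^ i) F a))//.
  by rewrite (le_trans (nr_sum _ _ _))//; apply: ler_sum.
have : \sum_(0 <= i < J) G i <= sup S.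
  by apply: ub_le_sup; [case: supS|exists J].
by rewrite (@big_cat_nat _ _ _ I)//=; move: hI; lra.
Qed.

Variable m : nat -> 'rV[int]_n.
Hypothesis m_leaves : forall L : seq 'rV[int]_n, \forall k \near \oo, m k \notin L.

Let a k := lattice_point d (m k).

(** The Bessel inequality allows at most [C * nr y ^+ 2 / e ^+ 2] lattice points at which the
    coefficient is at least [e] in modulus. A sequence that leaves every finite set and meets such
    points infinitely often would supply arbitrarily many. *)
Lemma orbit_weak y (e : R) : 0 < e -> \forall k \near \oo, cmod (dot (U (a k) h) y) < e.
Proof.
move=> e0; have [C [C0 hC]] := bessel p.
apply: contrapT => hn.
have bad N : exists2 k, (N <= k)%N & e <= cmod (dot (U (a k) h) y).
  apply: contrapT => hb; apply: hn; exists N => // k Nk /=.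
  by rewrite ltNge; apply/negP => hk; apply: hb; exists k.
have long q : exists L : seq 'rV[int]_n, [/\ uniq L, size L = q &
    forall x, x \in L -> e <= cmod (dot (U (lattice_point d x) h) y)].
  elim: q => [|q [L [uL sL hL]]]; first by exists [::].
  have [N _ hN] := m_leaves L; have [k Nk hk] := bad N.
  exists (m k :: L); split => /=; [by rewrite uL andbT; exact: hN|by rewrite sL|].
  by move=> x; rewrite inE => /orP[/eqP ->|/hL].
pose q := Num.bound (C * nr y ^+ 2 / e ^+ 2).
have [L [uL sL hL]] := long q.
have := hC L uL y; rewrite leNgt => /negP; apply.
apply: (@lt_le_trans _ _ (q%:R * e ^+ 2)).
  by rewrite -ltr_pdivrMr ?exprn_gt0// archi_boundP// divr_ge0 ?sqr_ge0// mulr_ge0// sqr_ge0.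
rewrite -sL mulr_natl -sumr_const_size big_seq [leRHS]big_seq; apply: ler_sum => x /hL hx.
by rewrite ler_pXn2r ?nnegrE ?cmod_ge0// ltW.
Qed.

(** Beyond the [N]-th singular value the operator is small in norm; before it finitely many singular
    vectors remain, which weak convergence handles one by one. *)
Lemma orbit_compact_vanish j b (e : R) : 0 < e ->
  \forall k \near \oo, nr (K j (U (a k + b) h)) < e.
Proof.
move=> e0; have [s [hs ss hN]] := commutator_decomp j; have [s0 sni _] := hs.
have h1 : 0 < nr h + 1 by rewrite ltr_wpDl ?nr_ge0.
have [|N sN] := @lorentz_vanish _ _ _ n3 s0 sni ss (e / 2 / (nr h + 1)).
  by rewrite !divr_gt0.
have [k [ev [sg [_ hK]]]] := hN N.
pose S := \sum_i sg i ^+ 2.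
have S0 : 0 <= S by apply: sumr_ge0 => i _; rewrite sqr_ge0.
have S1 : 0 < S + 1 by rewrite ltr_wpDl.
(* With this threshold the sum of squares is at most [S / (S + 1)^2] times [(e / 2)^2]. *)
have et : 0 < e / 2 / (S + 1) by rewrite !divr_gt0.
have : \forall l \near \oo, forall i, cmod (dot (U (a l) h) (U (- b) (ev i))) < e / 2 / (S + 1).
  by apply: filter_forall => i; exact: orbit_weak.
apply: filterS => l hl.
have [+ _] := hK (U (a l + b) h) => /le_lt_trans; apply.
rewrite Uiso [ltRHS](splitr e); apply: ler_ltD.
  rewrite -[leRHS]ger0_norm ?divr_ge0 ?(ltW e0)// -sqrtr_sqr ler_sqrt ?sqr_ge0//.
  apply: (@le_trans _ _ (\sum_i sg i ^+ 2 * (e / 2 / (S + 1)) ^+ 2)).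
    apply: ler_sum => i _; rewrite ler_wpM2l ?sqr_ge0//.
    rewrite ler_pXn2r ?nnegrE ?cmod_ge0 ?(ltW et)//.
    by rewrite [a l + b]addrC UD Uadj ltW.
  rewrite -mulr_suml -/S [(_ / (S + 1)) ^+ 2]exprMn exprVn mulrCA -[leRHS]mulr1.
  rewrite ler_wpM2l ?sqr_ge0// ler_pdivrMr ?exprn_gt0// mul1r expr2.
  by nra.
apply: (@le_lt_trans _ _ (s N * (nr h + 1))); first by rewrite ler_wpM2l// lerDl.
by rewrite -ltr_pdivlMr.
Qed.

(** The approximating sum has finitely many nodes, whose number does not depend on [k]. *)
Lemma orbit_gradient_vanish j b (e : R) : 0 < e ->
  \forall k \near \oo, nr (F (a k + b + d *: E j) - F (a k + b)) < e.
Proof.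
move=> e0; have e1 : 0 < e / (3 * d) by rewrite divr_gt0// mulr_gt0.
have [q q0 hq] := orbit_gradient j d0 e1.
have : \forall k \near \oo, forall i : 'I_q, nr (K j (U (a k + (b + (i%:R * (d / q%:R)) *: E j)) h)) < e / (3 * d).
  by apply: filter_forall => i; exact: orbit_compact_vanish.
apply: filterS => k hk; apply: (le_lt_trans (hq _)).
apply: (@le_lt_trans _ _ (d * (e / (3 * d) + e / (3 * d)))).
  rewrite ler_wpM2l ?(ltW d0)// lerD2r ler_pdivrMl ?ltr0n// big_mkord [leRHS]mulr_natl.
  have -> : e / (3 * d) *+ q = \sum_(i < q) e / (3 * d) by rewrite sumr_const card_ord.
  by apply: ler_sum => i _; rewrite -addrA ltW.
have -> : d * (e / (3 * d) + e / (3 * d)) = 2 / 3 * e by field; rewrite gt_eqF.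
by lra.
Qed.

(** Induction on the directions, and on the number of steps in each; the offset [b] absorbs the part
    of the way already covered. *)
Lemma orbit_shift_vanish ws L x b (e : R) : 0 < e -> {subset ws <= vs} ->
  x \in box_points ws L ->
  \forall k \near \oo, nr (F (a k + b + x) - F (a k + b)) < e.
Proof.
move=> e0; elim: ws x b e e0 => [|v ws ih] x b e e0 wv.
  by rewrite inE => /eqP ->; near=> k; rewrite addr0 subrr nr0.
case/allpairsP => -[t y] [/= _ yws ->].
have e2 : 0 < e / 2 by rewrite divr_gt0.
have h1 : \forall k \near \oo, nr (F (a k + (b + v *+ t) + y) - F (a k + (b + v *+ t))) < e / 2.
  by apply: ih => // u uws; apply: wv; rewrite inE uws orbT.
have h2 : \forall k \near \oo, nr (F (a k + b + v *+ t) - F (a k + b)) < e / 2.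
  have /mapP[j _ ->] : v \in vs by apply: wv; rewrite inE eqxx.
  elim: t (e / 2) e2 {h1} => [|t iht] f f0; first by near=> k; rewrite addr0 subrr nr0.
  have f2 : 0 < f / 2 by rewrite divr_gt0.
  apply: filterS2 (iht _ f2) (orbit_gradient_vanish j (b + (d *: E j) *+ t) f2) => k k1 k2.
  apply: le_lt_trans (nr_tri (F (a k + b + (d *: E j) *+ t)) _ _) _.
  rewrite [ltRHS](splitr f) addrC ltrD//.
  by move: k2; rewrite (mulrSr (d *: E j)) !addrA.
apply: filterS2 h1 h2 => k k1 k2.
apply: le_lt_trans (nr_tri (F (a k + b + v *+ t)) _ _) _.
by rewrite [ltRHS](splitr e) ltrD//; move: k1; rewrite !addrA.
Unshelve. all: by end_near. Qed.

Lemma box_average_vanish L (e : R) : (0 < L)%N -> 0 < e ->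
  \forall k \near \oo, nr (box_average vs L F (a k) - F (a k)) <= e.
Proof.
move=> L0 e0; pose r := box_points vs L.
have : \forall k \near \oo, forall i : 'I_(size r), nr (F (a k + 0 + tnth (in_tuple r) i) - F (a k + 0)) < e.
  apply: filter_forall => i; apply: (@orbit_shift_vanish vs L) => //.
  exact: mem_tnth.
apply: filterS => k hk.
have Q0 : 0 < (L ^ n)%:R :> R by rewrite ltr0n expn_gt0 L0.
have -> : box_average vs L F (a k) - F (a k) = ((L ^ n)%:R^-1 : R)%:C *: \sum_(x <- r) (F (a k + x) - F (a k)).
  rewrite /box_average size_vs sumrB scalerBr; congr (_ - _).
  by rewrite sumr_const_size size_box_points size_vs scale_invn_mulrn// expn_gt0 L0.
rewrite nrZR ger0_norm ?invr_ge0 ?(ltW Q0)// ler_pdivrMl//.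
rewrite (le_trans (nr_sum _ _ _))//.
rewrite -[X in (X ^ n)%:R * e]/(L) -[X in (L ^ X)%:R * e]size_vs -(size_box_points vs L) mulr_natl -sumr_const_size.
rewrite big_seq [leRHS]big_seq; apply: ler_sum => x /seq_tnthP[i ->].
by have := hk i; rewrite !addr0 => /ltW.
Qed.

(** A path of unit steps leads to [x], and [c] counts them. As [c] depends neither on [G] nor on
    [f], the estimate applies to box averages whose side grows while [x] is fixed. *)
Lemma lattice_path (x : 'rV[int]_n) : exists c : R, forall (G : 'rV[R]_n -> H) (f : R),
  (forall b j, nr (G (b + d *: E j) - G b) <= f) ->
  forall b, nr (G (b + lattice_point d x) - G b) <= c * f.
Proof.
pose P x := exists c : R, forall (G : 'rV[R]_n -> H) (f : R),
  (forall b j, nr (G (b + d *: E j) - G b) <= f) ->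
  forall b, nr (G (b + lattice_point d x) - G b) <= c * f.
have P0 : P 0.
  by exists 0 => G f _ b; rewrite lattice_point0 addr0 subrr nr0 mul0r.
have PN y : P y -> P (- y).
  move=> [c hc]; exists c => G f hG b; rewrite lattice_pointN nrBC.
  by have := hc G f hG (b - lattice_point d y); rewrite subrK.
have PD y z : P y -> P z -> P (y + z).
  move=> [c hc] [c' hc']; exists (c + c') => G f hG b.
  rewrite lattice_pointD addrA (le_trans (nr_tri (G (b + lattice_point d y)) _ _))//.
  by rewrite mulrDl [leRHS]addrC; apply: lerD; [exact: hc'|exact: hc].
have Pe j : P (delta_mx 0 j).
  by exists 1 => G f hG b; rewrite lattice_point_delta mul1r.
have Pn y k : P y -> P (y *+ k).
  by move=> Py; elim: k => [|k ih]; rewrite ?mulr0n// mulrS; exact: PD.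
rewrite -/(P x) [x]row_sum_delta; apply: (big_ind P) => // j _.
case: (x 0 j) => k; first by rewrite -[Posz k]natz scaler_nat; exact: Pn.
by rewrite NegzE scaleNr -natz scaler_nat; exact/PN/Pn.
Qed.

(** The order of the choices matters. The exponent [I] comes first, from the uniform tail estimate;
    then [N], beyond which averages of side [2 ^ I] are close to the orbit; and [J >= I] only after
    [k] and [l], so large that averages of side [2 ^ J] no longer see the distance between [a k] and
    [a l]. Five errors of [e / 6] add up. *)
Lemma lattice_orbit_cauchy (e : R) : 0 < e -> exists N, forall k l, (N <= k)%N -> (N <= l)%N ->
  nr (F (a k) - F (a l)) < e.
Proof.
move=> e0; have f0 : 0 < e / 6 by rewrite divr_gt0.
have e6 : e / 6 + e / 6 + (e / 6 + (e / 6 + e / 6)) < e by lra.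
have [I hI] := box_average_tail f0.
have I0 : (0 < 2 ^ I)%N by rewrite expn_gt0.
have [N _ hN] := box_average_vanish I0 f0.
exists N => k l /hN /= hk /hN /= hl.
have [c hc] := lattice_path (m k - m l).
have Mh : 0 <= M * nr h by rewrite mulr_ge0 ?nr_ge0.
pose B : R := `|c| * (2 * (M * nr h)).
have B0 : 0 <= B by rewrite mulr_ge0// mulr_ge0.
pose J := maxn I (Num.bound (B / (e / 6))).
have J2 : B / (2 ^ J)%:R <= e / 6.
  rewrite ler_pdivrMr ?ltr0n ?expn_gt0// mulrC -ler_pdivrMr//.
  have h1 : 0 <= B / (e / 6) by rewrite divr_ge0 ?(ltW f0).
  rewrite (le_trans (ltW (archi_boundP h1)))// ler_nat.
  by rewrite (leq_trans (leq_maxr I _))// -/J ltnW// ltn_expl.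
have J0 : (0 < 2 ^ J)%N by rewrite expn_gt0.
have h1 := hI J (a k) (leq_maxl _ _); have h2 := hI J (a l) (leq_maxl _ _).
have h3 : nr (box_average vs (2 ^ J) F (a k) - box_average vs (2 ^ J) F (a l)) <= e / 6.
  apply: le_trans J2.
  have := hc (box_average vs (2 ^ J) F) (2 * (M * nr h) / (2 ^ J)%:R).
  have e1 : a l + lattice_point d (m k - m l) = a k by rewrite lattice_pointB addrC subrK.
  move=> /(_ _ (a l)); rewrite e1 => h3; apply: le_trans (h3 _) _.
    move=> b j; apply: box_average_step => //; last exact: nr_orbit.
    by apply/mapP; exists j; rewrite ?mem_enum.
  rewrite mulrA ler_wpM2r ?invr_ge0// /B ler_wpM2r ?ler_norm// mulr_ge0//.
apply: le_lt_trans (nr_tri (box_average vs (2 ^ J) F (a k)) _ _) _.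
apply: (@le_lt_trans _ _ (e / 6 + e / 6 + (e / 6 + (e / 6 + e / 6)))); last exact: e6.
apply: lerD.
  rewrite (le_trans (nr_tri (box_average vs (2 ^ I) F (a k)) _ _))// addrC lerD//.
    by rewrite nrBC.
  by rewrite nrBC.
rewrite (le_trans (nr_tri (box_average vs (2 ^ J) F (a l)) _ _))// lerD//.
by rewrite (le_trans (nr_tri (box_average vs (2 ^ I) F (a l)) _ _))// lerD.
Qed.

End lattice.

(** Duhamel's formula is available for nonnegative times, so the steps go in positive directions;
    [lattice_floor] rounds down accordingly. *)
Lemma orbit_lipschitz_sum : exists2 B : R, 0 < B & forall a (r : 'I_n -> R) (d : R),
  (forall j, 0 <= r j <= d) -> nr (F (a + \sum_j r j *: E j) - F a) <= d * B.
Proof.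
have /choice[B hB] : forall j, exists B : R, 0 <= B /\
    forall a (t : R), 0 <= t -> nr (F (a + t *: E j) - F a) <= t * B.
  by move=> j; have [B B0 hB] := orbit_lipschitz j; exists B.
have SB : 0 <= \sum_j B j by apply: sumr_ge0 => j _; case: (hB j).
exists (\sum_j B j + 1) => [|a r d rd]; first by rewrite ltr_wpDl.
have d0 : 0 <= d.
  have n0 : (0 < n)%N by exact: leq_trans n3.
  by have /andP[/le_trans h1 /h1] := rd (Ordinal n0).
apply: (@le_trans _ _ (d * \sum_j B j)); last by rewrite ler_wpM2l// lerDl.
rewrite mulr_sumr.
elim/big_rec2 : _ a => [|j y x _ ih] a; first by rewrite addr0 subrr nr0.
rewrite addrA (le_trans (nr_tri (F (a + r j *: E j)) _ _))// [leRHS]addrC lerD//.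
have [Bj0 hj] := hB j; have /andP[rj0 rjd] := rd j.
by rewrite (le_trans (hj _ _ rj0))// ler_wpM2r.
Qed.

Definition lattice_floor (d : R) (v : 'rV[R]_n) : 'rV[int]_n := \row_j Num.floor (v 0 j / d).

Lemma lattice_floorP (d : R) v : 0 < d -> exists r : 'I_n -> R,
  (forall j, 0 <= r j <= d) /\ v = lattice_point d (lattice_floor d v) + \sum_j r j *: E j.
Proof.
move=> d0; exists (fun j => v 0 j - d * (Num.floor (v 0 j / d))%:~R); split=> [j|].
  have /andP[h1 h2] := floor_itv (v 0 j / d).
  rewrite ler_pdivlMr// mulrC in h1; rewrite ltr_pdivrMr// intrD mulrDl mul1r mulrC in h2.
  by rewrite subr_ge0 h1 lerBlDl /= ltW.
apply/rowP => j; rewrite !mxE summxE (bigD1 j)//= big1 ?addr0; last first.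
  by move=> i ij; rewrite !mxE eq_sym (negPf ij) andbF mulr0.
by rewrite !mxE !eqxx mulr1 addrC subrK.
Qed.

(** Every point of the cell with index [x] has norm at most [b x], so finitely many cells form a
    bounded set, which the sequence eventually leaves. *)
Lemma lattice_floor_leaves (d : R) (xi : nat -> 'rV[R]_n) : 0 < d ->
  (fun k => euclidean_norm (xi k)) @ \oo --> +oo ->
  forall L : seq 'rV[int]_n, \forall k \near \oo, lattice_floor d (xi k) \notin L.
Proof.
move=> d0 /cvgryPgt xi_oo L.
pose b (x : 'rV[int]_n) : R := Num.sqrt (\sum_j (d * (`|x 0 j|%:~R + 1)) ^+ 2).
have b0 x : 0 <= b x by exact: sqrtr_ge0.
have [N _ hN] := xi_oo (\sum_(x <- L) b x); exists N => // k /hN /=.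
apply: contraTN => kL; rewrite -leNgt.
apply: (@le_trans _ _ (b (lattice_floor d (xi k)))); last first.
  by rewrite (big_rem _ kL)/= lerDl sumr_ge0.
rewrite ler_sqrt; last by apply: sumr_ge0 => j _; rewrite sqr_ge0.
apply: ler_sum => j _; rewrite mxE.
set x := xi k 0 j; set z := Num.floor (x / d).
have /andP[h1 h2] := floor_itv (x / d).
rewrite -/z ler_pdivlMr// in h1; rewrite -/z ltr_pdivrMr// intrD in h2.
rewrite -[leLHS]real_normK ?num_real// ler_pXn2r ?nnegrE//; last first.
  by rewrite mulr_ge0 ?(ltW d0)// addr_ge0// ler0z.
rewrite intr_norm ler_norml; have := ler_norm (z%:~R : R); have := ler_norm (- (z%:~R : R)).
rewrite normrN => h3 h4; apply/andP; split.
  by rewrite -mulrN (le_trans _ h1)// mulrC ler_wpM2r ?(ltW d0)//; lra.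
by rewrite (le_trans (ltW h2))// mulrC ler_wpM2l ?(ltW d0)//; lra.
Qed.

(** The mesh is so fine that moving a point to the corner of its cell changes the orbit by at most
    [e / 3]; at the corners [lattice_orbit_cauchy] applies. *)
Lemma orbit_cauchy (xi : nat -> 'rV[R]_n) :
  (fun k => euclidean_norm (xi k)) @ \oo --> +oo ->
  forall e : R, 0 < e -> exists N, forall k l, (N <= k)%N -> (N <= l)%N ->
    nr (U (- xi k) (T (U (xi k) h)) - U (- xi l) (T (U (xi l) h))) < e.
Proof.
move=> xi_oo e e0; have [B B0 hB] := orbit_lipschitz_sum.
have e3 : 0 < e / 3 by rewrite divr_gt0.
have e33 : e / 3 + (e / 3 + e / 3) = e by lra.
have [N0 hN0] := @harmonic_lt R (e / 3 / B) (divr_gt0 e3 B0).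
pose d : R := N0.+1%:R^-1; have d0 : 0 < d by rewrite invr_gt0.
have dB : d * B <= e / 3 by rewrite -ler_pdivlMr// ltW// hN0.
have [N hN] := @lattice_orbit_cauchy N0 _ (lattice_floor_leaves d0 xi_oo) _ e3.
exists N => k l Nk Nl; rewrite -/(F (xi k)) -/(F (xi l)).
have near_lattice k' : nr (F (xi k') - F (lattice_point d (lattice_floor d (xi k')))) <= e / 3.
  have [r [hr {1}->]] := lattice_floorP (xi k') d0.
  exact: le_trans (hB _ _ _ hr) dB.
apply: le_lt_trans (nr_tri (F (lattice_point d (lattice_floor d (xi k)))) _ _) _.
rewrite -e33; apply: ler_ltD => //.
apply: le_lt_trans (nr_tri (F (lattice_point d (lattice_floor d (xi l)))) _ _) _.
by rewrite ltr_leD ?hN// nrBC.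
Qed.

End commutator_limit.

(** * Functional calculus of a projection-valued measure *)

Section raw_measure.
Import HBNNSimple.

(** An integral is built from the values of the set function on measurable sets alone. Integrals
    against [diag_measure] and [lebesgue_tuple], which are bare set functions, can thus be computed
    with genuine measures. *)
Lemma eq_raw_measure_integral d (T : measurableType d) (R : realType)
    (m1 m2 : set T -> \bar R) (f : T -> \bar R) :
  (forall A, measurable A -> m1 A = m2 A) ->
  (\int[m1]_x f x = \int[m2]_x f x)%E.
Proof.
move=> m12; rewrite /integral; congr (ereal_sup _ - ereal_sup _)%E;
  apply/seteqP; split=> _ [h hf <-]; exists h => //;
  by apply: eq_fsbigr => r _; rewrite m12.
Qed.

End raw_measure.

Section pvm.
Context {R : realType} {H : completeNormedModType R[i]}.
Variable dot : {dot H for Num.conj}.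
Hypothesis hdot : dot_induces_norm dot.
Context {d : measure_display} {T : measurableType d}.
Variable E : set T -> H -> H.
Hypothesis pE : projection_valued_measure dot E.
Implicit Types (A B : set T) (h : H) (f g : T -> R[i]).

Lemma pvm_lin A : measurable A -> linear (E A).
Proof. by move=> mA; have [h1 _ _ _] := pE; have [[]] := h1 A mA. Qed.

Lemma pvm_idem A h : measurable A -> E A (E A h) = E A h.
Proof. by move=> mA; have [h1 _ _ _] := pE; have [] := h1 A mA. Qed.

Lemma pvm_sym A h (k : H) : measurable A -> dot (E A h) k = dot h (E A k).
Proof. by move=> mA; have [h1 _ _ _] := pE; have [] := h1 A mA. Qed.

Lemma pvmT h : E setT h = h.
Proof. by have [_ h1 _ _] := pE. Qed.

Lemma pvmI A B h : measurable A -> measurable B -> E (A `&` B) h = E A (E B h).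
Proof. by move=> mA mB; have [_ _ h1 _] := pE; rewrite h1. Qed.

Lemma pvm_sigma (F : nat -> set T) h : (forall k, measurable (F k)) -> trivIset setT F ->
  series (fun k => E (F k) h) @ \oo --> E (\bigcup_k F k) h.
Proof. by have [_ _ _ h1] := pE; move=> mF tF; apply: h1. Qed.

Lemma pvm0 h : E set0 h = 0.
Proof.
have := @pvm_sigma (fun=> set0) h (fun=> measurable0) _.
move=> /(_ _)/cvgnrP; rewrite bigcup0// => h1.
apply: nr_eq0; apply/eqP; rewrite eq_le nr_ge0 andbT; apply: le_small => e e0.
have [|N hN] := h1 _ e e0; first exact: trivIset_set0.
(* At index [N.+2], subtracting the limit leaves [N.+1] equal terms, hence at least one. *)
have := hN N.+2 (leq_trans (leqnSn _) (leqnSn _)).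
rewrite /series /= sumr_const_nat subn0 mulrSr addrK; apply: le_lt_trans.
rewrite -[leLHS]mul1r -scaler_nat nrZ cmod_nat ler_wpM2r ?nr_ge0//.
by rewrite ler1n.
Qed.

Lemma pvmU A B h : measurable A -> measurable B -> A `&` B = set0 ->
  E (A `|` B) h = E A h + E B h.
Proof.
move=> mA mB AB.
have := @pvm_sigma (bigcup2 A B) h _ _; rewrite bigcup2E => h1.
apply: cvg_nr_unique (h1 _ _) _.
- by case=> [|[|k]] /=; [exact: mA|exact: mB|exact: measurable0].
- by rewrite -trivIset_bigcup2.
apply/cvgnrP => e e0; exists 2%N => k k2.
rewrite /series /= -(subnKC k2) big_nat_recl// big_nat_recl//= big1 ?addr0; last first.
  by move=> i _; exact: pvm0.
by rewrite subrr nr0.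
Qed.

Lemma pvm_disjoint A B h (k : H) : measurable A -> measurable B -> A `&` B = set0 ->
  dot (E A h) (E B k) = 0.
Proof. by move=> mA mB AB; rewrite pvm_sym// -pvmI// AB pvm0 dot0r. Qed.

Lemma pvm_sqr A h : measurable A -> dot (E A h) h = (nr (E A h) ^+ 2)%:C.
Proof. by move=> mA; rewrite -(dotxx hdot) !pvm_sym// pvm_idem. Qed.

Lemma nr_pvm_split A h : measurable A ->
  nr h ^+ 2 = nr (E A h) ^+ 2 + nr (E (~` A) h) ^+ 2.
Proof.
move=> mA; have mAC := measurableC mA.
rewrite -(pythagoras hdot); last by apply: pvm_disjoint; rewrite ?setICr.
by rewrite -pvmU ?setICr// setUv pvmT.
Qed.

Lemma nr_pvm A h : measurable A -> nr (E A h) <= nr h.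
Proof.
move=> mA; rewrite -(@ler_pXn2r _ 2) ?nnegrE ?nr_ge0//.
by rewrite (nr_pvm_split h mA) lerDl sqr_ge0.
Qed.

Lemma pvmC A h : measurable A -> E (~` A) h = h - E A h.
Proof.
move=> mA; have mAC := measurableC mA.
by rewrite -{2}[h]pvmT -(setUv A) pvmU ?setICr// addrC addKr.
Qed.

Definition finite_partition (I : finType) (A : I -> set T) :=
  [/\ forall i, measurable (A i), forall i j, i != j -> A i `&` A j = set0 &
      forall x, exists i, A i x].

Lemma pvm_bigcup (I : eqType) (r : seq I) (A : I -> set T) h : uniq r ->
  (forall i, measurable (A i)) -> (forall i j, i != j -> A i `&` A j = set0) ->
  E (\big[setU/set0]_(i <- r) A i) h = \sum_(i <- r) E (A i) h.
Proof.
move=> + mA dA; elim: r => [|i r ih] /=; first by rewrite !big_nil pvm0.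
case/andP => ir ur; rewrite !big_cons pvmU ?ih//.
  by apply: bigsetU_measurable.
rewrite big_distrr /= big_seq big1// => j jr; apply: dA.
by apply: contraNneq ir => ->.
Qed.

Lemma pvm_partition (I : finType) (A : I -> set T) h : finite_partition A ->
  h = \sum_i E (A i) h.
Proof.
move=> [mA dA cA]; rewrite -pvm_bigcup ?index_enum_uniq// -[LHS]pvmT; congr (E _ h).
apply/seteqP; split=> // x _; have [i Ai] := cA x.
by rewrite -bigcup_seq; exists i => //=; rewrite mem_index_enum.
Qed.

Lemma nr_partition (I : finType) (A : I -> set T) h : finite_partition A ->
  nr h ^+ 2 = \sum_i nr (E (A i) h) ^+ 2.
Proof.
move=> pA; have [mA dA cA] := pA.
rewrite {1}(pvm_partition h pA) (pythagoras_sum hdot) ?index_enum_uniq//.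
by move=> i j ij; apply: pvm_disjoint => //; exact: dA.
Qed.

Lemma partitionI (I J : finType) (A : I -> set T) (B : J -> set T) :
  finite_partition A -> finite_partition B ->
  finite_partition (fun p : I * J => A p.1 `&` B p.2).
Proof.
move=> [mA dA cA] [mB dB cB]; split=> [p|[i j] [i' j'] /=|x]; first exact: measurableI.
  rewrite xpair_eqE negb_and => /orP[/dA|/dB] AB.
    by rewrite setIACA AB set0I.
  by rewrite setIACA AB setI0.
by have [i Ai] := cA x; have [j Bj] := cB x; exists (i, j).
Qed.

Definition commutes_pvm (U : H -> H) := forall A h, measurable A -> U (E A h) = E A (U h).

(* [U] is the integral of [f] with respect to [E]: up to an error [e], it acts as the
   scalar [f x] on the range of [E (A i)] whenever [A i x]. *)
Definition calculus f (U : H -> H) :=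
  [/\ linear U, commutes_pvm U & forall e : R, 0 < e ->
    exists (I : finType) (A : I -> set T), finite_partition A /\
      forall i x h, A i x -> nr (U (E (A i) h) - f x *: E (A i) h) <= e * nr (E (A i) h)].

(** The pieces [E (A i) h] are orthogonal and [U] preserves them, so a norm bound may be checked
    piece by piece. Only nonempty [A i] are tested because [calculus] compares [U] with a value of
    [f] at a point of [A i]. *)
Lemma local_bound (I : finType) (A : I -> set T) (U : H -> H) (C : R) h :
  linear U -> commutes_pvm U -> finite_partition A -> 0 <= C ->
  (forall i, A i !=set0 -> nr (U (E (A i) h)) <= C * nr (E (A i) h)) ->
  nr (U h) <= C * nr h.
Proof.
move=> lU cU pA C0 hC; have [mA _ _] := pA.
rewrite -(@ler_pXn2r _ 2) ?nnegrE ?nr_ge0 ?mulr_ge0 ?nr_ge0// exprMn.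
rewrite (nr_partition _ pA) (nr_partition h pA) mulr_sumr; apply: ler_sum => i _.
rewrite -cU// -exprMn ler_pXn2r ?nnegrE ?nr_ge0 ?mulr_ge0 ?nr_ge0//.
have [->|/set0P Ai] := eqVneq (A i) set0; last exact: hC.
by rewrite pvm0 (lin0 lU) nr0 mulr0.
Qed.

Lemma calculus_bound f U (C : R) h : calculus f U -> 0 <= C ->
  (forall x, cmod (f x) <= C) -> nr (U h) <= C * nr h.
Proof.
move=> [lU cU hU] C0 fC.
suff key (e : R) : 0 < e -> nr (U h) <= (C + e) * nr h.
  have [/nr_eq0 ->|h0] := eqVneq (nr h) 0; first by rewrite (lin0 lU) !nr0 mulr0.
  have nh : 0 < nr h by rewrite lt0r h0 nr_ge0.
  rewrite -ler_pdivrMr//; apply/ler_addgt0Pr => e e0.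
  by rewrite ler_pdivrMr// key.
move=> e0; have [I [A [pA hA]]] := hU e e0.
apply: (local_bound lU cU pA) => [|i [x Aix]]; first by rewrite addr_ge0// ltW.
rewrite -[U _](subrK (f x *: E (A i) h)) (le_trans (nrD _ _))// addrC mulrDl lerD//.
  by rewrite nrZ ler_wpM2r ?nr_ge0.
exact: hA.
Qed.

Lemma calculusD f g U V : calculus f U -> calculus g V ->
  calculus (fun x => f x + g x) (fun h => U h + V h).
Proof.
move=> [lU cU hU] [lV cV hV]; split=> [a x y|A h mA|e e0].
- by rewrite lU lV scalerDr addrACA.
- by rewrite cU// cV// (linD (pvm_lin mA)).
have e2 : 0 < e / 2 by rewrite divr_gt0.
have [I [A [pA hA]]] := hU _ e2; have [J [B [pB hB]]] := hV _ e2.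
have [mA _ _] := pA; have [mB _ _] := pB.
exists (I * J)%type, (fun p => A p.1 `&` B p.2); split; first exact: partitionI.
move=> [i j] x h /= [Ax Bx]; rewrite scalerDl opprD addrACA (le_trans (nrD _ _))//.
rewrite [e in leRHS](splitr e) mulrDl; apply: lerD; first by rewrite pvmI//; exact: hA.
by rewrite setIC pvmI//; exact: hB.
Qed.

Lemma calculusZ (a : R[i]) f U : calculus f U ->
  calculus (fun x => a * f x) (fun h => a *: U h).
Proof.
move=> [lU cU hU]; split=> [b x y|A h mA|e e0].
- by rewrite lU scalerDr !scalerA mulrC.
- by rewrite cU// (linZ (pvm_lin mA)).
have a1 : 0 < cmod a + 1 by rewrite ltr_wpDl ?cmod_ge0.
have [I [A [pA hA]]] := hU _ (divr_gt0 e0 a1).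
exists I, A; split=> // i x h Ax.
rewrite -scalerA -scalerBr nrZ.
apply: (@le_trans _ _ (cmod a * (e / (cmod a + 1) * nr (E (A i) h)))).
  by rewrite ler_wpM2l ?cmod_ge0//; exact: hA.
rewrite mulrA ler_wpM2r ?nr_ge0// mulrCA ler_piMr ?(ltW e0)//.
by rewrite ler_pdivrMr// mul1r lerDl.
Qed.

Lemma calculusB f g U V : calculus f U -> calculus g V ->
  calculus (fun x => f x - g x) (fun h => U h - V h).
Proof.
move=> cf cg.
have -> : (fun x => f x - g x) = (fun x => f x + (-1) * g x) by apply/funext => x; rewrite mulN1r.
have -> : (fun h => U h - V h) = (fun h => U h + (-1) *: V h) by apply/funext => x; rewrite scaleN1r.
exact/calculusD/calculusZ.
Qed.

(** This turns identities between functions into identities between operators: the group law of the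
    exponentials and the compatibility of the truncations of [X] are obtained in this way. *)
Lemma calculus_unique f U V : calculus f U -> calculus f V -> U = V.
Proof.
move=> cU cV; apply/funext => h; apply/eqP; rewrite -subr_eq0; apply/eqP/nr_eq0/eqP.
rewrite eq_le nr_ge0 andbT.
have := calculus_bound h (calculusB cU cV) (lexx 0).
by rewrite mul0r; apply => x; rewrite subrr cmod0.
Qed.

Lemma calculus_indic A : measurable A -> calculus (fun x => (\1_A x)%:C) (E A).
Proof.
move=> mA; split=> [|B h mB|e e0]; first exact: pvm_lin.
  by rewrite -!pvmI// setIC.
exists bool, (fun b => if b then A else ~` A); split.
  split=> [[]|[] []//=|x]; [exact: mA|exact: measurableC|by rewrite setICr|by rewrite setICl|].
  by have [Ax|nAx] := pselect (A x); [exists true|exists false].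
move=> i x h; case: i => /= Ax.
  by rewrite pvm_idem// indicE mem_set// scale1r subrr nr0 mulr_ge0 ?nr_ge0 ?ltW.
rewrite -pvmI//; last exact: measurableC.
by rewrite setICr pvm0 indicE memNset// scale0r subrr nr0 mulr_ge0 ?nr_ge0 ?ltW.
Qed.

Lemma calculus_cst (a : R[i]) : calculus (fun=> a) (fun h => a *: h).
Proof.
have := calculusZ a (calculus_indic measurableT).
have -> : (fun x : T => a * (\1_[set: T] x)%:C) = (fun=> a :> R[i]).
  by apply/funext => x; rewrite indicT /= mulr1.
by have -> : (fun h => a *: E setT h) = (fun h => a *: h) by apply/funext => h; rewrite pvmT.
Qed.

Lemma calculusM f g U V (C C' : R) : calculus f U -> calculus g V ->
  (forall x, cmod (f x) <= C) -> (forall x, cmod (g x) <= C') ->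
  calculus (fun x => f x * g x) (fun h => U (V h)).
Proof.
move=> cfU cgV fC gC; have [lU cU hU] := cfU; have [lV cV hV] := cgV.
split=> [a x y|A h mA|e e0]; first by rewrite lV lU.
  by rewrite cV// cU.
pose c := `|C| + `|C'| + 1.
have c0 : 0 < c by rewrite ltr_wpDl// addr_ge0.
have ec0 := divr_gt0 e0 c0.
have [I [A [pA hA]]] := hU _ ec0; have [J [B [pB hB]]] := hV _ ec0.
have [mA _ _] := pA; have [mB _ _] := pB.
exists (I * J)%type, (fun p => A p.1 `&` B p.2); split; first exact: partitionI.
move=> [i j] x h /= [Ax Bx]; set y := E _ h.
have yA : E (A i) y = y by rewrite /y pvmI// pvm_idem.
have yB : E (B j) y = y by rewrite /y setIC pvmI// pvm_idem.
have UC k : nr (U k) <= `|C| * nr k.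
  apply: calculus_bound cfU _ _ => // z; exact: le_trans (fC z) (ler_norm _).
have h1 : nr (V y - g x *: y) <= e / c * nr y by rewrite -yB; exact: hB.
have h2 : nr (U y - f x *: y) <= e / c * nr y by rewrite -yA; exact: hA.
have -> : U (V y) - (f x * g x) *: y = U (V y - g x *: y) + g x *: (U y - f x *: y).
  by rewrite (linB lU) (linZ lU) scalerBr subrKA scalerA mulrC.
rewrite (le_trans (nrD _ _))//.
apply: (@le_trans _ _ ((`|C| + `|C'|) * (e / c * nr y))).
  rewrite mulrDl lerD//; first by rewrite (le_trans (UC _))// ler_wpM2l.
  rewrite nrZ; apply: ler_pM => //; [exact: cmod_ge0|exact: nr_ge0|].
  exact: le_trans (gC x) (ler_norm _).
rewrite mulrA ler_wpM2r ?nr_ge0// mulrCA ler_piMr ?(ltW e0)//.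
by rewrite ler_pdivrMr// mul1r lerDl.
Qed.

Lemma calculus_limit f (fk : nat -> T -> R[i]) (Uk : nat -> H -> H) :
  (forall k, calculus (fk k) (Uk k)) ->
  (forall k x, cmod (f x - fk k x) <= k.+1%:R^-1) ->
  exists U, calculus f U /\ forall k h, nr (U h - Uk k h) <= k.+1%:R^-1 * nr h.
Proof.
move=> ck fkf.
have e0 k : 0 <= k.+1%:R^-1 :> R by rewrite invr_ge0.
have close k l h : nr (Uk k h - Uk l h) <= (k.+1%:R^-1 + l.+1%:R^-1) * nr h.
  apply: calculus_bound (calculusB (ck k) (ck l)) _ _; first by rewrite addr_ge0.
  move=> x; have -> : fk k x - fk l x = (f x - fk l x) - (f x - fk k x) by ring.
  by rewrite (le_trans (cmodD _ _))// cmodN addrC lerD.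
have small h (e : R) : 0 < e -> exists N, forall k, (N <= k)%N -> k.+1%:R^-1 * nr h < e.
  move=> e1; have h1 : 0 < nr h + 1 by rewrite ltr_wpDl ?nr_ge0.
  have [N hN] := harmonic_lt (divr_gt0 e1 h1); exists N => k /hN.
  rewrite ltr_pdivlMr//; apply: le_lt_trans; rewrite ler_wpM2l// lerDl//.
have /choice[U hU] h : exists u : H, Uk ^~ h @ \oo --> u.
  apply: nr_complete => e e1; have [N hN] := small h _ (divr_gt0 e1 (ltr0n _ 2)).
  exists N => k l /hN hk /hN hl; rewrite (le_lt_trans (close _ _ _))// mulrDl.
  by rewrite [ltRHS](splitr e) ltrD.
have UUk k h : nr (U h - Uk k h) <= k.+1%:R^-1 * nr h.
  suff key (e : R) : 0 < e -> nr (U h - Uk k h) <= k.+1%:R^-1 * nr h + e.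
    by apply/ler_addgt0Pr.
  move=> e1; have e2 := divr_gt0 e1 (ltr0n _ 2).
  have [N1 hN1] := small h _ e2.
  have /cvgnrP/(_ _ e2)[N2 hN2] := hU h.
  have h1 := hN1 _ (leq_maxl N1 N2); have h2 := hN2 _ (leq_maxr N1 N2).
  have h3 := close (maxn N1 N2) k h; rewrite mulrDl in h3.
  rewrite (le_trans (nr_tri (Uk (maxn N1 N2) h) _ _))// [X in X + _]nrBC.
  apply: (le_trans (lerD (ltW h2) h3)); rewrite addrA addrC lerD2l [leRHS](splitr e).
  by rewrite lerD2l ltW.
exists U; split=> //; split=> [a x y|A h mA|e e1].
- apply: cvg_nr_unique (hU _) _; apply/cvgnrP => e e1.
  pose M := cmod a * nr x + nr y + 1.
  have M0 : 0 < M by rewrite ltr_wpDl// addr_ge0 ?mulr_ge0 ?cmod_ge0 ?nr_ge0.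
  have [N hN] := harmonic_lt (divr_gt0 e1 M0); exists N => k /hN.
  have [lk _ _] := ck k; rewrite lk ltr_pdivlMr//; apply: le_lt_trans.
  rewrite opprD addrACA -scalerBr (le_trans (nrD _ _))// nrZ !mulrDr mulr1.
  rewrite -[leLHS]addr0; apply: lerD => //; apply: lerD; last by rewrite nrBC.
  by rewrite mulrCA ler_wpM2l ?cmod_ge0// nrBC.
- apply: cvg_nr_unique (hU _) _; apply/cvgnrP => e e2.
  have [N hN] := small h e e2; exists N => k /hN; apply: le_lt_trans.
  have [_ ckk _] := ck k; rewrite ckk// -(linB (pvm_lin mA)) (le_trans (nr_pvm _ mA))//.
  by rewrite nrBC.
have e3 := divr_gt0 e1 (ltr0n R 3).
have e33 : e / 3 + e / 3 + e / 3 = e by field.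
have [k /(_ _ (leqnn k))/ltW hk] := harmonic_lt e3.
have [_ _ /(_ _ e3)[I [A [pA hA]]]] := ck k.
exists I, A; split=> // i x h Ax; set y := E _ h.
have -> : U y - f x *: y = (U y - Uk k y) + (Uk k y - fk k x *: y) - ((f x - fk k x) *: y).
  by rewrite subrKA scalerBl opprB subrKA.
rewrite (le_trans (nrB _ _))//.
have h1 := UUk k y; have h2 : nr (Uk k y - fk k x *: y) <= e / 3 * nr y by exact: hA.
have h3 : nr ((f x - fk k x) *: y) <= e / 3 * nr y.
  by rewrite nrZ ler_wpM2r ?nr_ge0// (le_trans (fkf k x)).
have h4 : nr (U y - Uk k y + (Uk k y - fk k x *: y)) <= e / 3 * nr y + e / 3 * nr y.
  by rewrite (le_trans (nrD _ _))// lerD// (le_trans h1)// ler_wpM2r ?nr_ge0.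
by rewrite -[e in leRHS]e33 2!mulrDl lerD.
Qed.

End pvm.

Section polarization.
Context {R : realType} {H : completeNormedModType R[i]}.
Variable dot : {dot H for Num.conj}.
Hypothesis hdot : dot_induces_norm dot.

(** Applying the hypothesis to [a *: x + y] with [a = 1] and [a = i] separates the two cross terms.
    The restriction to a subspace [M] accommodates unbounded operators, which are linear on their
    domains only. *)
Lemma polarization_in (M : set H) (U V : H -> H) :
  (forall (a : R[i]) x y, M x -> M y -> M (a *: x + y)) ->
  (forall (a : R[i]) x y, M x -> M y -> U (a *: x + y) = a *: U x + U y) ->
  (forall (a : R[i]) x y, M x -> M y -> V (a *: x + y) = a *: V x + V y) ->
  (forall x, M x -> dot (U x) x = dot (V x) x) ->
  forall x y, M x -> M y -> dot (U x) y = dot (V x) y.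
Proof.
move=> sM lU lV UV x y Mx My.
have key (a : R[i]) : a * (dot (U x) y - dot (V x) y) + a^* * (dot (U y) x - dot (V y) x) = 0.
  have := UV _ (sM a _ _ Mx My); rewrite lU// lV//.
  rewrite !(dotDl, dotDr, dotZl, dotZr) UV// (UV y)// => /eqP.
  rewrite -subr_eq0 => /eqP <-; ring.
have k1 := key 1; have ki := key (@Num.imaginary _).
rewrite rmorph1 !mul1r in k1.
rewrite conjCi mulNr -mulrBr in ki.
move/eqP: ki; rewrite mulf_eq0 (negPf (neq0Ci _)) /= => /eqP ki.
apply/eqP; rewrite -subr_eq0; apply/eqP.
have := congr2 +%R k1 ki; rewrite addr0 addrACA subrr addr0 -mulr2n => /eqP.
by rewrite mulrn_eq0 /= => /eqP.
Qed.

Lemma polarization (U V : H -> H) : linear U -> linear V ->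
  (forall h, dot (U h) h = dot (V h) h) -> U = V.
Proof.
move=> lU lV UV; apply/funext => h; apply: (dot_ext hdot) => k.
by apply: (@polarization_in setT U V) => // *; [exact: lU|exact: lV].
Qed.

End polarization.

Lemma measurable_superlevel d (T : measurableType d) (R : realType) (f : T -> R) (c : R) :
  measurable_fun setT f -> measurable [set x | c <= f x].
Proof.
move=> mf; have := mf measurableT `[c, +oo[%classic (measurable_itv _).
rewrite setTI; congr measurable; apply/seteqP.
by split=> x /=; rewrite in_itv/= andbT.
Qed.

Lemma integrable_bounded d (T : measurableType d) (R : realType)
    (mu : {measure set T -> \bar R}) (D : set T) (f : T -> R) (C : R) :
  measurable D -> (mu D < +oo)%E -> measurable_fun setT f -> (forall x, `|f x| <= C) ->
  mu.-integrable D (EFin \o f).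
Proof.
move=> mD muD mf fC; apply: measurable_bounded_integrable => //; first exact: measurable_funTS.
exists C; split; first exact: num_real.
by move=> y Cy x _; exact: le_trans (fC x) (ltW Cy).
Qed.

(** * Integrals of bounded real functions and their quadratic forms *)

Section pvm_integral.
Context {R : realType} {H : completeNormedModType R[i]}.
Variable dot : {dot H for Num.conj}.
Hypothesis hdot : dot_induces_norm dot.
Context {d : measure_display} {T : measurableType d}.
Variable E : set T -> H -> H.
Hypothesis pE : projection_valued_measure dot E.
Implicit Types (A B : set T) (h : H) (f g : T -> R).

(* [diag_measure] itself is not a measure: it may be negative off the measurable sets. *)
Lemma pvm_measure_exists h : exists mu : {measure set T -> \bar R},
  forall A, measurable A -> mu A = (nr (E A h) ^+ 2)%:E.
Proof.
pose m (A : set T) : \bar R :=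
  if pselect (measurable A) then (nr (E A h) ^+ 2)%:E else 0%E.
have mE A : measurable A -> m A = (nr (E A h) ^+ 2)%:E.
  by move=> mA; rewrite /m; case: pselect.
have m0 : m set0 = 0%E by rewrite mE// (pvm0 pE) nr0 expr0n.
have m_ge0 A : (0 <= m A)%E.
  by rewrite /m; case: pselect => // mA; rewrite lee_fin sqr_ge0.
have m_sigma : semi_sigma_additive m.
  move=> F mF tF mUF; rewrite mE//.
  have -> : (fun k => \sum_(0 <= i < k) m (F i))%E =
            EFin \o (fun k => nr (series (fun i => E (F i) h) k) ^+ 2).
    apply/funext => k /=; rewrite /series /= !big_mkord (pythagoras_sum hdot) ?index_enum_uniq//.
      by rewrite -sumEFin; apply: eq_bigr => i _; rewrite mE.
    move=> i j ij; apply: (pvm_disjoint pE) => //.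
    by move/trivIsetP : tF; apply.
  apply/fine_cvgP; split; first exact: nearW.
  have := pvm_sigma pE mF tF (h:=h) => /cvgnrP cF.
  have cn : (fun k => nr (series (fun i => E (F i) h) k)) @ \oo --> nr (E (\bigcup_k F k) h).
    apply/cvgrPdist_lt => e e0; have [N hN] := cF _ e0.
    exists N => // k /= Nk; rewrite (le_lt_trans _ (hN _ Nk))// nrBC.
    exact: nr_dist.
  by apply: cvgM.
pose mm : {measure set T -> \bar R} := HB.pack m (isMeasure.Build d T R m m0 m_ge0 m_sigma).
by exists mm.
Qed.

Definition pvm_measure h : {measure set T -> \bar R} := sval (cid (pvm_measure_exists h)).

Lemma pvm_measureE h A : measurable A -> pvm_measure h A = (nr (E A h) ^+ 2)%:E.
Proof. by move=> mA; rewrite (svalP (cid (pvm_measure_exists h))). Qed.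

Lemma diag_measureE h A : measurable A -> diag_measure dot E h A = (nr (E A h) ^+ 2)%:E.
Proof. by move=> mA; rewrite /diag_measure (pvm_sqr hdot pE). Qed.

Lemma integral_diag_measure h (F : T -> \bar R) :
  (\int[diag_measure dot E h]_x F x = \int[pvm_measure h]_x F x)%E.
Proof.
by apply: eq_raw_measure_integral => A mA; rewrite diag_measureE// pvm_measureE.
Qed.

Lemma pvm_measureT h : pvm_measure h setT = (nr h ^+ 2)%:E.
Proof. by rewrite pvm_measureE// (pvmT pE). Qed.

Lemma pvm_integrable h f (C : R) : measurable_fun setT f -> (forall x, `|f x| <= C) ->
  (pvm_measure h).-integrable setT (EFin \o f).
Proof.
by move=> mf fC; apply: (integrable_bounded (C := C)) => //; rewrite pvm_measureT ltry.
Qed.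

(** Couples the local description of the integral with its quadratic form: the first gives the
    algebra, the second is how [spectral_integral] and [spectral_measure] are specified. *)
Definition real_calculus f (U : H -> H) :=
  [/\ calculus E (fun x => (f x)%:C) U, measurable_fun setT f,
      exists C : R, forall x, `|f x| <= C &
      forall h, dot (U h) h = (\int[pvm_measure h]_x f x)%:C].

Lemma real_calculus_indic A : measurable A -> real_calculus \1_A (E A).
Proof.
move=> mA; split; first exact: (calculus_indic pE).
- exact: measurable_indic.
- by exists (1 : R) => x; rewrite indicE; case: (_ \in _); rewrite ?normr1 ?normr0.
- by move=> h; rewrite (pvm_sqr hdot pE)// /Rintegral integral_indic// setIT pvm_measureE.
Qed.

Lemma real_calculusD f g U V : real_calculus f U -> real_calculus g V ->
  real_calculus (fun x => f x + g x) (fun h => U h + V h).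
Proof.
move=> [cf mf [C fC] hf] [cg mg [D gD] hg]; split.
- have -> : (fun x => (f x + g x)%:C) = (fun x => (f x)%:C + (g x)%:C).
    by apply/funext => x; rewrite rmorphD.
  exact: (calculusD pE).
- exact: measurable_funD.
- by exists (C + D) => x; rewrite (le_trans (ler_normD _ _))// lerD.
- move=> h; rewrite dotDl hf hg RintegralD//; last 2 first.
  + exact: pvm_integrable mf fC.
  + exact: pvm_integrable mg gD.
  by rewrite -rmorphD.
Qed.

Lemma real_calculusZ (a : R) f U : real_calculus f U ->
  real_calculus (fun x => a * f x) (fun h => a%:C *: U h).
Proof.
move=> [cf mf [C fC] hf]; split.
- have -> : (fun x => (a * f x)%:C) = (fun x => a%:C * (f x)%:C).
    by apply/funext => x; rewrite rmorphM.
  exact: (calculusZ pE).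
- exact: measurable_funM.
- by exists (`|a| * C) => x; rewrite normrM ler_wpM2l.
- move=> h; rewrite dotZl hf RintegralZl//; last exact: pvm_integrable mf fC.
  by rewrite -rmorphM.
Qed.

Lemma real_calculus_sum N (f : nat -> T -> R) (U : nat -> H -> H) :
  (forall i, real_calculus (f i) (U i)) ->
  real_calculus (fun x => \sum_(i < N) f i x) (fun h => \sum_(i < N) U i h).
Proof.
move=> hf; elim: N => [|N ih].
  have -> : (fun x : T => \sum_(i < 0) f i x) = (fun x => 0 * f 0%N x).
    by apply/funext => x; rewrite big_ord0 mul0r.
  have -> : (fun h => \sum_(i < 0) U i h) = (fun h => 0%:C *: U 0%N h).
    by apply/funext => h; rewrite big_ord0 scale0r.
  exact: real_calculusZ.
have -> : (fun x => \sum_(i < N.+1) f i x) = (fun x => \sum_(i < N) f i x + f N x).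
  by apply/funext => x; rewrite big_ord_recr.
have -> : (fun h => \sum_(i < N.+1) U i h) = (fun h => \sum_(i < N) U i h + U N h).
  by apply/funext => h; rewrite big_ord_recr.
exact: real_calculusD.
Qed.

(** The sum counts the integers from 1 to [N] that are at most [z], so it is the integer part of
    [z]. *)
Lemma staircase (N : nat) (z : R) : 0 <= z -> z <= N%:R ->
  `|z - \sum_(i < N) (if i.+1%:R <= z then 1 else 0)| <= 1.
Proof.
move=> z0 zN; set S := \sum_(i < N) _.
have [u1 u2] : S <= z /\ S <= N%:R.
  rewrite /S; clear zN S; elim: N => [|N [i1 i2]]; first by rewrite big_ord0.
  rewrite big_ord_recr /= -natr1; case: ifPn => h; last by split; lra.
  by split; rewrite -?natr1 in h *; lra.
have : Num.min (z - 1) N%:R <= S.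
  rewrite /S; clear zN u1 u2 S; elim: N => [|N ih].
    by rewrite big_ord0 ge_min lexx orbT.
  rewrite big_ord_recr /= -natr1; move: ih; rewrite !ge_min.
  case: ifPn; rewrite -?ltNge => h /orP[]ih; apply/orP.
  - by right; lra.
  - by right; lra.
  - by left; lra.
  - by left; lra.
rewrite ge_min => /orP[]h; rewrite ler_norml; apply/andP; split; lra.
Qed.

(** Rounding [(f + C) * k.+1%:R] down to an integer approximates [f] within [k.+1%:R^-1], and the
    rounded function is a sum of indicators of superlevel sets. [N k] levels suffice because [f + C]
    is at most [2 * C]. *)
Lemma real_calculus_exists f (C : R) : measurable_fun setT f -> (forall x, `|f x| <= C) ->
  exists U, real_calculus f U.
Proof.
move=> mf fC.
have fC' x : - C <= f x <= C by rewrite -ler_norml.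
pose N k := (Num.truncn (2 * C * k.+1%:R)).+1.
pose A k i := [set x | i.+1%:R <= (f x + C) * k.+1%:R].
have mA k i : measurable (A k i).
  apply: measurable_superlevel.
  by apply: measurable_funM => //; exact: measurable_funD.
pose fk k x : R := \sum_(i < N k) \1_(A k i) x.
pose fk' k x : R := k.+1%:R^-1 * fk k x + (- C) * \1_[set: T] x.
have ck k : exists U, real_calculus (fk' k) U.
  eexists; apply: real_calculusD; apply: real_calculusZ.
    exact: (@real_calculus_sum (N k) (fun i => \1_(A k i)) _ (fun i => real_calculus_indic (mA k i))).
  exact: real_calculus_indic.
have {ck}/choice[Uk ck] : forall k, exists U, real_calculus (fk' k) U by [].
have fkf k x : `|f x - fk' k x| <= k.+1%:R^-1.
  have k0 : 0 < k.+1%:R :> R by [].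
  have -> : f x - fk' k x = k.+1%:R^-1 * ((f x + C) * k.+1%:R - fk k x).
    rewrite /fk' indicT mulr1; field; lra.
  rewrite normrM ger0_norm ?invr_ge0 ?ler0n//.
  rewrite -[leRHS]mulr1 ler_wpM2l ?invr_ge0 ?ler0n//.
  have -> : fk k x = \sum_(i < N k) (if i.+1%:R <= (f x + C) * k.+1%:R then 1 else 0).
    apply: eq_bigr => i _; rewrite indicE; case: ifPn => h; first by rewrite mem_set.
    by rewrite memNset//; exact/negP.
  have /andP[f1 f2] := fC' x.
  apply: staircase; first by rewrite mulr_ge0//; lra.
  apply: (@le_trans _ _ (2 * C * k.+1%:R)); first by rewrite ler_wpM2r//; lra.
  by apply: ltW; exact: truncnS_gt.
have [|k x|U [cU UU]] := @calculus_limit _ _ _ hdot _ _ _ pE (fun x => (f x)%:C)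
    (fun k x => (fk' k x)%:C) Uk; first by move=> k; have [] := ck k.
  by rewrite -rmorphB cmod_real.
exists U; split => //; first by exists C.
move=> h; apply/eqP; rewrite -subr_eq0; apply/eqP/cmod_eq0/eqP.
rewrite eq_le cmod_ge0 andbT; apply: le_small => e e0.
have M0 : 0 < 2 * nr h ^+ 2 + 1 by rewrite ltr_wpDl// mulr_ge0// sqr_ge0.
have [k /(_ _ (leqnn k)) hk] := harmonic_lt (divr_gt0 e0 M0).
rewrite ltr_pdivlMr// in hk.
have [_ mk [D fD] hk'] := ck k.
have if_ := pvm_integrable h mf fC; have ifk := pvm_integrable h mk fD.
have -> : dot (U h) h - (\int[pvm_measure h]_x f x)%:C =
  dot (U h - Uk k h) h - (\int[pvm_measure h]_x (f x - fk' k x))%:C.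
  rewrite dotBl RintegralB// hk' rmorphB /=; ring.
rewrite (le_lt_trans (cmodD _ _))// (le_lt_trans _ hk)// cmodN.
apply: (@le_trans _ _ (k.+1%:R^-1 * (2 * nr h ^+ 2))); last first.
  by rewrite ler_wpM2l ?invr_ge0// lerDl.
rewrite mulrCA mulr2n mulrDl mul1r lerD//.
  rewrite (le_trans (cauchy_schwarz hdot _ _))// expr2 mulrA ler_wpM2r ?nr_ge0//.
have mB : measurable_fun setT (fun x => f x - fk' k x) by exact: measurable_funB.
have kB x : `|f x - fk' k x| <= k.+1%:R^-1 by exact: fkf.
rewrite cmod_real (le_trans (le_normr_Rintegral _ (pvm_integrable h mB kB)))//.
apply: (@le_trans _ _ (\int[pvm_measure h]_x (cst k.+1%:R^-1 x))).
  apply: le_Rintegral => //.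
    apply: (pvm_integrable h (measurableT_comp _ mB)) => //= x; rewrite normr_id; exact: kB.
  by apply: (@pvm_integrable _ _ k.+1%:R^-1) => //= x; rewrite ger0_norm ?invr_ge0.
by rewrite Rintegral_cst// pvm_measureT.
Qed.

End pvm_integral.

Section spectral_integral.
Context {R : realType} {H : completeNormedModType R[i]}.
Variable dot : {dot H for Num.conj}.
Hypothesis hdot : dot_induces_norm dot.
Context {d : measure_display} {T : measurableType d}.
Variable E : set T -> H -> H.
Hypothesis pE : projection_valued_measure dot E.
Local Notation mu := (pvm_measure hdot pE).

(** [spectral_integral] is chosen by [get] from its quadratic form. The combination [U] of the
    integrals of the real and imaginary parts has this form, and by polarization there is no other
    choice. *)
Lemma spectral_integralP (f : T -> R[i]) (C : R) :
  measurable_fun setT (fun x => complex.Re (f x)) -> measurable_fun setT (fun x => complex.Im (f x)) ->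
  (forall x, cmod (f x) <= C) ->
  calculus E f (spectral_integral dot E f) /\
  forall h, dot (spectral_integral dot E f h) h =
    (\int[mu h]_x complex.Re (f x)) +i* (\int[mu h]_x complex.Im (f x)).
Proof.
move=> mr mi fC.
have rC x : `|complex.Re (f x)| <= C by exact: le_trans (Re_le_cmod _) (fC x).
have iC x : `|complex.Im (f x)| <= C.
  rewrite (le_trans _ (fC x))// -(@ler_pXn2r _ 2) ?nnegrE ?cmod_ge0//.
  by rewrite real_normK ?num_real// cmod_sqr lerDr sqr_ge0.
have [U1 [c1 _ _ h1]] := real_calculus_exists hdot pE mr rC.
have [U2 [c2 _ _ h2]] := real_calculus_exists hdot pE mi iC.
pose U h := U1 h + 'i%C *: U2 h.
have cU : calculus E f U.
  have -> : f = (fun x => (complex.Re (f x))%:C + 'i%C * (complex.Im (f x))%:C).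
    by apply/funext => x; rewrite -complexE.
  exact/(calculusD pE c1)/(calculusZ pE).
have hU h : dot (U h) h = (\int[mu h]_x complex.Re (f x)) +i* (\int[mu h]_x complex.Im (f x)).
  by rewrite /U dotDl dotZl h1 h2; simpc.
suff -> : spectral_integral dot E f = U by split.
have [lU _ _] := cU.
have eqd h : fine (\int[diag_measure dot E h]_x (complex.Re (f x))%:E) +i*
     fine (\int[diag_measure dot E h]_x (complex.Im (f x))%:E) = dot (U h) h.
  by rewrite hU !(integral_diag_measure hdot pE).
have bU : bounded_operator U.
  apply/bounded_operatorP; split=> //; exists `|C| => // x.
  apply: (calculus_bound hdot pE x cU) => // y; exact: le_trans (fC y) (ler_norm _).
rewrite /spectral_integral; set P := [set _ | _].
have [[lV _] hV] : P (get P) by apply: getPex; exists U; split => // h.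
by apply: (polarization hdot) => // h; rewrite hV eqd.
Qed.

End spectral_integral.

(** * The unitary group of the joint spectral measure *)

Section expi.
Context {R : realType}.
Implicit Types s t : R.

Definition expi t : R[i] := cos t +i* sin t.

Lemma mvt0 (f df : R -> R) t : (forall x : R, is_derive x 1 f (df x)) ->
  exists2 c : R, `|c| <= `|t| & f t - f 0 = df c * t.
Proof.
move=> fdf.
have cf A : {within A, continuous f}.
  apply: continuous_subspaceT => x; apply/differentiable_continuous/derivable1_diffP.
  by have := fdf x => -[].
have [t0|t0|t0] := ltgtP 0 t.
- have [c] := MVT t0 (fun x _ => fdf x) (cf _).
  rewrite in_itv /= subr0 => /andP[c0 ct] ->; exists c => //.
  by rewrite !ger0_norm ?ltW.
- have [c] := MVT t0 (fun x _ => fdf x) (cf _).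
  rewrite in_itv /= sub0r mulrN => /andP[c0 ct] h; exists c => //.
    by rewrite !ltr0_norm// lerN2 ltW.
  by rewrite -[LHS]opprB h opprK.
- by exists 0; rewrite -t0 ?subrr ?mulr0.
Qed.

Lemma ler_norm_sin t : `|sin t| <= `|t|.
Proof.
have [c _] := mvt0 t (@is_derive_sin R); rewrite sin0 subr0 => ->.
by rewrite normrM ler_piMl// cos_max.
Qed.

Lemma cos_sub1 t : 1 - cos t = 2 * sin (t / 2) ^+ 2.
Proof.
have -> : cos t = cos ((t / 2) *+ 2) by congr cos; rewrite -mulr_natr divfK.
rewrite cos_mulr2n cos2sin2; ring.
Qed.

Lemma cos_sub1_le t : `|cos t - 1| <= t ^+ 2 / 2.
Proof.
rewrite distrC cos_sub1 ger0_norm; last by apply: mulr_ge0 => //; exact: sqr_ge0.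
have := ler_norm_sin (t / 2); rewrite -(@ler_pXn2r _ 2) ?nnegrE// !real_normK ?num_real//.
by rewrite exprMn; lra.
Qed.

Lemma expi0 : expi 0 = 1.
Proof. by rewrite /expi cos0 sin0. Qed.

Lemma expiD s t : expi (s + t) = expi s * expi t.
Proof. by rewrite /expi cosD sinD; simpc; congr (_ +i* _); rewrite addrC. Qed.

Lemma cmod_expi t : cmod (expi t) = 1.
Proof. by apply/eqP; rewrite -sqrp_eq1 ?cmod_ge0// cmod_sqr /= cos2Dsin2. Qed.

Lemma expi_sub1_le t : cmod (expi t - 1) <= `|t|.
Proof.
rewrite -(@ler_pXn2r _ 2) ?nnegrE ?cmod_ge0// cmod_sqr /= subr0 real_normK ?num_real//.
have := cos2Dsin2 t; have := ler_norml (cos t - 1) (t ^+ 2 / 2); rewrite cos_sub1_le.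
move=> /esym/andP[]; set c := cos t; set s := sin t; nra.
Qed.

(** The cosine contributes at most [t^2 / 2] and the sine at most [t^2]. *)
Lemma expi_sub_lin_le t : cmod (expi t - 1 - 'i%C * t%:C) <= 2 * t ^+ 2.
Proof.
have -> : expi t - 1 - 'i%C * t%:C = (cos t - 1)%:C + 'i%C * (sin t - t)%:C.
  by rewrite /expi; simpc.
rewrite (le_trans (cmodD _ _))// cmodM cmod_real [cmod 'i%C]cmodi mul1r cmod_real.
have h1 := cos_sub1_le t.
have dsin (x : R) : is_derive x 1 (fun x => sin x - x) (cos x - 1) by apply: is_deriveB.
have [c ct] := mvt0 t dsin; rewrite sin0 !subr0 => ->.
have [c' _] := mvt0 c (@is_derive_cos R); rewrite cos0 => h2.
have h3 : `|cos c - 1| <= `|t|.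
  rewrite h2 normrM (le_trans _ ct)// ler_piMl// normrN sin_max//.
have h4 : `|(cos c - 1) * t| <= t ^+ 2.
  by rewrite normrM -(real_normK (num_real t)) expr2 ler_wpM2r.
have := sqr_ge0 t; lra.
Qed.

End expi.

Lemma measurable_tnthR (R : realType) n (j : 'I_n) :
  measurable_fun setT (fun x : n.-tuple (measurableTypeR R) => tnth x j : R).
Proof. exact: measurable_tnth. Qed.

Section joint_group.
Context {R : realType} {H : completeNormedModType R[i]}.
Variable dot : {dot H for Num.conj}.
Hypothesis hdot : dot_induces_norm dot.
Context {n : nat}.
Variable E : set (n.-tuple (measurableTypeR R)) -> H -> H.
Hypothesis pE : projection_valued_measure dot E.
Local Notation U := (joint_expi dot E).
Local Notation mu := (pvm_measure hdot pE).
Implicit Types (a b : 'rV[R]_n) (h : H).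

Definition linform a (x : n.-tuple (measurableTypeR R)) : R := \sum_j a 0 j * tnth x j.

Lemma linform0 x : linform 0 x = 0.
Proof. by rewrite /linform big1// => j _; rewrite mxE mul0r. Qed.

Lemma linformD a b x : linform (a + b) x = linform a x + linform b x.
Proof. by rewrite /linform -big_split; apply: eq_bigr => j _; rewrite mxE mulrDl. Qed.

Lemma linform_delta (t : R) j x : linform (t *: delta_mx 0 j) x = t * tnth x j.
Proof.
rewrite /linform (bigD1 j)//= big1 ?addr0 => [|i ij]; first by rewrite !mxE !eqxx mulr1.
by rewrite !mxE (negPf ij) andbF mulr0 mul0r.
Qed.

Lemma measurable_linform a : measurable_fun setT (linform a).
Proof.
apply: measurable_sum => j; apply: measurable_funM => //; exact: measurable_tnthR.
Qed.

Lemma joint_expiP a : calculus E (fun x => expi (linform a x)) (U a) /\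
  forall h, dot (U a h) h =
    (\int[mu h]_x cos (linform a x)) +i* (\int[mu h]_x sin (linform a x)).
Proof.
apply: (@spectral_integralP _ _ _ hdot _ _ _ pE (fun x => expi (linform a x)) 1) => /=.
- apply: (@measurableT_comp _ _ _ _ _ _ cos) (measurable_linform a).
  apply: continuous_measurable_fun; exact: continuous_cos.
- apply: (@measurableT_comp _ _ _ _ _ _ sin) (measurable_linform a).
  apply: continuous_measurable_fun; exact: continuous_sin.
- by move=> x; rewrite cmod_expi.
Qed.

Lemma joint_expi_calculus a : calculus E (fun x => expi (linform a x)) (U a).
Proof. by have [] := joint_expiP a. Qed.

Lemma joint_expi_lin a : linear (U a).
Proof. by have [] := joint_expi_calculus a. Qed.

Lemma joint_expi_pvm a A h : measurable A -> U a (E A h) = E A (U a h).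
Proof. by have [_ c _] := joint_expi_calculus a; exact: c. Qed.

Lemma joint_expi0 h : U 0 h = h.
Proof.
suff -> : U 0 = (fun h => 1 *: h) by rewrite scale1r.
apply: (calculus_unique hdot pE (joint_expi_calculus 0)).
have -> : (fun x => expi (linform 0 x)) = (fun=> 1).
  by apply/funext => x; rewrite linform0 expi0.
exact: (calculus_cst pE).
Qed.

Lemma joint_expiD a b h : U (a + b) h = U a (U b h).
Proof.
suff -> : U (a + b) = (fun h => U a (U b h)) by [].
apply: (calculus_unique hdot pE (joint_expi_calculus (a + b))).
have -> : (fun x => expi (linform (a + b) x)) =
    (fun x => expi (linform a x) * expi (linform b x)).
  by apply/funext => x; rewrite linformD expiD.
by apply: (calculusM hdot pE (C := 1) (C' := 1)) => [||x|x];
  rewrite ?cmod_expi//; exact: joint_expi_calculus.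
Qed.

Lemma joint_expiK a h : U (- a) (U a h) = h.
Proof. by rewrite -joint_expiD addNr joint_expi0. Qed.

Lemma joint_expiVK a h : U a (U (- a) h) = h.
Proof. by rewrite -joint_expiD addrN joint_expi0. Qed.

Lemma nr_joint_expi a h : nr (U a h) = nr h.
Proof.
have le b k : nr (U b k) <= nr k.
  rewrite -[leRHS]mul1r; apply: (calculus_bound hdot pE k (joint_expi_calculus b)) => // x.
  by rewrite cmod_expi.
by apply/eqP; rewrite eq_le le /= -{1}[h](joint_expiK a) le.
Qed.

(** An isometry preserves inner products: the real part by expanding [|x + y|^2], the imaginary part
    by replacing [x] with [i x]. As [U (- a)] inverts [U a], it is the adjoint. *)
Lemma joint_expi_adj a (h k : H) : dot (U a h) k = dot h (U (- a) k).
Proof.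
have lU := joint_expi_lin a.
have re x y : complex.Re (dot (U a x) (U a y)) = complex.Re (dot x y).
  have := nr_joint_expi a (x + y); rewrite (linD lU) => /(congr1 (fun r => r ^+ 2)).
  by rewrite !(nrD_sqr hdot) !nr_joint_expi => /addrI; lra.
have key x y : dot (U a x) (U a y) = dot x y.
  apply/eqP; rewrite eq_complex re eqxx /=.
  have := re ('i%C *: x) y; rewrite (linZ lU) !dotZl.
  case: (dot x y) => p q; case: (dot (U a x) (U a y)) => p' q'; simpc => /=.
  by move=> h1; apply/eqP; lra.
by rewrite -{1}[k](joint_expiVK a) key.
Qed.

End joint_group.

(** * Spectral slabs and strong continuity *)

Section truncation.
Context {R : realType} {H : completeNormedModType R[i]}.
Variable dot : {dot H for Num.conj}.
Hypothesis hdot : dot_induces_norm dot.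

(** Continuity from below of the measure [<E(.)h, h>]: the squared norm of [h - E (A k) h] is the
    mass that [A k] leaves out. *)
Lemma pvm_exhaust {d : measure_display} {T : measurableType d} (E : set T -> H -> H)
    (A : nat -> set T) (h : H) (e : R) : projection_valued_measure dot E ->
  (forall k, measurable (A k)) -> (forall k l, (k <= l)%N -> A k `<=` A l) ->
  \bigcup_k A k = setT -> 0 < e -> exists N, forall k, (N <= k)%N -> nr (h - E (A k) h) < e.
Proof.
move=> pE mA sA cA e0; pose mu := pvm_measure hdot pE h.
have : mu (A k) @[k --> \oo] --> mu setT.
  rewrite -cA; apply: nondecreasing_cvg_mu => //; first by rewrite cA.
  by move=> k l kl; apply/subsetPset; exact: sA.
rewrite /mu pvm_measureT.
have -> : (fun k => mu (A k)) = EFin \o (fun k => nr (E (A k) h) ^+ 2).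
  by apply/funext => k /=; rewrite /mu pvm_measureE.
move=> /fine_cvgP[_] /cvgrPdist_lt /(_ (e ^+ 2)) [|N _ hN]; first by rewrite exprn_gt0.
exists N => k /hN /=; rewrite (nr_pvm_split hdot pE h (mA k)) (pvmC pE)// addrC addKr.
rewrite ger0_norm ?sqr_ge0// => h1.
by rewrite -(@ltr_pXn2r _ 2) ?nnegrE ?nr_ge0 ?(ltW e0).
Qed.

Context {n : nat}.
Variable E : set (n.-tuple (measurableTypeR R)) -> H -> H.
Hypothesis pE : projection_valued_measure dot E.
Local Notation U := (joint_expi dot E).

Definition slab (j : 'I_n) (r : R) : set (n.-tuple (measurableTypeR R)) :=
  [set x | `|tnth x j : R| <= r].

Lemma measurable_slab j r : measurable (slab j r).
Proof.
have -> : slab j r = [set x | - r <= - `|tnth x j : R|].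
  by apply/seteqP; split=> x; rewrite /slab /= lerN2.
apply: measurable_superlevel; apply: measurableT_comp => //.
by apply: measurableT_comp => //; exact: measurable_tnthR.
Qed.

Lemma slab_exhaust j h (e : R) : 0 < e -> exists N : nat, forall k : nat, (N <= k)%N ->
  nr (h - E (slab j k%:R) h) < e.
Proof.
apply: (pvm_exhaust h pE (A := fun k => slab j k%:R)) => [k|k l kl x /=|].
- exact: measurable_slab.
- by rewrite /slab /= => /le_trans; apply; rewrite ler_nat.
apply/seteqP; split=> // x _; exists (Num.truncn `|tnth x j : R|).+1 => //=.
by rewrite /slab /=; apply: ltW; exact: truncnS_gt.
Qed.

Lemma joint_expi_slab (j : 'I_n) (r t : R) h : 0 <= r ->
  nr (U (t *: delta_mx 0 j) (E (slab j r) h) - E (slab j r) h) <= `|t| * r * nr h.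
Proof.
move=> r0; have mS := measurable_slab j r.
have c1 := calculusB pE (joint_expi_calculus hdot pE (t *: delta_mx 0 j)) (calculus_cst pE 1).
have cU := calculusM hdot pE c1 (calculus_indic pE mS) (C := 2) (C' := 1).
have := calculus_bound hdot pE h (cU _ _); rewrite scale1r; apply.
- by move=> x; rewrite (le_trans (cmodD _ _))// cmodN cmod1 cmod_expi.
- by move=> x; rewrite cmod_real indicE; case: (_ \in _); rewrite ?normr1 ?normr0.
- by rewrite mulr_ge0.
move=> x; rewrite cmodM cmod_real indicE linform_delta.
have [xS|_] := boolP (x \in slab j r); last by rewrite normr0 mulr0 mulr_ge0.
move: xS; rewrite inE /slab /= => xr.
by rewrite normr1 mulr1 (le_trans (expi_sub1_le _))// normrM ler_wpM2l.
Qed.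

Lemma joint_expi_continuous h (j : 'I_n) (e : R) : 0 < e ->
  exists2 d : R, 0 < d & forall t : R, 0 <= t <= d ->
    nr (U (t *: delta_mx 0 j) h - h) < e.
Proof.
move=> e0; have e3 : 0 < e / 3 by rewrite divr_gt0.
have e33 : e / 3 + e / 3 + e / 3 = e by field.
have [N /(_ _ (leqnn N)) hN] := slab_exhaust j h e3.
have M0 : 0 < N%:R * nr h + 1 by rewrite ltr_wpDl// mulr_ge0 ?nr_ge0.
exists (e / 3 / (N%:R * nr h + 1)) => [|t /andP[t0 td]]; first by rewrite divr_gt0.
set y := E (slab j N%:R) h in hN *; set V := U _.
have lV : linear V := joint_expi_lin hdot pE _.
have -> : V h - h = V (h - y) + (V y - y) - (h - y).
  by rewrite (linB lV) subrKA opprB subrKA.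
rewrite (le_lt_trans (nrB _ _))// -e33 (ltrD _ hN)//.
rewrite (le_lt_trans (nrD _ _))// nr_joint_expi// (ltr_leD hN)//.
rewrite (le_trans (joint_expi_slab _ _ _ _))// ger0_norm// -mulrA.
have : t * (N%:R * nr h + 1) <= e / 3 by rewrite -ler_pdivlMr.
by rewrite mulrDr mulr1 => h1; rewrite (le_trans _ h1)// lerDl.
Qed.

End truncation.

(** * Duhamel's formula *)

Section position.
Context {R : realType} {H : completeNormedModType R[i]}.
Variable dot : {dot H for Num.conj}.
Hypothesis hdot : dot_induces_norm dot.
Context {n : nat}.
Variable E : set (n.-tuple (measurableTypeR R)) -> H -> H.
Hypothesis pE : projection_valued_measure dot E.
Variables (j : 'I_n) (X : operator H).
Hypothesis Xsa : self_adjoint dot X.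
Hypothesis XE : spectral_measure dot X (fun B => E [set x | B (tnth x j)]).
Local Notation mu := (pvm_measure hdot pE).
Local Notation P r := (E (slab j r)).
Implicit Types (r t : R) (h : H).

(** The spectral measure of [X] is the [j]-th marginal of the joint one. The change of variables is
    made on positive and negative parts separately. *)
Lemma integral_marginal h (f : R -> R) : measurable_fun setT f ->
  (\int[diag_measure dot (fun B => E [set x | B (tnth x j)]) h]_t (f t)%:E =
   \int[mu h]_x (f (tnth x j))%:E)%E.
Proof.
move=> mf.
rewrite (@eq_raw_measure_integral _ (measurableTypeR R) _ _
  (pushforward (mu h) (fun x : n.-tuple (measurableTypeR R) => tnth x j))); last first.
  move=> A mA; rewrite /pushforward.
  have mA' : measurable [set x : n.-tuple (measurableTypeR R) | A (tnth x j)].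
    have := @measurable_tnth _ (measurableTypeR R) n j measurableT A mA.
    by rewrite setTI.
  by rewrite [RHS](pvm_measureE hdot pE h mA') -(diag_measureE hdot pE h mA').
have mj := @measurable_tnth _ (measurableTypeR R) n j.
pose nu := measure_function_pushforward__canonical__measure_function_Measure (mu h) mj.
have mEf : measurable_fun setT (fun t => (f t)%:E) by exact/measurable_EFinP.
rewrite [RHS]integralE (integralE nu setT (fun t => (f t)%:E)); congr (_ - _)%E.
  apply: etrans (ge0_integral_pushforward mj (mu h) measurableT _ _) _ => //.
    exact: measurable_funepos.
  by rewrite preimage_setT; apply: eq_integral => x _; rewrite /= !(funeposE, funenegE).
apply: etrans (ge0_integral_pushforward mj (mu h) measurableT _ _) _ => //.
  exact: measurable_funeneg.
by rewrite preimage_setT; apply: eq_integral => x _; rewrite /= !(funeposE, funenegE).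
Qed.

Lemma integral_slab h r (f : R -> R) : 0 <= r -> measurable_fun setT f -> P r h = h ->
  (\int[mu h]_x (f (tnth x j))%:E = \int[mu h]_x (f (tnth x j) * \1_(slab j r) x)%:E)%E.
Proof.
move=> r0 mf Ph; have mS := measurable_slab j r.
have mfj : measurable_fun setT (fun x : n.-tuple (measurableTypeR R) => f (tnth x j)).
  by apply: (measurableT_comp mf); exact: measurable_tnthR.
apply: ae_eq_integral => //.
- exact/measurable_EFinP.
- by apply/measurable_EFinP; apply: measurable_funM => //; exact: measurable_indic.
exists (~` slab j r); split; first exact: measurableC.
  have mSC := measurableC mS.
  by rewrite (pvm_measureE hdot pE _ mSC) (pvmC pE _ mS) Ph subrr nr0 expr0n.
move=> x /= h1 h2; apply: h1 => _.
by rewrite indicE mem_set// mulr1.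
Qed.

Lemma slab_dom r h : 0 <= r -> P r h = h -> op_dom X h.
Proof.
move=> r0 Ph; have [_ dX _] := XE; apply/dX.
rewrite (integral_marginal _ (f := fun t => t ^+ 2)); last exact: measurable_funX.
rewrite (integral_slab (f := fun t => t ^+ 2) r0 _ Ph); last exact: measurable_funX.
apply: le_lt_trans (_ : (\int[mu h]_x cst (r ^+ 2)%:E x < +oo)%E); last first.
  by rewrite integral_cst // pvm_measureT -EFinM ltry.
apply: ge0_le_integral => //.
- by move=> x _; rewrite lee_fin mulr_ge0 ?sqr_ge0// indicE; case: (_ \in _).
- apply/measurable_EFinP; apply: measurable_funM.
    by apply: measurable_funX; exact: measurable_tnthR.
  by apply: measurable_indic; exact: measurable_slab.
move=> x _; rewrite lee_fin indicE; have [|_] := boolP (x \in _); last by rewrite mulr0 sqr_ge0.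
rewrite inE /slab /= mulr1 => xr.
by rewrite -(real_normK (num_real _)) ler_pXn2r ?nnegrE.
Qed.

(** The [j]-th coordinate cut off outside the slab, a bounded symbol for [X] on the range of the
    slab. *)
Definition position r (x : n.-tuple (measurableTypeR R)) : R := tnth x j * \1_(slab j r) x.

Lemma measurable_position r : measurable_fun setT (position r).
Proof.
apply: measurable_funM; first exact: measurable_tnthR.
by apply: measurable_indic; exact: measurable_slab.
Qed.

Lemma position_le r x : 0 <= r -> `|position r x| <= r.
Proof.
move=> r0; rewrite /position indicE; have [|_] := boolP (x \in _); last by rewrite mulr0 normr0.
by rewrite inE /slab /= mulr1.
Qed.

Lemma position_calculus r : 0 <= r -> exists2 Y, calculus E (fun x => (position r x)%:C) Y &
  forall h, P r h = h -> dot (X h) h = dot (Y h) h.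
Proof.
move=> r0; have mf := measurable_position r.
have [Y [cY _ _ hY]] := real_calculus_exists hdot pE mf (fun x => position_le x r0).
exists Y => // h Ph; have [_ _ ->] := XE; last exact: slab_dom Ph.
rewrite (integral_marginal _ (f := id))// hY.
by rewrite (integral_slab (f := id) r0 _ Ph).
Qed.

Lemma slab_mono r r' h : r <= r' -> P r h = h -> P r' h = h.
Proof.
move=> rr' <-; rewrite -(pvmI pE); [|exact: measurable_slab..].
congr (E _ h); apply/seteqP; split=> x; rewrite /slab /=; first by case.
by move=> xr; split=> //; exact: le_trans xr rr'.
Qed.

Lemma slab_density h k : (forall N : nat, P N%:R (h - k) = 0) -> h = k.
Proof.
move=> hk; apply/eqP; rewrite -subr_eq0; apply/eqP/nr_eq0/eqP.
rewrite eq_le nr_ge0 andbT; apply: le_small => e e0.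
have [N /(_ _ (leqnn N))] := slab_exhaust hdot pE j (h - k) e0.
by rewrite hk subr0.
Qed.

(* The quadratic forms of [X] and of its truncations agree on the range of each slab, and
   the union of these ranges is dense. *)
Lemma position_op r (Y : H -> H) h : 0 <= r -> calculus E (fun x => (position r x)%:C) Y ->
  P r h = h -> X h = Y h.
Proof.
move=> r0 cY Ph; apply: slab_density => N.
apply: (dot_ext hdot) => k; rewrite dot0l (pvm_sym pE); last exact: measurable_slab.
(* Both [h] and the test vector lie in the range of the slab of half-width [r'], where [X] and [Y']
   have the same quadratic form. *)
pose r' := Num.max r N%:R; have r'0 : 0 <= r' by rewrite le_max r0.
have rr' : r <= r' by rewrite le_max lexx.
have Pk : P r' (P N%:R k) = P N%:R k.
  apply: slab_mono (_ : N%:R <= r') _; first by rewrite le_max lexx orbT.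
  by rewrite (pvm_idem pE)//; exact: measurable_slab.
have [Y' cY' XY'] := position_calculus r'0.
have [lY' _ _] := cY'; have lP := pvm_lin pE (measurable_slab j r').
(* [Y] and [Y'] agree at [h], since cutting the symbol of [Y'] down to the smaller slab gives that
   of [Y]. *)
rewrite dotBl -[Y h](_ : Y' h = _); last first.
  rewrite -{1}Ph; suff -> : Y = (fun h => Y' (P r h)) by [].
  apply: (calculus_unique hdot pE cY).
  have -> : (fun x => (position r x)%:C) = (fun x => (position r' x)%:C * (\1_(slab j r) x)%:C).
    apply/funext => x; rewrite -rmorphM /position !indicE; congr _%:C.
    have [/set_mem xr|_] := boolP (x \in slab j r); last by rewrite !mulr0.
    by rewrite mem_set ?mulr1//; exact: le_trans xr rr'.
  apply: (calculusM hdot pE cY' (calculus_indic pE (measurable_slab j r)) (C := r') (C' := 1)).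
    by move=> x; rewrite cmod_real position_le.
  by move=> x; rewrite cmod_real indicE; case: (_ \in _); rewrite ?normr1 ?normr0.
apply/eqP; rewrite subr_eq0; apply/eqP.
have [d0 dl _ _] := Xsa.
apply: (@polarization_in _ _ dot [set u | P r' u = u] X Y') => //=.
- by move=> a x y Px Py; rewrite lP Px Py.
- move=> a x y Px Py; have dx := slab_dom r'0 Px; have dy := slab_dom r'0 Py.
  by have [] := dl a x y dx dy.
- by move=> *; exact: lY'.
- exact: slab_mono Ph.
Qed.

End position.

Section duhamel.
Context {R : realType} {H : completeNormedModType R[i]}.
Variable dot : {dot H for Num.conj}.
Hypothesis hdot : dot_induces_norm dot.
Context {n : nat}.
Variable E : set (n.-tuple (measurableTypeR R)) -> H -> H.
Hypothesis pE : projection_valued_measure dot E.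
Variables (j : 'I_n) (X : operator H).
Hypothesis Xsa : self_adjoint dot X.
Hypothesis XE : spectral_measure dot X (fun B => E [set x | B (tnth x j)]).
Local Notation W t := (joint_expi dot E (t *: delta_mx 0 j)).
Local Notation P r := (E (slab j r)).
Implicit Types (r t : R) (h : H).

Lemma slab_joint_expi r t h : P r h = h -> P r (W t h) = W t h.
Proof. by move=> Ph; rewrite -(joint_expi_pvm hdot pE) ?Ph//; exact: measurable_slab. Qed.

Lemma nr_position_op r h : 0 <= r -> P r h = h -> nr (X h) <= r * nr h.
Proof.
move=> r0 Ph; have [Y cY _] := position_calculus hdot pE XE r0.
rewrite (position_op hdot pE Xsa XE r0 cY Ph).
by apply: (calculus_bound hdot pE h cY) => // x; rewrite cmod_real position_le.
Qed.

(** On the slab the symbol [e^(itx) - 1 - itx] is bounded by [2 (t r)^2]. *)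
Lemma joint_expi_taylor r t h : 0 <= r -> P r h = h ->
  nr (W t h - h - ('i%C * t%:C) *: X h) <= 2 * (t * r) ^+ 2 * nr h.
Proof.
move=> r0 Ph; have [Y cY _] := position_calculus hdot pE XE r0.
rewrite (position_op hdot pE Xsa XE r0 cY Ph).
have mS := measurable_slab j r.
have cI := calculus_indic pE mS.
have c1 := calculusB pE (joint_expi_calculus hdot pE (t *: delta_mx 0 j)) (calculus_cst pE 1).
have c2 := calculusM hdot pE (calculusB pE c1 (calculusZ pE ('i%C * t%:C) cY)) cI
  (C := 2 + `|t| * r) (C' := 1).
have := calculus_bound hdot pE h (c2 _ _); rewrite Ph scale1r; apply.
- move=> x; rewrite (le_trans (cmodD _ _))// cmodN lerD//.
    by rewrite (le_trans (cmodD _ _))// cmodN cmod1 cmod_expi.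
  rewrite !cmodM [cmod 'i%C]cmodi mul1r !cmod_real ler_wpM2l//; exact: position_le.
- by move=> x; rewrite cmod_real indicE; case: (_ \in _); rewrite ?normr1 ?normr0.
- by rewrite mulr_ge0// sqr_ge0.
move=> x; rewrite cmodM cmod_real /position !indicE linform_delta.
have [xS|_] := boolP (x \in slab j r); last by rewrite normr0 mulr0 mulr_ge0// sqr_ge0.
rewrite normr1 !mulr1; move: xS; rewrite inE /slab /= => xr.
have -> : 'i%C * t%:C * (tnth x j : R)%:C = 'i%C * (t * tnth x j)%:C by rewrite -mulrA -rmorphM.
rewrite (le_trans (expi_sub_lin_le _))// ler_wpM2l// !exprMn ler_wpM2l ?sqr_ge0//.
by rewrite -(real_normK (num_real (tnth x j : R))) ler_pXn2r ?nnegrE.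
Qed.

Variable T : H -> H.
Hypothesis Tlin : linear T.
Variable M : R.
Hypothesis M0 : 0 <= M.
Hypothesis TM : forall x, nr (T x) <= M * nr x.
Variable K : H -> H.
Hypothesis Klin : linear K.
Variable MK : R.
Hypothesis MK0 : 0 <= MK.
Hypothesis KM : forall x, nr (K x) <= MK * nr x.
Hypothesis TX : forall h, op_dom X h -> op_dom X (T h).
Hypothesis TXK : forall h, op_dom X h -> T (X h) - X (T h) = K h.

(** To first order in [t], the pairing [<T W_t g', W_t k'>] changes by [i t <(T X - X T) g', k'> = i
    t <K g', k'>]. The remainder is quadratic, with a constant [D] independent of [s] because [W s]
    preserves norms and ranges of slabs. *)
Lemma duhamel_step r g (k : H) : 0 <= r -> P r g = g -> P r k = k ->
  exists D : R, forall s t : R, 0 <= t <= 1 ->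
    cmod (dot (T (W (s + t) g)) (W (s + t) k) - dot (T (W s g)) (W s k))
    <= t * (nr (K (W s g)) * nr k) + D * t ^+ 2.
Proof.
move=> r0 Pg Pk.
(* The summands come from the second order term, the Taylor remainder of [g'] and that of [k']; the
   last one uses [t <= 1]. *)
exists (M * nr g * nr k * (r ^+ 2 + 2 * r ^+ 2 + 2 * r ^+ 2 * (1 + r))).
move=> s t /andP[t0 t1].
rewrite [s + t]addrC scalerDl !(joint_expiD hdot pE).
set g' := W s g; set k' := W s k.
have Pg' : P r g' = g' by exact: slab_joint_expi.
have Pk' : P r k' = k' by exact: slab_joint_expi.
have <- : nr k' = nr k by rewrite /k' nr_joint_expi.
have <- : nr g' = nr g by rewrite /g' nr_joint_expi.
have dg := slab_dom hdot pE XE r0 Pg'; have dk := slab_dom hdot pE XE r0 Pk'.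
have [_ _ _ sX] := Xsa.
(* Self-adjointness moves [X] to the other side, because [T g'] stays in its domain. *)
have sym : dot (X (T g')) k' = dot (T g') (X k').
  by have [_ /(_ (conj dk erefl)) ->] := sX k' (X k'); last exact: TX.
have hg := joint_expi_taylor t r0 Pg'; have hk := joint_expi_taylor t r0 Pk'.
have Xg := nr_position_op r0 Pg'; have Xk := nr_position_op r0 Pk'.
set rho := W t g' - g' - _ in hg; set sigma := W t k' - k' - _ in hk.
pose c : R[i] := 'i%C * t%:C.
have cc : cmod c = t by rewrite /c cmodM [cmod 'i%C]cmodi mul1r cmod_real ger0_norm.
have eg : W t g' = g' + c *: X g' + rho by rewrite /rho -[_ - _ - _]addrA -opprD [RHS]addrC subrK.
have ek : W t k' = (k' + c *: X k') + sigma by rewrite /sigma -[_ - _ - _]addrA -opprD [RHS]addrC subrK.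
have cJ : c^* = - c.
  by rewrite -[LHS]/(conjc c) /c; simpc.
have -> : dot (T (W t g')) (W t k') - dot (T g') k' =
   c * dot (K g') k' - c ^+ 2 * dot (T (X g')) (X k') + dot (T rho) (W t k')
   + dot (T (g' + c *: X g')) sigma.
  have main : dot (T (g' + c *: X g')) (k' + c *: X k') =
      dot (T g') k' + c * dot (T (X g')) k' - c * dot (T g') (X k')
      - c ^+ 2 * dot (T (X g')) (X k').
    by rewrite (linD Tlin) (linZ Tlin) !(dotDl, dotDr, dotZl, dotZr) cJ; ring.
  have -> : dot (T (W t g')) (W t k') =
      dot (T (g' + c *: X g')) (k' + c *: X k') + dot (T (g' + c *: X g')) sigma
      + dot (T rho) (W t k').
    by rewrite -dotDr -ek -dotDl -(linD Tlin) -eg.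
  rewrite main -TXK// dotBl sym; ring.
have ng := nr_ge0 g'; have nk := nr_ge0 k'.
have Wk : nr (W t k') = nr k' by rewrite nr_joint_expi.
have b1 : cmod (c * dot (K g') k') <= t * (nr (K g') * nr k').
  by rewrite cmodM cc ler_wpM2l// (cauchy_schwarz hdot).
have b2 : cmod (c ^+ 2 * dot (T (X g')) (X k')) <= t ^+ 2 * (M * (r * nr g') * (r * nr k')).
  rewrite expr2 cmodM cmodM cc -expr2 ler_wpM2l ?sqr_ge0//.
  rewrite (le_trans (cauchy_schwarz hdot _ _))// ler_pM ?nr_ge0//.
  by rewrite (le_trans (TM _))// ler_wpM2l.
have b3 : cmod (dot (T rho) (W t k')) <= M * (2 * (t * r) ^+ 2 * nr g') * nr k'.
  rewrite (le_trans (cauchy_schwarz hdot _ _))// Wk ler_wpM2r//.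
  by rewrite (le_trans (TM _))// ler_wpM2l.
have b4 : cmod (dot (T (g' + c *: X g')) sigma) <=
    M * ((1 + r) * nr g') * (2 * (t * r) ^+ 2 * nr k').
  rewrite (le_trans (cauchy_schwarz hdot _ _))// ler_pM ?nr_ge0//.
  rewrite (le_trans (TM _))// ler_wpM2l// (le_trans (nrD _ _))// mulrDl mul1r lerD2l.
  by rewrite nrZ cc (le_trans _ Xg)// ler_piMl ?nr_ge0.
rewrite (le_trans (cmodD _ _))//.
apply: (le_trans (lerD (le_trans (cmodD _ _) (lerD (le_trans (cmodD _ _) (lerD (lexx _) (lexx _))) (lexx _))) (lexx _))).
rewrite cmodN.
apply: (le_trans (lerD (lerD (lerD b1 b2) b3) b4)).
rewrite -!addrA lerD2l le_eqVlt; apply/orP; left; apply/eqP; ring.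
Qed.

(** [N] steps of length [d = t0 / N] are added up; their quadratic errors total [D * t0 * d], which
    tends to 0. *)
Lemma duhamel_slab r g (k : H) (C t0 : R) : 0 <= r -> P r g = g -> P r k = k -> 0 <= t0 ->
  (forall t, 0 <= t <= t0 -> nr (K (W t g)) <= C) ->
  cmod (dot (joint_expi dot E (- (t0 *: delta_mx 0 j)) (T (W t0 g)) - T g) k) <= t0 * C * nr k.
Proof.
move=> r0 Pg Pk t00 KC; have [D hD] := duhamel_step r0 Pg Pk.
pose y t := dot (T (W t g)) (W t k).
have nk := nr_ge0 k.
have -> : dot (joint_expi dot E (- (t0 *: delta_mx 0 j)) (T (W t0 g)) - T g) k = y t0 - y 0.
  by rewrite dotBl (joint_expi_adj hdot pE) opprK /y !scale0r !(joint_expi0 hdot pE).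
suff key (e : R) : 0 < e -> cmod (y t0 - y 0) <= t0 * C * nr k + e by apply/ler_addgt0Pr.
(* Taking [N] above this number ensures both [d <= 1] and [|D| * t0 * d <= e]. *)
move=> e0; have M1 : 0 < t0 + `|D| * t0 ^+ 2 / e + 1.
  by rewrite ltr_wpDl// addr_ge0// divr_ge0 ?(ltW e0)// mulr_ge0// sqr_ge0.
have [N0 /(_ _ (leqnn _))] := harmonic_lt (divr_gt0 ltr01 M1).
set N := N0.+1 => hN; have N0' : 0 < N%:R :> R by [].
have {hN} hN : t0 + `|D| * t0 ^+ 2 / e + 1 < N%:R.
  by move: hN; rewrite div1r ltf_pV2 ?posrE.
have q0 : 0 <= `|D| * t0 ^+ 2 / e by rewrite divr_ge0 ?(ltW e0)// mulr_ge0// sqr_ge0.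
pose d := t0 / N%:R.
have d0 : 0 <= d by rewrite divr_ge0.
have d1 : d <= 1 by rewrite ler_pdivrMr// mul1r; lra.
have step i : (i <= N)%N ->
    cmod (y (i%:R * d) - y 0) <= i%:R * (d * (C * nr k) + D * d ^+ 2).
  elim: i => [|i ih] iN; first by rewrite !mul0r subrr cmod0.
  have -> : y (i.+1%:R * d) - y 0 = (y (i%:R * d + d) - y (i%:R * d)) + (y (i%:R * d) - y 0).
    by rewrite subrKA -natr1 mulrDl mul1r.
  rewrite (le_trans (cmodD _ _))// -natr1 mulrDl mul1r addrC lerD//; first exact: ih (ltnW iN).
  have d01 : 0 <= d <= 1 by rewrite d0.
  rewrite (le_trans (hD _ _ d01))// lerD2r ler_wpM2l// ler_wpM2r//; apply: KC.
  rewrite mulr_ge0//= /d mulrA ler_pdivrMr// mulrC ler_wpM2l// ler_nat; exact: ltnW.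
have dN : N%:R * d = t0 by rewrite /d mulrC divfK ?gt_eqF.
have := step N (leqnn _); rewrite dN => /le_trans; apply.
have -> : N%:R * (d * (C * nr k) + D * d ^+ 2) = (N%:R * d) * C * nr k + D * (N%:R * d) * d.
  by ring.
rewrite dN lerD2l; apply: (@le_trans _ _ (`|D| * t0 * d)).
  by rewrite ler_wpM2r// ler_wpM2r// ler_norm.
rewrite /d mulrA ler_pdivrMr// -[_ * t0 * t0]mulrA -expr2.
rewrite [leRHS]mulrC -ler_pdivrMr//; lra.
Qed.

(** The truncation is removed twice: from the test vector, by testing against a projection of [F h]
    itself, and then from [g], where [C] deteriorates by [MK] times the truncation error. *)
Lemma duhamel (t0 : R) g (C : R) : 0 <= t0 ->
  (forall t, 0 <= t <= t0 -> nr (K (W t g)) <= C) ->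
  nr (joint_expi dot E (- (t0 *: delta_mx 0 j)) (T (W t0 g)) - T g) <= t0 * C.
Proof.
move=> t00 KC; pose F h := joint_expi dot E (- (t0 *: delta_mx 0 j)) (T (W t0 h)) - T h.
have lW s := joint_expi_lin hdot pE s.
have C0 : 0 <= C by apply: le_trans (nr_ge0 _) (KC 0 _); rewrite lexx.
have mS r := measurable_slab j r.
have idP r h : P r (P r h) = P r h by rewrite (pvm_idem pE).
have trunc (N : nat) h C' : P N%:R h = h -> (forall t, 0 <= t <= t0 -> nr (K (W t h)) <= C') ->
    nr (F h) <= t0 * C'.
  move=> Ph hC.
  have C'0 : 0 <= C' by apply: le_trans (nr_ge0 _) (hC 0 _); rewrite lexx.
  suff key (e : R) : 0 < e -> nr (F h) <= t0 * C' + e by apply/ler_addgt0Pr.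
  move=> e0; have [N' hN'] := slab_exhaust hdot pE j (F h) e0.
  pose m := maxn N N'; have := hN' m (leq_maxr _ _) => h1.
  have Pm : P m%:R h = h by apply: (slab_mono pE) Ph; rewrite ler_nat leq_maxl.
  have := duhamel_slab (ler0n R m) Pm (idP m%:R (F h)) t00 hC.
  rewrite -/(F h) -(pvm_sym pE)// (pvm_sqr hdot pE)// cmod_real ger0_norm ?sqr_ge0// => h2.
  have h3 : nr (P m%:R (F h)) <= t0 * C'.
    have [->|Q0] := eqVneq (nr (P m%:R (F h))) 0; first by rewrite mulr_ge0.
    have Q1 : 0 < nr (P m%:R (F h)) by rewrite lt0r Q0 nr_ge0.
    by move: h2; rewrite expr2 ler_pM2r.
  rewrite -[F h in leLHS](subrK (P m%:R (F h))) (le_trans (nrD _ _))// addrC.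
  by rewrite lerD// ltW.
suff key (e : R) : 0 < e -> nr (F g) <= t0 * C + e by apply/ler_addgt0Pr.
move=> e0; have B0 : 0 < t0 * MK + (M + M) + 1 by rewrite ltr_wpDl// addr_ge0 ?mulr_ge0 ?addr_ge0.
have d0 := divr_gt0 e0 B0.
have [N /(_ _ (leqnn _)) /ltW hN] := slab_exhaust hdot pE j g d0.
set q := P N%:R g in hN.
have F1 : nr (F q) <= t0 * (C + MK * (e / (t0 * MK + (M + M) + 1))).
  apply: (trunc N); first exact: idP.
  move=> t tt; rewrite -[q](subKr g) (linB (lW _)) (linB Klin) (le_trans (nrB _ _))//.
  rewrite lerD ?KC// (le_trans (KM _))// ler_wpM2l// nr_joint_expi//.
have lF : F g = F q + F (g - q).
  rewrite /F (linB (lW _)) !(linB Tlin) (linB (lW _)).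
  by set a := joint_expi _ _ _ _; set b := joint_expi _ _ _ _;
    rewrite opprB addrACA [b + _]addrC subrK addKr.
have F2 : nr (F (g - q)) <= (M + M) * (e / (t0 * MK + (M + M) + 1)).
  rewrite (le_trans (nrB _ _))// nr_joint_expi// mulrDl lerD//.
    by rewrite (le_trans (TM _))// ler_wpM2l// nr_joint_expi.
  by rewrite (le_trans (TM _))// ler_wpM2l.
rewrite lF (le_trans (nrD _ _))// (le_trans (lerD F1 F2))//.
rewrite mulrDr -addrA lerD2l mulrA -mulrDl mulrCA ler_piMr ?(ltW e0)//.
by rewrite ler_pdivrMr// mul1r lerDl.
Qed.

End duhamel.

(** * Lebesgue measure on tuples *)

Section lebesgue_tuple.
Context {R : realType}.
Local Notation RT := (measurableTypeR R).
Local Notation leb := (@lebesgue_measure R).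

Definition tcons n (p : RT * n.-tuple RT) : n.+1.-tuple RT := [tuple of p.1 :: p.2].

Lemma measurable_tcons n : measurable_fun setT (@tcons n).
Proof. exact: measurable_cons measurable_fst measurable_snd. Qed.

Lemma product_lebesgue_tuple n (la : {sigma_finite_measure set (n.-tuple RT) -> \bar R})
    (A : set (n.+1.-tuple RT)) :
  (forall B, measurable B -> la B = lebesgue_tuple B) -> measurable A ->
  pushforward (leb \x la)%E (@tcons n) A = lebesgue_tuple A.
Proof.
move=> laE mA; rewrite /pushforward /product_measure1 /=.
have mA' : measurable (@tcons n @^-1` A).
  by rewrite -[_ @^-1` _]setTI; exact: measurable_tcons.
apply: eq_integral => x _; rewrite laE; last exact: measurable_xsection.
congr lebesgue_tuple; apply/seteqP; split=> t; rewrite /xsection /= ?inE//.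
Qed.

(** [lebesgue_tuple] is a bare set function. By induction it agrees on measurable sets with the
    image of a product measure under [tcons]; sigma-finiteness is transported along the inverse map
    to head and tail. *)
Lemma lebesgue_tuple_measure n :
  exists la : {sigma_finite_measure set (n.-tuple RT) -> \bar R},
    forall A, measurable A -> la A = lebesgue_tuple A.
Proof.
elim: n => [|n [la laE]].
  by exists \d_([tuple] : 0.-tuple RT).
have mc := @measurable_tcons n.
pose nu := measure_function_pushforward__canonical__measure_function_Measure
  (leb \x la)%E mc.
have [F FT [mF Foo]] : exists2 F : (set (RT * n.-tuple RT))^nat, \bigcup_k F k = setT &
    (forall k, measurable (F k)) /\ forall k, ((leb \x la)%E (F k) < +oo)%E.
  have /sigma_finiteP[F [TF ndF Foo]] := sigma_finiteT leb.
  have /sigma_finiteP[G [TG ndG Goo]] := sigma_finiteT la.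
  exists (fun k => F k `*` G k).
    rewrite -setXTT TF TG; apply/seteqP; split=> -[x y] /=; first by case=> k _ []; split; exists k.
    move=> [[k _ Fx] [l _ Gy]]; exists (maxn k l) => //; split => /=.
      by move: x Fx; exact/subsetPset/ndF/leq_maxl.
    by move: y Gy; exact/subsetPset/ndG/leq_maxr.
  split=> k; have [mF Fk] := Foo k; have [mG Gk] := Goo k; first exact: measurableX.
  by rewrite product_measure1E// lte_mul_pinfty// ge0_fin_numE.
have sf : sigma_finite setT nu.
  exists (fun k => (fun x => (thead x, [tuple of behead x])) @^-1` F k).
    apply/seteqP; split=> // x _.
    have : (\bigcup_k F k) (thead x, [tuple of behead x]) by rewrite FT.
    by case=> k _ Fk; exists k.
  move=> k; split.
    rewrite -[X in measurable X]setTI; apply: measurable_fun_pair => //.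
      exact: measurable_tnth.
    exact: measurable_behead.
  rewrite /nu /= /pushforward (_ : _ @^-1` _ = F k)//.
  apply/seteqP; split=> -[x t] /=; rewrite theadE; congr (F k (_, _)); exact/val_inj.
pose la' : {sigma_finite_measure set (n.+1.-tuple RT) -> \bar R} :=
  HB.pack (nu : set _ -> _) (Measure.class nu) (Measure_isSigmaFinite.Build _ _ _ nu sf).
by exists la' => A mA; exact: product_lebesgue_tuple.
Qed.

Lemma lebesgue_tuple_tonelli n (f : n.+1.-tuple RT -> \bar R) :
  measurable_fun setT f -> (forall x, (0 <= f x)%E) ->
  (\int[@lebesgue_tuple R n.+1]_x f x =
   \int[leb]_x \int[@lebesgue_tuple R n]_t f (tcons (x, t)))%E.
Proof.
move=> mf f0; have [la laE] := lebesgue_tuple_measure n.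
rewrite -(@eq_raw_measure_integral _ _ _ _ _ f (fun A => product_lebesgue_tuple laE (A:=A))).
rewrite (ge0_integral_pushforward (@measurable_tcons n))//.
rewrite preimage_setT fubini_tonelli1 => [||p]; [|exact: measurableT_comp mf (@measurable_tcons n)|exact: f0].
apply: eq_integral => x _; rewrite /fubini_F.
exact: eq_raw_measure_integral.
Qed.

End lebesgue_tuple.

(** * Integrals of characters over cubes *)

Section box_integral.
Context {R : realType}.
Local Notation RT := (measurableTypeR R).
Local Notation leb := (@lebesgue_measure R).

Lemma sin_int_mul_pi (N : nat) (z : int) : sin (z%:~R * (pi *+ N)) = 0 :> R.
Proof.
have sin_pin m : sin (pi *+ m) = 0 :> R.
  by elim: m => [|m ih]; rewrite ?mulr0n ?sin0// mulrSr sinDpi ih oppr0.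
by case: z => m; rewrite ?NegzE ?mulrNz ?mulNr ?sinN -pmulrn mulr_natl -mulrnA sin_pin ?oppr0.
Qed.

(** For nonzero [z] the interval consists of whole periods of the cosine, because [d * b] is a
    multiple of [pi]. *)
Lemma cos_integral (b d th : R) (N : nat) (z : int) : 0 < b -> 0 < d -> d * b = pi *+ N ->
  (\int[leb]_(x in `[(- b)%R, b]) (1 + cos (th + d * z%:~R * x))%:E =
   (2 * b * (1 + (z == 0)%:R * cos th))%:E)%E.
Proof.
move=> b0 d0 db; have bb : - b < b by lra.
have [->|z0] := eqVneq z 0.
  under eq_integral do rewrite mulr0 mul0r addr0.
  rewrite integral_cst//= lebesgue_measure_itv/= lte_fin bb -EFinB -EFinM mul1r.
  by congr _%:E; ring.
have w0 : d * z%:~R != 0 by rewrite mulf_neq0 ?intr_eq0 ?(gt_eqF d0).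
set w := d * z%:~R in w0 *.
pose F (x : R) := x + sin (th + w * x) / w.
have dF (x : R) : is_derive x 1 F (1 + cos (th + w * x)).
  have h1 : is_derive x 1 (fun x => th + w * x) w.
    by apply: is_derive_eq; rewrite add0r mul1r /GRing.scale /= mulr1.
  have h2 := @is_derive1_comp _ (@sin R) (fun x => th + w * x) x _ _ (is_derive_sin (th + w * x)) h1.
  have h3 : is_derive x 1 (fun x => sin (th + w * x) / w) (cos (th + w * x)).
    by apply: is_derive_eq; rewrite scaler0 add0r /GRing.scale /= mulrCA mulVf ?mulr1.
  exact: is_deriveD.
have cF x : {for x, continuous F}.
  by apply/differentiable_continuous/derivable1_diffP; have [] := dF x.
have cf : continuous (fun x : R => 1 + cos (th + w * x)).
  move=> x; apply: cvgD; first exact: cvg_cst.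
  apply: (@continuous_comp _ _ _ (fun x => th + w * x) cos); last exact: continuous_cos.
  by apply: cvgD; [exact: cvg_cst|apply: cvgM; [exact: cvg_cst|exact: cvg_id]].
rewrite (@continuous_FTC2 _ _ F)//.
- have wb : sin (w * b) = 0 by rewrite /w -mulrA mulrCA db sin_int_mul_pi.
  rewrite -EFinB; congr _%:E; rewrite mul0r addr0 mulr1 /F mulrN sinB sinD wb.
  by field.
- exact: continuous_subspaceT.
- split=> [x _||]; first by have [] := dF x.
    exact/cvg_at_right_filter/cF.
  exact/cvg_at_left_filter/cF.
- by move=> x _; rewrite derive1E; have [_ ->] := dF x.
Qed.

Definition box n (b : R) : set (n.-tuple RT) := [set x | forall j, `|tnth x j : R| <= b].

Lemma measurable_box n b : measurable (@box n b).
Proof.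
have -> : @box n b = \bigcap_(j in setT) slab j b.
  by apply/seteqP; split=> x bx j; [move=> _; exact: bx|exact: bx].
apply: fin_bigcap_measurable => // j _; exact: measurable_slab.
Qed.

Lemma indic_box_tcons n b (x : RT) (t : n.-tuple RT) :
  \1_(@box n.+1 b) (tcons (x, t)) = \1_(`[(- b)%R, b]%classic : set RT) x * \1_(@box n b) t :> R.
Proof.
have -> : @box n.+1 b = [set y | `|thead y : R| <= b /\ @box n b [tuple of behead y]].
  apply/seteqP; split=> y /=.
    move=> by_; split; first exact: by_.
    by move=> j; rewrite tnth_behead; exact: by_.
  by move=> [y0 y1] j; case: (unliftP ord0 j) => [i ->|-> //]; have := y1 i;
     rewrite tnth_behead; congr (`|tnth _ _| <= _); apply/val_inj; rewrite /= inordK ?ltnS.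
rewrite !indicE -natrM mulnb; congr (_ : bool)%:R.
apply/idP/andP => [/set_mem[]|[]].
  rewrite /tcons theadE /= => xb tb; split; apply/mem_set; first by rewrite /= in_itv /= -ler_norml.
  by move: tb; congr (box _); exact/val_inj.
move=> /set_mem /=; rewrite in_itv /= -ler_norml => xb /set_mem tb.
apply/mem_set; split => //=; move: tb; congr (box _); exact/val_inj.
Qed.

Lemma linform_tcons n d (k : 'rV[int]_n.+1) (x : RT) (t : n.-tuple RT) :
  linform (lattice_point d k) (tcons (x, t)) =
  d * (k 0 ord0)%:~R * x + linform (lattice_point d (\row_j k 0 (lift ord0 j))) t.
Proof.
rewrite /linform big_ord_recl /lattice_point !mxE; congr (_ + _).
by apply: eq_bigr => j _; rewrite !mxE tnthS.
Qed.

Lemma measurable_cos_linform n (a : 'rV[R]_n) (th : R) :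
  measurable_fun setT (fun x => 1 + cos (th + linform a x)).
Proof.
apply: measurable_funD => //; apply: (@measurableT_comp _ _ _ _ _ _ cos).
  by apply: continuous_measurable_fun; exact: continuous_cos.
by apply: measurable_funD => //; exact: measurable_linform.
Qed.

Lemma measurable_cos_box n (b : R) (a : 'rV[R]_n) (th : R) :
  measurable_fun setT (fun x => ((1 + cos (th + linform a x)) * \1_(box b) x)%:E).
Proof.
apply/measurable_EFinP; apply: measurable_funM; first exact: measurable_cos_linform.
by apply: measurable_indic; exact: measurable_box.
Qed.

(* [1 + cos] instead of [cos] makes the integrand nonnegative, so that Tonelli applies. *)
Lemma box_integral n (b d : R) (N : nat) : 0 < b -> 0 < d -> d * b = pi *+ N ->
  forall (th : R) (k : 'rV[int]_n),
  (\int[@lebesgue_tuple R n]_x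
     ((1 + cos (th + linform (lattice_point d k) x)) * \1_(box b) x)%:E =
   ((2 * b) ^+ n * (1 + (k == 0)%:R * cos th))%:E)%E.
Proof.
move=> b0 d0 db; elim: n => [|n ih] th k.
  have -> : k = 0 by apply/rowP; case.
  rewrite eqxx /= integral_dirac//; last exact: measurable_cos_box.
  by rewrite diracT mul1e /linform big_ord0 addr0 indicE mem_set ?mulr1 ?mul1r//; case.
rewrite lebesgue_tuple_tonelli//; last exact: measurable_cos_box.
pose k' : 'rV[int]_n := \row_j k 0 (lift ord0 j).
(* Up to the factor [(2 * b) ^+ n], this is the integral over the other coordinates, from the
   induction hypothesis with the first coordinate absorbed into the phase; hence the arbitrary
   [th]. *)
pose f (x : R) := 1 + (k' == 0)%:R * cos (th + d * (k 0 ord0)%:~R * x).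
have f0 x : 0 <= f x.
  rewrite /f; have := cos_geN1 (th + d * (k 0 ord0)%:~R * x).
  by case: (k' == 0) => /=; lra.
have mf : measurable_fun setT f.
  apply: continuous_measurable_fun => x; apply: cvgD; first exact: cvg_cst.
  apply: cvgM; first exact: cvg_cst.
  apply: (@continuous_comp _ _ _ (fun x => th + d * (k 0 ord0)%:~R * x) cos); last exact: continuous_cos.
  by apply: cvgD; [exact: cvg_cst|apply: cvgM; [exact: cvg_cst|exact: cvg_id]].
have kk : (k == 0) = (k' == 0) && (k 0 ord0 == 0).
  apply/eqP/andP => [k0|[/eqP k'0 /eqP k00]].
    by rewrite k0 mxE; split=> //; apply/eqP/rowP => i; rewrite mxE k0 !mxE.
  apply/rowP => i; rewrite mxE; case: (unliftP ord0 i) => [i' ->|->]//.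
  by have := congr1 (fun a : 'rV_n => a 0 i') k'0; rewrite !mxE.
transitivity (\int[leb]_x (((2 * b) ^+ n)%:E * (((EFin \o f) \_ `[(- b)%R, b]%classic) x)))%E.
  apply: eq_integral => x _; rewrite epatch_indic /=.
  have -> : (fun t => ((1 + cos (th + linform (lattice_point d k) (tcons (x, t)))) *
          \1_(box b) (tcons (x, t)))%:E) =
     (fun t => ((\1_(`[(- b)%R, b]%classic : set RT) x) * ((1 + cos ((th + d * (k 0 ord0)%:~R * x)
         + linform (lattice_point d k') t)) * \1_(box b) t))%:E).
    by apply/funext => t; rewrite linform_tcons indic_box_tcons addrA mulrCA.
  rewrite indicE; case: (x \in _) => /=; last first.
    have [la laE] := @lebesgue_tuple_measure R n.
    rewrite -(eq_raw_measure_integral _ laE) !mule0.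
    by apply: integral0_eq => t _; rewrite mul0r.
  under eq_fun do rewrite mul1r.
  by rewrite ih mule1 -EFinM.
rewrite ge0_integralZl_EFin//; last 3 first.
- move=> x _; rewrite epatch_indic /= mule_ge0// lee_fin//.
- by apply/(measurable_restrictT _ _).1 => //; apply/measurable_EFinP; exact: measurable_funS mf.
- by rewrite exprn_ge0// mulr_ge0// ltW.
rewrite -integral_mkcond exprSr -mulrA EFinM; congr (_ * _)%E.
rewrite kk /f; case: (k' == 0) => /=.
  under eq_integral do rewrite mul1r.
  by rewrite (cos_integral _ _ b0 d0 db).
under eq_integral do rewrite mul0r addr0.
rewrite integral_cst//= lebesgue_measure_itv/= lte_fin ifT; last lra.
by rewrite -EFinB -EFinM mul0r addr0; congr _%:E; ring.
Qed.

End box_integral.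

(** * The Bessel inequality *)

Lemma Rintegral_sum d (T : measurableType d) (R : realType) (mu : {measure set T -> \bar R})
    (D : set T) (I : Type) (r : seq I) (f : I -> T -> R) : measurable D ->
  (forall i, mu.-integrable D (EFin \o f i)) ->
  mu.-integrable D (EFin \o (fun x => \sum_(i <- r) f i x)) /\
  \int[mu]_(x in D) (\sum_(i <- r) f i x) = \sum_(i <- r) \int[mu]_(x in D) f i x.
Proof.
move=> mD hf; elim: r => [|i r [ih1 ih2]].
  rewrite big_nil; under eq_fun do rewrite big_nil.
  split; first exact: integrable0.
  by rewrite Rintegral_cst// mul0r.
have -> : (fun x => \sum_(j <- i :: r) f j x) = (fun x => f i x + \sum_(j <- r) f j x).
  by apply/funext => x; rewrite big_cons.
split; first exact: integrableD (hf i) ih1.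
by rewrite RintegralD// ih2 big_cons.
Qed.

Section bessel.
Context {R : realType} {H : completeNormedModType R[i]}.
Variable dot : {dot H for Num.conj}.
Hypothesis hdot : dot_induces_norm dot.
Context {n : nat}.
Variable E : set (n.-tuple (measurableTypeR R)) -> H -> H.
Hypothesis pE : projection_valued_measure dot E.
Variable la : {sigma_finite_measure set (n.-tuple (measurableTypeR R)) -> \bar R}.
Hypothesis laE : forall A, measurable A -> la A = lebesgue_tuple A.
Local Notation U := (joint_expi dot E).
Local Notation mu := (pvm_measure hdot pE).
Implicit Types (z : R[i]) (a : 'rV[R]_n) (m k : 'rV[int]_n).

Definition re_wave z a (x : n.-tuple (measurableTypeR R)) : R :=
  complex.Re z * cos (linform a x) - complex.Im z * sin (linform a x).

Lemma re_waveE z a x : re_wave z a x = complex.Re (z * expi (linform a x)).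
Proof. by case: z => p q; rewrite /re_wave /expi. Qed.

Lemma measurable_cos_wave a : measurable_fun setT (fun x => cos (linform a x)).
Proof.
apply: (@measurableT_comp _ _ _ _ _ _ cos); last exact: measurable_linform.
by apply: continuous_measurable_fun; exact: continuous_cos.
Qed.

Lemma measurable_sin_wave a : measurable_fun setT (fun x => sin (linform a x)).
Proof.
apply: (@measurableT_comp _ _ _ _ _ _ sin); last exact: measurable_linform.
by apply: continuous_measurable_fun; exact: continuous_sin.
Qed.

Lemma measurable_re_wave z a : measurable_fun setT (re_wave z a).
Proof.
by apply: measurable_funB; apply: measurable_funM => //;
  [exact: measurable_cos_wave|exact: measurable_sin_wave].
Qed.

Lemma integrable_cos_wave (nu : {measure set (n.-tuple (measurableTypeR R)) -> \bar R}) D a :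
  measurable D -> (nu D < +oo)%E -> nu.-integrable D (EFin \o (fun x => cos (linform a x))).
Proof.
move=> mD nuD; apply: (integrable_bounded (C := 1)) => // [|x]; first exact: measurable_cos_wave.
exact: cos_max.
Qed.

Lemma integrable_sin_wave (nu : {measure set (n.-tuple (measurableTypeR R)) -> \bar R}) D a :
  measurable D -> (nu D < +oo)%E -> nu.-integrable D (EFin \o (fun x => sin (linform a x))).
Proof.
move=> mD nuD; apply: (integrable_bounded (C := 1)) => // [|x]; first exact: measurable_sin_wave.
exact: sin_max.
Qed.

Lemma Rintegral_re_wave (nu : {measure set (n.-tuple (measurableTypeR R)) -> \bar R}) D z a :
  measurable D -> (nu D < +oo)%E ->
  \int[nu]_(x in D) re_wave z a x =
  complex.Re z * (\int[nu]_(x in D) cos (linform a x))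
  - complex.Im z * (\int[nu]_(x in D) sin (linform a x)).
Proof.
move=> mD nuD; have ic := integrable_cos_wave a mD nuD; have is_ := integrable_sin_wave a mD nuD.
rewrite /re_wave RintegralB ?RintegralZl//.
- apply: (integrable_bounded (C := `|complex.Re z|)) => // [|x].
    by apply: measurable_funM => //; exact: measurable_cos_wave.
  by rewrite normrM ler_piMr// cos_max.
- apply: (integrable_bounded (C := `|complex.Im z|)) => // [|x].
    by apply: measurable_funM => //; exact: measurable_sin_wave.
  by rewrite normrM ler_piMr// sin_max.
Qed.

Lemma integrable_re_wave (nu : {measure set (n.-tuple (measurableTypeR R)) -> \bar R}) D z a :
  measurable D -> (nu D < +oo)%E -> nu.-integrable D (EFin \o re_wave z a).
Proof.
move=> mD nuD; apply: (integrable_bounded (C := cmod z)) => // [|x]; first exact: measurable_re_wave.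
by rewrite re_waveE (le_trans (Re_le_cmod _))// cmodM cmod_expi mulr1.
Qed.

Lemma Rintegral_pvm_wave h z a :
  \int[mu h]_x re_wave z a x = complex.Re (z * dot (U a h) h).
Proof.
have [_ ->] := joint_expiP hdot pE a.
rewrite Rintegral_re_wave// ?pvm_measureT ?ltry//.
by case: z.
Qed.

Section box.
Variables (b d : R) (N : nat).
Hypotheses (b0 : 0 < b) (d0 : 0 < d) (db : d * b = pi *+ N).

Lemma lebesgue_box : la (box b) = ((2 * b) ^+ n)%:E.
Proof.
(* At the phase [pi / 2] and frequency 0 the cosine vanishes and only the volume is left. *)
have := box_integral b0 d0 db (pi / 2) (0 : 'rV[int]_n).
rewrite eqxx mul1r cos_pihalf addr0 mulr1 => <-.
have -> : (fun x => ((1 + cos (pi / 2 + linform (lattice_point d 0) x)) * \1_(box b) x)%:E) =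
    (fun x => (\1_(@box R n b) x)%:E).
  by apply/funext => x; rewrite lattice_point0 linform0 addr0 cos_pihalf addr0 mul1r.
by rewrite -(eq_raw_measure_integral _ laE) integral_indic ?setIT//; exact: measurable_box.
Qed.

Lemma lebesgue_box_fin : (la (box b) < +oo)%E.
Proof. by rewrite lebesgue_box ltry. Qed.

Lemma Rintegral_box_cos th k :
  \int[la]_(x in box b) cos (th + linform (lattice_point d k) x) =
  (2 * b) ^+ n * ((k == 0)%:R * cos th).
Proof.
have mB := @measurable_box R n b.
have loo := lebesgue_box_fin.
have ic : la.-integrable (box b) (EFin \o (fun x => cos (th + linform (lattice_point d k) x))).
  apply: (integrable_bounded (C := 1)) => // [|x]; last exact: cos_max.
  apply: (@measurableT_comp _ _ _ _ _ _ cos).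
    by apply: continuous_measurable_fun; exact: continuous_cos.
  by apply: measurable_funD => //; exact: measurable_linform.
have i1 : la.-integrable (box b) (EFin \o (fun=> 1 : R)).
  by apply: (integrable_bounded (C := 1)) => // x; rewrite normr1.
have c1 : \int[la]_(_ in box b) 1 = (2 * b) ^+ n.
  by rewrite Rintegral_cst// mul1r; exact: (congr1 fine lebesgue_box).
have := RintegralD mB i1 ic; rewrite c1.
rewrite [X in X = _](_ : _ = (2 * b) ^+ n * (1 + (k == 0)%:R * cos th)).
  by rewrite mulrDr mulr1 => /addrI.
rewrite /Rintegral integral_mkcond epatch_indic.
have := box_integral b0 d0 db th k; rewrite -(eq_raw_measure_integral _ laE) => h.
by under eq_integral do rewrite -EFinM; rewrite h.
Qed.

Lemma Rintegral_box_wave z k :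
  \int[la]_(x in box b) re_wave z (lattice_point d k) x =
  (k == 0)%:R * complex.Re z * (2 * b) ^+ n.
Proof.
rewrite Rintegral_re_wave//; [|exact: measurable_box|exact: lebesgue_box_fin].
have := Rintegral_box_cos 0 k; under eq_Rintegral do rewrite add0r.
(* The sine is the cosine with phase [- (pi / 2)]. *)
move=> ->; have := Rintegral_box_cos (- (pi / 2)) k.
under eq_Rintegral do rewrite addrC cosBpihalf.
by move=> ->; rewrite cos0 cosN cos_pihalf; ring.
Qed.

Variables (h : H) (C : R).
Hypothesis C0 : 0 <= C.
Hypothesis mu_le : forall A, measurable A -> (mu h A <= C%:E * la A)%E.
Hypothesis supp : E (box b) h = h.
Local Notation V m := (U (lattice_point d m)).

Lemma dot_lattice m k : dot (V m h) (V k h) = dot (V (m - k) h) h.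
Proof.
by rewrite lattice_pointB addrC (joint_expiD hdot pE) [RHS](joint_expi_adj hdot pE) opprK.
Qed.

(** The squared modulus of the trigonometric polynomial with coefficients [c], expanded into real
    parts of characters so that it can be integrated term by term. *)
Definition trig_square (L : seq 'rV[int]_n) (c : 'rV[int]_n -> R[i]) x :=
  \sum_(m <- L) \sum_(k <- L) re_wave (c m * conjc (c k)) (lattice_point d (m - k)) x.

Lemma trig_square_ge0 L c x : 0 <= trig_square L c x.
Proof.
pose S := \sum_(m <- L) c m * expi (linform (lattice_point d m) x).
suff -> : trig_square L c x = complex.Re (S * conjc S).
  by rewrite mulc_conj /= sqr_ge0.
have -> : conjc S = \sum_(k <- L) conjc (c k * expi (linform (lattice_point d k) x)).
  exact: rmorph_sum.
rewrite mulr_suml Re_sum; apply: eq_bigr => m _; rewrite mulr_sumr Re_sum.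
apply: eq_bigr => k _; rewrite re_waveE lattice_pointB linformD expiD conjM.
have -> : expi (linform (- lattice_point d k) x) = conjc (expi (linform (lattice_point d k) x)).
  have -> : linform (- lattice_point d k) x = - linform (lattice_point d k) x.
    by rewrite /linform -sumrN; apply: eq_bigr => j _; rewrite mxE mulNr.
  by rewrite /expi cosN sinN.
by congr complex.Re; ring.
Qed.

Lemma Rintegral_trig (nu : {measure set (n.-tuple (measurableTypeR R)) -> \bar R}) D L c :
  measurable D -> (nu D < +oo)%E ->
  nu.-integrable D (EFin \o trig_square L c) /\
  \int[nu]_(x in D) trig_square L c x = \sum_(m <- L) \sum_(k <- L)
    \int[nu]_(x in D) re_wave (c m * conjc (c k)) (lattice_point d (m - k)) x.
Proof.
move=> mD nuD.
have i1 m := Rintegral_sum L mD (fun k =>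
  integrable_re_wave (c m * conjc (c k)) (lattice_point d (m - k)) mD nuD).
have [i2 ->] := Rintegral_sum L mD (fun m => (i1 m).1).
by split=> //; apply: eq_bigr => m _; rewrite (i1 m).2.
Qed.

Lemma measurable_trig L c : measurable_fun setT (trig_square L c).
Proof.
by apply: measurable_sum => m; apply: measurable_sum => k; exact: measurable_re_wave.
Qed.

Lemma nr_trig_sum L c :
  nr (\sum_(m <- L) c m *: V m h) ^+ 2 = \int[mu h]_x trig_square L c x.
Proof.
have muT : (mu h setT < +oo)%E by rewrite pvm_measureT ltry.
have [_ ->] := Rintegral_trig L c measurableT muT.
set v : H := \sum_(m <- L) c m *: V m h.
have -> : nr v ^+ 2 = complex.Re (dot v v) by rewrite (dotxx hdot).
rewrite {1}/v dot_suml Re_sum; apply: eq_bigr => m _; rewrite /v dot_sumr Re_sum.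
apply: eq_bigr => k _; rewrite Rintegral_pvm_wave -dot_lattice.
by rewrite dotZl dotZr mulrA.
Qed.

(** The measure [<E(.)h, h>] lives on the box and is at most [C] times Lebesgue measure. For the
    latter the characters are orthogonal on the box, so that only the diagonal terms survive. *)
Lemma nr_trig_sum_le L c : uniq L -> nr (\sum_(m <- L) c m *: V m h) ^+ 2 <=
  C * (2 * b) ^+ n * \sum_(m <- L) cmod (c m) ^+ 2.
Proof.
move=> uL; rewrite nr_trig_sum.
have mB := @measurable_box R n b.
have muT : (mu h setT < +oo)%E by rewrite pvm_measureT ltry.
have muB : (mu h (box b) < +oo)%E by rewrite (pvm_measureE hdot pE)// ltry.
have [imu _] := Rintegral_trig L c measurableT muT.
have [imuB _] := Rintegral_trig L c mB muB.
have [ila lasum] := Rintegral_trig L c mB lebesgue_box_fin.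
have mtE : measurable_fun setT (EFin \o trig_square L c).
  by apply/measurable_EFinP; exact: measurable_trig.
have tE0 x : (0 <= (EFin \o trig_square L c) x)%E by rewrite lee_fin trig_square_ge0.
have -> : \int[mu h]_x trig_square L c x = \int[mu h]_(x in box b) trig_square L c x.
  rewrite /Rintegral (negligible_integral (N := ~` box b))//; last 2 first.
  - exact: measurableC.
  - have mBC := measurableC mB.
    by rewrite (pvm_measureE hdot pE _ mBC) (pvmC pE _ mB) supp subrr nr0 expr0n.
  by rewrite setTD setCK.
have le : (\int[mu h]_(x in box b) (trig_square L c x)%:E <=
    C%:E * \int[la]_(x in box b) (trig_square L c x)%:E)%E.
  have mtB : measurable_fun (box b) (EFin \o trig_square L c) by exact: measurable_funTS.
  have /= <- := ge0_integral_mscale la mB (NngNum C0) mtB (fun x _ => tE0 x).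
  apply: ge0_le_measure_integral => // A mA; exact: mu_le.
have {le} : \int[mu h]_(x in box b) trig_square L c x <=
    C * \int[la]_(x in box b) trig_square L c x.
  rewrite -lee_fin EFinM /Rintegral !fineK//; exact: integrable_fin_num.
move=> /le_trans; apply; rewrite -mulrA ler_wpM2l// lasum mulr_sumr.
rewrite !big_seq; apply: ler_sum => m mL.
rewrite (bigD1_seq m)//= [X in _ + X]big1 ?addr0; last first.
  by move=> k km; rewrite Rintegral_box_wave subr_eq0 eq_sym (negPf km) !mul0r.
by rewrite Rintegral_box_wave subrr eqxx mul1r mulc_conj /= mulrC.
Qed.

(** Duality: with [c m] the conjugate of [dot (V m h) e], the sum [S] equals [dot v e], while
    [nr v ^+ 2] is at most a constant times [S]. Cauchy-Schwarz and division by [S] conclude. *)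
Lemma bessel_lattice L e : uniq L ->
  \sum_(m <- L) cmod (dot (V m h) e) ^+ 2 <= C * (2 * b) ^+ n * nr e ^+ 2.
Proof.
move=> uL; set S := \sum_(m <- L) _; pose c m := conjc (dot (V m h) e).
pose v := \sum_(m <- L) c m *: V m h.
have S0 : 0 <= S by rewrite sumr_ge0// => m _; rewrite sqr_ge0.
have Sv : S%:C = dot v e.
  rewrite /v dot_suml /S rmorph_sum; apply: eq_bigr => m _.
  by rewrite dotZl /c mulrC mulc_conj.
have h1 : S <= nr v * nr e by rewrite -(ger0_norm S0) -cmod_real Sv (cauchy_schwarz hdot).
have h2 : nr v ^+ 2 <= C * (2 * b) ^+ n * S.
  rewrite (le_trans (nr_trig_sum_le c uL))// le_eqVlt; apply/orP; left; apply/eqP.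
  by congr (_ * _); apply: eq_bigr => m _; rewrite /c cmod_conj.
have [->|S1] := eqVneq S 0.
  by rewrite mulr_ge0 ?sqr_ge0// mulr_ge0// exprn_ge0// mulr_ge0// ltW.
have {}S1 : 0 < S by rewrite lt0r S1.
have h3 : S ^+ 2 <= (C * (2 * b) ^+ n * S) * nr e ^+ 2.
  rewrite (le_trans (_ : _ <= (nr v * nr e) ^+ 2))//.
    by rewrite ler_pXn2r ?nnegrE ?mulr_ge0 ?nr_ge0.
  by rewrite exprMn ler_wpM2r ?sqr_ge0.
by rewrite -(ler_pM2l S1) -[S * S]expr2 mulrA [S * _]mulrC.
Qed.

End box.

End bessel.
(** * The absolutely continuous subspace *)

Lemma finite_measure_of d (T : measurableType d) (R : realType) (m : {measure set T -> \bar R}) :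
  fin_num_fun m -> exists m' : {finite_measure set T -> \bar R}, forall A, m' A = m A.
Proof.
case: m => m cm /= fm.
pose fin := Measure_isFinite.Axioms_ m _ (Measure.measure_function_Content_isMeasure_mixin cm) fm.
pose m' : {finite_measure set T -> \bar R} := HB.pack m cm fin.
by exists m'.
Qed.

Section ac_density.
Context {R : realType} {H : completeNormedModType R[i]}.
Variable dot : {dot H for Num.conj}.
Hypothesis hdot : dot_induces_norm dot.
Context {n : nat}.
Variable E : set (n.-tuple (measurableTypeR R)) -> H -> H.
Hypothesis pE : projection_valued_measure dot E.
Local Notation mu := (pvm_measure hdot pE).
Implicit Types (h : H) (A : set (n.-tuple (measurableTypeR R))).

(** This form of the condition is linear in [h], unlike the quadratic one that defines
    [ac_subspace], and makes it evident that a closed subspace is obtained. *)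
Lemma ac_subspaceP h : ac_subspace dot E h <->
  forall A, measurable A -> lebesgue_tuple A = 0%E -> E A h = 0.
Proof.
have [la laE] := @lebesgue_tuple_measure R n.
split=> [ach A mA A0|h0 N N0 A mA AN].
  have /ach/(_ A mA (@subset_refl _ _)) : (@lebesgue_tuple R n).-null_set A.
    move=> B mB BA; rewrite -laE//; apply/eqP; rewrite eq_le measure_ge0 andbT.
    by rewrite -A0 -laE// le_measure ?inE.
  rewrite (diag_measureE hdot pE)// => -[] /eqP; rewrite sqrf_eq0 => /eqP.
  exact: nr_eq0.
by rewrite (diag_measureE hdot pE)// h0 ?nr0 ?expr0n//; exact: N0.
Qed.

Lemma ac_closed_subspace : closed_subspace (ac_subspace dot E).
Proof.
split=> [|a x y /ac_subspaceP hx /ac_subspaceP hy|f l fM fl]; apply/ac_subspaceP => A mA A0;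
    have lA := pvm_lin pE mA.
- exact: (lin0 lA).
- by rewrite lA hx// hy// scaler0 addr0.
apply/nr_eq0/eqP; rewrite eq_le nr_ge0 andbT; apply: le_small => e e0.
have /cvgnrP/(_ _ e0)[N /(_ N (leqnn _)) hN] := fl.
have /ac_subspaceP/(_ A mA A0) fN := fM N.
rewrite -[E A l]subr0 -fN -(linB lA) (le_lt_trans (nr_pvm hdot pE _ mA))//.
by rewrite nrBC.
Qed.

Lemma E_acP h : ac_subspace dot E (E_ac dot E h) /\
  forall m, ac_subspace dot E m -> dot (h - E_ac dot E h) m = 0.
Proof.
have [p hp] := projection_exists hdot h ac_closed_subspace.
rewrite /E_ac /orthogonal_projection; set P := [set p | _].
by have : P (get P) by apply: getPex; exists p.
Qed.

Lemma E_ac_lin : linear (E_ac dot E).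
Proof.
move=> a x y; have [Mx hx] := E_acP x; have [My hy] := E_acP y.
have [M0 Ml _] := ac_closed_subspace; have [Ms hs] := E_acP (a *: x + y).
apply: (projection_unique hdot ac_closed_subspace Ms hs); first exact: Ml.
move=> m Mm; rewrite opprD addrACA -scalerBr dotDl dotZl hx// hy//.
by rewrite mulr0 addr0.
Qed.

Lemma nr_E_ac h : nr (E_ac dot E h) <= nr h.
Proof.
have [Mh hh] := E_acP h; rewrite -(@ler_pXn2r _ 2) ?nnegrE ?nr_ge0//.
by rewrite -[h in leRHS](subrK (E_ac dot E h)) (pythagoras hdot) ?hh// lerDr sqr_ge0.
Qed.

(** [h] is cut down to the set where the density of its measure is at most [N.+1] and the point lies
    in a box; the measure of the cut vector is the restriction of that of [h]. *)
Lemma ac_dense h (e : R) : ac_subspace dot E h -> 0 < e ->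
  exists h', [/\ nr (h - h') < e,
    exists N : nat, E (box N%:R) h' = h' &
    exists2 C : R, 0 <= C & forall A, measurable A ->
      (mu h' A <= C%:E * lebesgue_tuple A)%E].
Proof.
move=> ach e0; have [la laE] := @lebesgue_tuple_measure R n.
have fin_mu : fin_num_fun (mu h).
  by move=> A mA; rewrite (pvm_measureE hdot pE).
have [muF muFE] := finite_measure_of fin_mu.
pose nu := charge_of_finite_measure muF.
have nula : nu `<< la.
  move=> N laN A mA AN; have A0 := laN A mA AN.
  rewrite [LHS]muFE (pvm_measureE hdot pE)//.
  have /ac_subspaceP -> := ach; rewrite ?nr0 ?expr0n//.
  by rewrite -laE.
pose f x := fine (Radon_Nikodym nu la x).
have fE x : Radon_Nikodym nu la x = (f x)%:E by rewrite fineK ?Radon_Nikodym_fin_num.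
have nuE A : measurable A -> (mu h A = \int[la]_(x in A) (f x)%:E)%E.
  move=> mA; have := Radon_Nikodym_integral nula mA; rewrite [LHS]muFE => ->.
  by apply: eq_integral => x _.
have fi : la.-integrable setT (EFin \o f).
  have <- : Radon_Nikodym nu la = EFin \o f by apply/funext => x; rewrite fE.
  exact: Radon_Nikodym_integrable.
have mf : measurable_fun setT f.
  by apply/measurable_EFinP; exact: measurable_int fi.
pose A (k : nat) := [set x | f x <= k.+1%:R] `&` box k.+1%:R.
have mA k : measurable (A k).
  apply: measurableI; last exact: measurable_box.
  by have := measurable_fun_le measurableT mf (measurable_cst (k.+1%:R : R)); rewrite setTI.
have [N /(_ _ (leqnn N)) hN] : exists N, forall k, (N <= k)%N -> nr (h - E (A k) h) < e.
  apply: (pvm_exhaust hdot h pE mA) => // [k l kl x [/= fx bx]|].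
    have kl' : k.+1%:R <= l.+1%:R :> R by rewrite ler_nat.
    by split => [/=|j]; [exact: le_trans fx kl'|exact: le_trans (bx j) kl'].
  apply/seteqP; split=> // x _.
  pose M := \sum_j `|tnth x j : R| + `|f x|.
  have M0 : 0 <= \sum_j `|tnth x j : R| by rewrite sumr_ge0.
  have MN : M <= (Num.truncn M).+1%:R by apply: ltW; exact: truncnS_gt.
  exists (Num.truncn M) => //; split=> [/=|j].
    by apply: le_trans MN; rewrite /M (le_trans (ler_norm _))// lerDr.
  apply: le_trans MN; rewrite /M (bigD1 j)//= -addrA lerDl addr_ge0// sumr_ge0//.
have mB := @measurable_box R n N.+1%:R.
exists (E (A N) h); split=> //.
  exists N.+1; rewrite -(pvmI pE)//.
  by congr (E _ h); rewrite /A setICA setIid.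
exists N.+1%:R => // B mB'; have mBA := measurableI _ _ mB' (mA N).
rewrite (pvm_measureE hdot pE)// -(pvmI pE)// -(pvm_measureE hdot pE)// nuE//.
have b0 : 0 < N.+1%:R :> R by [].
(* Any spacing compatible with the box serves: only the finiteness of its volume matters. *)
have db : pi / N.+1%:R * N.+1%:R = pi *+ 1 :> R by rewrite divfK ?gt_eqF.
have loo := lebesgue_box_fin laE b0 (divr_gt0 (pi_gt0 R) b0) db.
have lBA : (la (B `&` A N) < +oo)%E.
  by apply: le_lt_trans loo; rewrite le_measure ?inE// => x [_ []].
apply: (@le_trans _ _ (\int[la]_(x in B `&` A N) (cst N.+1%:R%:E x))%E).
  apply: le_integral => //.
  - exact: integrableS measurableT mBA (@subsetT _ _) fi.
  - apply: (integrable_bounded (f := fun=> N.+1%:R) (C := N.+1%:R)) => // x.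
    by rewrite ger0_norm.
  - by move=> x /set_mem [_ [/= fx _]]; rewrite lee_fin.
rewrite integral_cst// -laE// lee_wpmul2l// le_measure ?inE//.
Qed.

End ac_density.

(** * Strong limits and the conclusion *)

Section pointwise_limit.
Context {R : realType} {H : completeNormedModType R[i]}.

Lemma pointwise_limit (F : nat -> H -> H) (M : R) : 0 <= M ->
  (forall k, linear (F k)) -> (forall k h, nr (F k h) <= M * nr h) ->
  (forall h (e : R), 0 < e -> exists N, forall k l, (N <= k)%N -> (N <= l)%N ->
    nr (F k h - F l h) < e) ->
  exists S : H -> H, bounded_operator S /\ forall h, (fun k => F k h) @ \oo --> S h.
Proof.
move=> M0 lF FM cF.
have /choice[S hS] h : exists l : H, (fun k => F k h) @ \oo --> l by apply: nr_complete; exact: cF.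
exists S; split=> //; apply/bounded_operatorP; split.
  move=> a x y; apply: cvg_nr_unique (hS _) _; apply/cvgnrP => e e0.
  have c0 : 0 < cmod a + 1 by rewrite ltr_wpDl ?cmod_ge0.
  have e2 : 0 < e / 2 by rewrite divr_gt0.
  have /cvgnrP/(_ _ (divr_gt0 e2 c0))[N1 hN1] := hS x.
  have /cvgnrP/(_ _ e2)[N2 hN2] := hS y.
  exists (maxn N1 N2) => k; rewrite geq_max => /andP[/hN1 h1 /hN2 h2].
  rewrite lF opprD addrACA -scalerBr (le_lt_trans (nrD _ _))// [e]splitr ler_ltD// nrZ.
  rewrite ltr_pdivlMr// in h1; rewrite mulrC (le_trans _ (ltW h1))// ler_wpM2l ?nr_ge0//.
  by rewrite lerDl.
exists M => // x; suff key (e : R) : 0 < e -> nr (S x) <= M * nr x + e by apply/ler_addgt0Pr.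
move=> e0; have /cvgnrP/(_ _ e0)[N /(_ _ (leqnn N)) hN] := hS x.
rewrite -[S x](subKr (F N x)) (le_trans (nrB _ _))// lerD//; exact: ltW.
Qed.

End pointwise_limit.

Theorem corollary1 (R : realType) (H : completeNormedModType R[i])
  (dot : {dot H for Num.conj}) (hdot : dot_induces_norm dot)
  (Hsep : separable_space H) (Hinf : infinite_dimensional H)
  (n : nat) (hn : (3 <= n)%N)
  (X : 'I_n -> operator H)
  (Xsa : forall j, self_adjoint dot (X j))
  (Xcomm : forall j k, strongly_commute dot (X j) (X k))
  (E : set (n.-tuple (measurableTypeR R)) -> H -> H)
  (XE : joint_spectral_measure dot X E)
  (T : H -> H) (Tbounded : bounded_operator T)
  (TX : forall j, commutator_in (lorentz_ideal dot n) T (X j))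
  (xi : nat -> 'rV[R]_n)
  (xi_oo : (fun k => euclidean_norm (xi k)) @ \oo --> +oo) :
  exists S : H -> H, bounded_operator S /\
    forall h : H,
      (fun k => joint_expi dot E (- xi k)
                  (T (joint_expi dot E (xi k) (E_ac dot E h)))) @ \oo --> S h.
Proof.
have [pE XEj] := XE.
have [Tlin [M M0 TM]] := (bounded_operatorP T).1 Tbounded.
have /choice[K hK] j : exists K, lorentz_ideal dot n K /\
    forall h, op_dom (X j) h -> T (X j h) - X j (T h) = K h.
  by have [_ [K iK hK]] := TX j; exists K.
have lU a := joint_expi_lin hdot pE a.
pose F k h := joint_expi dot E (- xi k) (T (joint_expi dot E (xi k) h)).
have lF k : linear (F k) by move=> a x y; rewrite /F lU Tlin lU.
have FM k h : nr (F k h) <= M * nr h.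
  by rewrite /F nr_joint_expi// (le_trans (TM _))// nr_joint_expi.
have ltruncated h : (exists N : nat, E (box N%:R) h = h) ->
    (exists2 C : R, 0 <= C & forall A, measurable A ->
      (pvm_measure hdot pE h A <= C%:E * lebesgue_tuple A)%E) ->
    forall e : R, 0 < e -> exists N, forall k l, (N <= k)%N -> (N <= l)%N ->
      nr (F k h - F l h) < e.
  move=> [b hb] [C C0 hC] e e0.
  apply: (orbit_cauchy hdot hn lU _ _ _ _ M0 TM (K := K) _ _ _ xi_oo) e0 => //.
  - by move=> a x; exact: nr_joint_expi.
  - by move=> a a' x; exact: joint_expiD.
  - by move=> a x y; exact: joint_expi_adj.
  - by move=> x j e' e'0; exact: joint_expi_continuous.
  - by move=> j; have [] := hK j.
  - move=> j t0 g C' t00 KC.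
    have [[bK _] _] : lorentz_ideal dot n (K j) by have [] := hK j.
    have [Klin [MK MK0 KM]] := (bounded_operatorP (K j)).1 bK.
    apply: (duhamel hdot pE (Xsa j) (XEj j) Tlin M0 TM Klin MK0 KM _ _ t00 KC).
      by have [] := TX j.
    by have [] := hK j.
  - move=> p; have d0 : 0 < p.+1%:R^-1 :> R by rewrite invr_gt0.
    have [la laE] := @lebesgue_tuple_measure R n.
    (* The box of half-side [b'] contains that of half-side [b], as [1 <= pi], and [b'] times the
       mesh [p.+1%:R^-1] is a multiple of [pi]. *)
    pose b' : R := (pi *+ b.+1) * p.+1%:R.
    have pi1 : 1 <= pi :> R by have := pi_ge2 R; lra.
    have b'0 : 0 < b' by rewrite mulr_gt0// pmulrn_lgt0// pi_gt0.
    have bb' : b%:R <= b'.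
      rewrite /b' -[pi *+ _]mulr_natr -mulrA -natrM (@le_trans _ _ (b.+1 * p.+1)%:R)//.
        by rewrite ler_nat (leq_trans (leqnSn b))// leq_pmulr.
      by rewrite ler_peMl.
    have db : p.+1%:R^-1 * b' = pi *+ b.+1 by rewrite /b' mulrC mulfK ?gt_eqF.
    exists (C * (2 * b') ^+ n); split.
      by rewrite mulr_ge0// exprn_ge0// mulr_ge0// ltW.
    move=> L uL e'; apply: (bessel_lattice laE b'0 d0 db C0) => //.
      by move=> A mA; rewrite laE//; exact: hC.
    rewrite -hb -(pvmI pE); [|exact: measurable_box..].
    congr (E _ h); apply/seteqP; split=> x; first by case.
    by move=> bx; split=> // j; exact: le_trans (bx j) bb'.
apply: (pointwise_limit (F := fun k h => F k (E_ac dot E h)) M0).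
- by move=> k a x y; rewrite (E_ac_lin hdot pE) lF.
- by move=> k h; rewrite (le_trans (FM _ _))// ler_wpM2l// nr_E_ac.
move=> h e e0; have [ach _] := E_acP hdot pE h.
set g := E_ac dot E h in ach *.
have M1 : 0 < M + 1 by rewrite ltr_wpDl.
have e3 : 0 < e / 3 by rewrite divr_gt0.
have [g' [gg' hb hC]] := ac_dense hdot pE ach (divr_gt0 e3 M1).
have [N hN] := ltruncated g' hb hC _ e3; exists N => k l Nk Nl.
have d k' : nr (F k' g - F k' g') <= e / 3.
  rewrite -(linB (lF k')) (le_trans (FM _ _))//; rewrite ltr_pdivlMr// in gg'.
  by rewrite (le_trans _ (ltW gg'))// mulrC ler_wpM2l ?nr_ge0// lerDl.
have e33 : e / 3 + e / 3 + e / 3 = e by field.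
have -> : F k g - F l g = (F k g - F k g') + (F k g' - F l g') - (F l g - F l g').
  by rewrite subrKA opprB subrKA.
rewrite (le_lt_trans (nrB _ _))// -e33 ltr_leD//.
by rewrite (le_lt_trans (nrD _ _))// ler_ltD// hN.
Qed.
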